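(* Consider the solutions $u(z;g_2,\lambda,g_3)$ of $u''=6u^2-6\lambda z-\tfrac12g_2$ for which only one of the parameters $g_2,\lambda,g_3$ is non-zero, and set $k=4$, $5$, $6$ according to whether the non-zero parameter is $g_2$, $\lambda$, $g_3$ respectively. Then $u$ is invariant under the scaling $z\to\xi z$, $u\to\xi^{-2}u$, where $\xi$ is a $k$th root of unity (that is, $u(\xi z)=\xi^{-2}u(z)$), and the normalized coefficients $F_n$ satisfy $$ \lim_{n\to\infty}F_{kn}=k . $$
   Context: For complex $g_2,\lambda,g_3$, $u(z)=u(z;g_2,\lambda,g_3)$ denotes the meromorphic solution on $\mathbb{C}$ of $\frac{d^2u}{dz^2}=6u^2-6\lambda z-\frac{g_2}{2}$ with a double pole at $z=0$ whose Laurent expansion there is $u(z)=\sum_{n\ge0}c_nz^{n-2}$ with $c_0=1$ and $c_6=g_3/28$ (all other coefficients are then determined by the differential equation; $c_6$ is the only free coefficient). It has the Mittag-Leffler expansion $u(z)=\frac1{z^2}+\sum_{\Omega\ne0}\left(\frac1{(z-\Omega)^2}-\frac1{\Omega^2}\right)$, where the sum is over all non-zero poles $\Omega$ of $u$, and the sums $\sum_{\Omega\neq 0}\Omega^{-n}$ converge absolutely for $n\ge3$, with $c_n=(n-1)\sum_{\Omega\ne0}\Omega^{-n}$. Let $\Omega_*$ be a non-zero pole of $u$ of minimal modulus. The normalized coefficients $F_n$ ($n\ge3$) are defined by $$c_n=\frac{n-1}{\Omega_*^n}F_n,\qquad F_n=\sum_{\hat\Omega\ne0}\hat\Omega^{-n},$$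 the sum being over the rescaled non-zero poles $\hat\Omega=\Omega/\Omega_*$. *)

(* Defs.v *)
From Stdlib Require Export Reals.
From Coquelicot Require Export Coquelicot.

Local Open Scope C_scope.

(* For a function that is holomorphic on a punctured neighbourhood of [a], [a]
   is a pole exactly when |u(z)| tends to infinity as z tends to a.  The value
   [u a] is irrelevant. *)
Definition is_pole (u : C -> C) (a : C) : Prop :=
  filterlim (fun z : C => Cmod (u z)) (locally' a) (Rbar_locally p_infty).

(* Meromorphic on the whole plane.  [u] is a total function whose value at a
   pole is arbitrary; a removable singularity must carry its limit value. *)
Definition meromorphic (u : C -> C) : Prop :=
  forall a : C,
    locally' a (fun z : C => ex_derive (K := C_AbsRing) (V := C_NormedModule) u z)
    /\ (ex_derive (K := C_AbsRing) (V := C_NormedModule) u a \/ is_pole u a).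

Definition solves_ode (g2 lambda : C) (u : C -> C) : Prop :=
  exists du : C -> C,
    forall z : C, ~ is_pole u z ->
      is_derive (K := C_AbsRing) (V := C_NormedModule) u z (du z)
      /\ is_derive (K := C_AbsRing) (V := C_NormedModule) du z
           (6 * u z ^ 2 - 6 * lambda * z - g2 / 2).

(* u(z) = sum_(n >= 0) c_n z^(n-2) on a punctured disc around 0. *)
Definition laurent_at_0 (u : C -> C) (c : nat -> C) : Prop :=
  exists r : R, (0 < r)%R /\
    forall z : C, z <> 0 -> (Cmod z < r)%R ->
      is_series (K := C_AbsRing) (V := C_NormedModule)
        (fun n : nat => c n * (z ^ n / z ^ 2)) (u z).

(* [u] is u(.; g2, lambda, g3), and [c] is its sequence of Laurent
   coefficients at 0. *)
Definition is_solution (g2 lambda g3 : C) (u : C -> C) (c : nat -> C) : Prop :=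
  meromorphic u
  /\ solves_ode g2 lambda u
  /\ laurent_at_0 u c
  /\ c 0%nat = 1
  /\ c 6%nat = g3 / 28.

Definition minimal_nonzero_pole (u : C -> C) (Omega : C) : Prop :=
  Omega <> 0 /\ is_pole u Omega
  /\ forall Omega' : C, Omega' <> 0 -> is_pole u Omega' ->
       (Cmod Omega <= Cmod Omega')%R.

(* For n >= 3, this says that F_n is the sum of (Omega' / Omega)^(-n) over the
   non-zero poles Omega' of u, by the Mittag-Leffler expansion of u. *)
Definition normalized_coefficients
    (c : nat -> C) (Omega : C) (F : nat -> C) : Prop :=
  forall n : nat, (3 <= n)%nat ->
    c n = (RtoC (INR n) - 1) / Omega ^ n * F n.

Definition only_nonzero_parameter (g2 lambda g3 : C) (k : nat) : Prop :=
  (g2 <> 0 /\ lambda = 0 /\ g3 = 0 /\ k = 4%nat)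
  \/ (g2 = 0 /\ lambda <> 0 /\ g3 = 0 /\ k = 5%nat)
  \/ (g2 = 0 /\ lambda = 0 /\ g3 <> 0 /\ k = 6%nat).

(* u(xi z) = xi^(-2) u(z), as meromorphic functions of z. *)
Definition scaling_invariant (u : C -> C) (xi : C) : Prop :=
  forall z : C,
    (is_pole u (xi * z) <-> is_pole u z)
    /\ (~ is_pole u z -> u (xi * z) = / xi ^ 2 * u z).

(* Main.v *)
(* The scaling u(z) -> a^2 u(a z) maps solutions to solutions and multiplies c_n by a^n.
   Since the equation determines all c_n from c_6, a k-th root of unity fixes the
   coefficients, and the identity theorem (uniqueness for the differential equation along
   segments avoiding the isolated poles) gives the invariance of u.

   For the limit, scale so that the closest pole has modulus 1 and c_k > 0.  The recurrence
   (n - 6)(n + 1) c_n = 6 sum_(0 < j < n) c_j c_(n - j) then makes every c_n nonnegative, and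
   zero unless k divides n.  The radius of convergence is 1: bounded c_n r^n would, by the
   same recurrence, decay geometrically, so u cannot be regular on the circle of
   convergence at the positive real point.  Along a ray x with x^k <> 1, |u| is dominated
   by a rescaled copy q^2 u(q s), q < 1, of the positive solution, which is still bounded at
   s = 1; so the only poles on the unit circle are the k-th roots of unity.  At such a pole u
   is 1/(z - 1)^2 plus a bounded function.  Subtracting the k double poles leaves a function
   that is bounded on the unit disc, and the Cauchy estimate gives
   c_(k n) = k (k n - 1) + O(1), that is F_(k n) -> k. *)

Require Import Defs.
From Stdlib Require Import Lra Lia Psatz PeanoNat Wf_nat.
Local Open Scope R_scope.

(** Contour integrals and analytic continuation are avoided: complex derivatives are used only along
    segments, where the equation is a system in a real variable and Gronwall's inequality gives
    uniqueness. The Cauchy estimate accordingly becomes a finite average over roots of unity, and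
    the double pole is found by integrating (u / u')' along segments that end at it. The comparison
    off the positive ray has to begin with a strict inequality, because the dominating solution
    itself blows up at 1. A gap at s = 1/2, uniform in the direction, leaves room for some q < 1; it
    comes from the consecutive multiples 2k and 3k of k, whose phases differ by x^k. When lambda is
    non-zero the equation is not autonomous and has no first integral to describe the pole; a
    corrected energy, bounded instead of constant, takes its place. Making c_k positive fixes the
    rotation, so the nearest pole cannot also be placed at 1 by choice. The bound off the rays
    forces its k-th power to be 1, and the invariance under roots of unity then moves it to 1. *)

(** * Continuity arguments and differential inequalities on real intervals *)

Lemma pow_le_1 (s : R) (n : nat) : 0 <= s <= 1 -> s ^ n <= 1.
Proof. intros Hs. rewrite <- (pow1 n). apply pow_incr. exact Hs. Qed.

Lemma pos_min (a b : R) : 0 < a -> 0 < b -> exists r, 0 < r /\ r <= a /\ r <= b.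
Proof. intros Ha Hb. exists (Rmin a b). split; [apply Rmin_pos; assumption|]. split; [apply Rmin_l|apply Rmin_r]. Qed.

(** Continuous induction: the supremum of the x such that [P] holds on all of [a, x] satisfies [P]
    by the closure hypothesis and cannot lie below [b] by the opening one. *)
Lemma real_induction (P : R -> Prop) (a b : R) :
  a <= b -> P a ->
  (forall x, a <= x < b -> (forall y, a <= y <= x -> P y) ->
     exists d, 0 < d /\ forall y, x < y < x + d -> y <= b -> P y) ->
  (forall x, a < x <= b -> (forall y, a <= y < x -> P y) -> P x) ->
  forall x, a <= x <= b -> P x.
Proof.
  intros Hab Ha Hopen Hcl.
  set (E := fun x => a <= x <= b /\ forall y, a <= y <= x -> P y).
  assert (Ea : E a).
  { split; [lra|]. intros y Hy. replace y with a by lra. exact Ha. }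
  destruct (completeness E) as [m [Hub Hlub]].
  { exists b. intros x [Hx _]. lra. }
  { exists a. exact Ea. }
  assert (Ham : a <= m) by (apply Hub, Ea).
  assert (Hmb : m <= b) by (apply Hlub; intros x [Hx _]; lra).
  assert (Hlt : forall y, a <= y < m -> P y).
  { intros y Hy. destruct (Classical_Prop.classic (exists x, E x /\ y < x)) as [[x [[Hx HP] Hyx]]|H].
    - apply HP; lra.
    - exfalso. assert (m <= y); [|lra]. apply Hlub. intros x Hx.
      apply Rnot_lt_le. intros Hyx. apply H. exists x. split; assumption. }
  assert (Hm : P m).
  { destruct (Req_dec a m) as [e|e]; [rewrite <- e; exact Ha|]. apply Hcl; [lra|exact Hlt]. }
  assert (Hle : forall y, a <= y <= m -> P y).
  { intros y Hy. destruct (Req_dec y m) as [e|e]; [rewrite e; exact Hm|]. apply Hlt; lra. }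
  assert (m = b).
  { destruct (Req_dec m b) as [e|e]; [exact e|exfalso].
    destruct (Hopen m ltac:(lra) Hle) as [d [Hd Hnext]].
    set (x := Rmin (m + d / 2) b).
    assert (Hx : m < x <= b /\ x < m + d).
    { unfold x. split; [split|]; [apply Rmin_glb_lt; lra | apply Rmin_r |].
      apply Rle_lt_trans with (1 := Rmin_l _ _). lra. }
    assert (E x).
    { split; [lra|]. intros y Hy. destruct (Rle_lt_dec y m) as [h|h]; [apply Hle; lra|].
      apply Hnext; lra. }
    specialize (Hub x H). lra. }
  intros x Hx. apply Hle. lra.
Qed.

(** Connectedness of [a, b]. Points near [s] are compared with each other and not only with [s], so
    a property can be carried across an exceptional centre such as a pole. *)
Lemma locally_constant_prop (Q : R -> Prop) (a b : R) :
  a <= b ->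
  (forall s, a <= s <= b -> exists d, 0 < d /\
     forall s1 s2, a <= s1 <= b -> a <= s2 <= b ->
       Rabs (s1 - s) < d -> Rabs (s2 - s) < d -> Q s1 -> Q s2) ->
  Q a -> Q b.
Proof.
  intros Hab Hloc Ha.
  apply (real_induction Q a b Hab Ha); [| |lra].
  - intros x Hx HP. destruct (Hloc x ltac:(lra)) as [d [Hd H]].
    exists d. split; [exact Hd|]. intros y Hy Hyb.
    apply (H x y); try lra; [| |apply HP; lra]; apply Rabs_def1; lra.
  - intros x Hx HP. destruct (Hloc x ltac:(lra)) as [d [Hd H]].
    set (y := Rmax a (x - d / 2)).
    assert (Hy : a <= y < x /\ x - d < y).
    { unfold y. split; [split; [apply Rmax_l|apply Rmax_lub_lt; lra]|].
      apply Rlt_le_trans with (2 := Rmax_r _ _). lra. }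
    apply (H y x); try lra; [| |apply HP; lra]; apply Rabs_def1; lra.
Qed.

Lemma mean_value (f df : R -> R) (a b : R) :
  a <= b -> (forall t, a <= t <= b -> is_derive f t (df t)) ->
  exists c, a <= c <= b /\ f b - f a = df c * (b - a).
Proof.
  intros Hab H. destruct (MVT_gen f a b df) as [c [Hc E]].
  - rewrite (Rmin_left _ _ Hab), (Rmax_right _ _ Hab). intros x Hx. apply H. lra.
  - rewrite (Rmin_left _ _ Hab), (Rmax_right _ _ Hab). intros x Hx.
    apply continuity_pt_filterlim. apply (ex_derive_continuous f). eexists. apply H, Hx.
  - rewrite (Rmin_left _ _ Hab), (Rmax_right _ _ Hab) in Hc. exists c. split; assumption.
Qed.

(** The product of [N] with exp(-K (t - a)) has nonpositive derivative. *)
Lemma gronwall (N dN : R -> R) (K a b : R) :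
  a <= b -> (forall t, a <= t <= b -> is_derive N t (dN t) /\ dN t <= K * N t) ->
  N b <= N a * exp (K * (b - a)).
Proof.
  intros Hab H.
  destruct (mean_value (fun t => N t * exp (- K * (t - a)))
    (fun t => (dN t - K * N t) * exp (- K * (t - a))) a b Hab) as [c [Hc E]].
  { intros t Ht. destruct (H t Ht) as [Hd _].
    assert (ex_derive N t) by (eexists; exact Hd).
    auto_derive; [exact H0|]. change (Derive (fun x : R => N x) t) with (Derive N t). rewrite (is_derive_unique N t _ Hd). unfold Rminus. ring. }
  assert (Hneg : N b * exp (- K * (b - a)) <= N a).
  { replace (N a) with (N a * exp (- K * (a - a))).
    2:{ replace (- K * (a - a)) with 0 by ring. rewrite exp_0. ring. }
    destruct (H c Hc) as [_ Hle]. pose proof (exp_pos (- K * (c - a))).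
    assert ((dN c - K * N c) * exp (- K * (c - a)) * (b - a) <= 0); [|lra].
    assert ((dN c - K * N c) * exp (- K * (c - a)) <= 0) by nra. nra. }
  pose proof (exp_pos (K * (b - a))).
  replace (N b) with (N b * exp (- K * (b - a)) * exp (K * (b - a))).
  - apply Rmult_le_compat_r; lra.
  - rewrite Rmult_assoc, <- exp_plus. replace (- K * (b - a) + K * (b - a)) with 0 by ring.
    rewrite exp_0. ring.
Qed.

(** * The complex modulus and its support directions *)

Lemma Re_plus (x y : C) : Re (x + y)%C = Re x + Re y.
Proof. reflexivity. Qed.
Lemma Im_plus (x y : C) : Im (x + y)%C = Im x + Im y.
Proof. reflexivity. Qed.
Lemma Re_mult (x y : C) : Re (x * y)%C = Re x * Re y - Im x * Im y.
Proof. reflexivity. Qed.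
Lemma Im_mult (x y : C) : Im (x * y)%C = Re x * Im y + Im x * Re y.
Proof. reflexivity. Qed.

Lemma Cmod_sub_ge (x y : C) : Cmod x - Cmod y <= Cmod (x - y)%C.
Proof.
  pose proof (Cmod_triangle (x - y) y) as H.
  replace (x - y + y)%C with x in H by ring. lra.
Qed.

Lemma Cmod_minus_sym (x y : C) : Cmod (x - y)%C = Cmod (y - x)%C.
Proof. rewrite <- Cmod_opp. f_equal. ring. Qed.

Lemma Cmod_sqr (x : C) : Cmod x * Cmod x = Re x * Re x + Im x * Im x.
Proof. pose proof (Cmod2_alt x). simpl in H. lra. Qed.

Lemma Re_dir_le (e z : C) : Cmod e = 1 -> Re (e * z)%C <= Cmod z.
Proof.
  intros He. pose proof (re_le_Cmod (e * z)) as H. rewrite Cmod_mult, He in H.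
  pose proof (Rle_abs (Re (e * z)%C)). lra.
Qed.

Lemma Re_dir_attained (z : C) : exists e : C, Cmod e = 1 /\ Re (e * z)%C = Cmod z.
Proof.
  destruct (Req_dec (Cmod z) 0) as [H|H].
  - exists (RtoC 1). split; [apply Cmod_1|]. apply Cmod_eq_0 in H as H'. rewrite H'.
    rewrite Cmod_0. simpl. ring.
  - exists (/ Cmod z * Cconj z)%C. rewrite <- RtoC_inv by exact H.
    assert (0 < Cmod z) by (pose proof (Cmod_ge_0 z); lra).
    assert (0 < / Cmod z) by (apply Rinv_0_lt_compat; lra). split.
    + rewrite Cmod_mult, Cmod_R, Cmod_conj, Rabs_right by lra. field. lra.
    + rewrite Re_mult. unfold Cconj. rewrite Im_mult. simpl.
      pose proof (Cmod_sqr z) as E. unfold Re, Im in *.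
      apply (Rmult_eq_reg_r (Cmod z)); [|exact H]. rewrite E. field_simplify; [|exact H]. field; exact H.
Qed.

(** The modulus is the supremum of Re (e z) over |e| = 1. It is not differentiable at 0, whereas
    each Re (e z) is real linear, so estimates along curves are made for a fixed [e] and collected
    here. *)
Lemma Cmod_le_dir (z : C) (M : R) :
  (forall e : C, Cmod e = 1 -> Re (e * z)%C <= M) -> Cmod z <= M.
Proof. intros H. destruct (Re_dir_attained z) as [e [He E]]. rewrite <- E. apply H, He. Qed.

(** * Calculus for complex-valued functions of a real variable *)

(** Componentwise, so that the real mean value theorem and Gronwall's inequality apply; complex
    derivatives enter through their restrictions to lines. *)
Definition cder (f : R -> C) (t : R) (l : C) : Prop :=
  is_derive (fun s => Re (f s)) t (Re l) /\ is_derive (fun s => Im (f s)) t (Im l).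

Lemma cder_eq (f : R -> C) (t : R) (l l' : C) : cder f t l -> l = l' -> cder f t l'.
Proof. intros H <-. exact H. Qed.

Lemma cder_ext_loc (f g : R -> C) (t : R) (l : C) :
  (exists d, 0 < d /\ forall s, Rabs (s - t) < d -> f s = g s) -> cder f t l -> cder g t l.
Proof.
  intros [d [Hd E]] [H1 H2]. split.
  - eapply is_derive_ext_loc; [|exact H1]. exists (mkposreal d Hd). intros y Hy. f_equal. apply E, Hy.
  - eapply is_derive_ext_loc; [|exact H2]. exists (mkposreal d Hd). intros y Hy. f_equal. apply E, Hy.
Qed.

Lemma cder_const (c : C) (t : R) : cder (fun _ => c) t 0%C.
Proof. split; apply @is_derive_const. Qed.

Lemma cder_id (t : R) : cder (fun s => RtoC s) t 1%C.
Proof. split; simpl; [apply @is_derive_id | apply @is_derive_const]. Qed.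

Lemma cder_RtoC (f : R -> R) (t l : R) : is_derive f t l -> cder (fun s => RtoC (f s)) t (RtoC l).
Proof. intros H. split; simpl; [exact H | apply @is_derive_const]. Qed.

Lemma cder_plus (f g : R -> C) (t : R) (a b : C) :
  cder f t a -> cder g t b -> cder (fun s => f s + g s)%C t (a + b)%C.
Proof.
  intros [H1 H2] [H3 H4]. split.
  - apply (is_derive_plus (fun s => Re (f s)) (fun s => Re (g s)) t _ _ H1 H3).
  - apply (is_derive_plus (fun s => Im (f s)) (fun s => Im (g s)) t _ _ H2 H4).
Qed.

Lemma is_derive_mult_R (f g : R -> R) (t a b : R) :
  is_derive f t a -> is_derive g t b -> is_derive (fun s => f s * g s) t (a * g t + f t * b).
Proof. intros H1 H2. apply (is_derive_mult f g t a b H1 H2). intros; apply Rmult_comm. Qed.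

Lemma cder_mult (f g : R -> C) (t : R) (a b : C) :
  cder f t a -> cder g t b -> cder (fun s => f s * g s)%C t (a * g t + f t * b)%C.
Proof.
  intros [H1 H2] [H3 H4]. split.
  - pose proof (is_derive_minus _ _ t _ _ (is_derive_mult_R _ _ t _ _ H1 H3)
      (is_derive_mult_R _ _ t _ _ H2 H4)) as H.
    eapply is_derive_ext; [|eapply (eq_ind _ (fun l => is_derive _ t l) H)].
    + intros s. reflexivity.
    + rewrite Re_plus, !Re_mult. unfold minus, plus, opp; simpl. ring.
  - pose proof (is_derive_plus _ _ t _ _ (is_derive_mult_R _ _ t _ _ H1 H4)
      (is_derive_mult_R _ _ t _ _ H2 H3)) as H.
    eapply is_derive_ext; [|eapply (eq_ind _ (fun l => is_derive _ t l) H)].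
    + intros s. reflexivity.
    + rewrite Im_plus, !Im_mult. unfold plus; simpl. ring.
Qed.

Lemma cder_scal (c : C) (f : R -> C) (t : R) (a : C) :
  cder f t a -> cder (fun s => c * f s)%C t (c * a)%C.
Proof. intros H. eapply cder_eq; [apply (cder_mult _ _ _ _ _ (cder_const c t) H)|]. cbv beta. ring. Qed.

Lemma cder_opp (f : R -> C) (t : R) (a : C) : cder f t a -> cder (fun s => - f s)%C t (- a)%C.
Proof. intros [H1 H2]. split; [apply (is_derive_opp _ t _ H1) | apply (is_derive_opp _ t _ H2)]. Qed.

Lemma cder_minus (f g : R -> C) (t : R) (a b : C) :
  cder f t a -> cder g t b -> cder (fun s => f s - g s)%C t (a - b)%C.
Proof. intros H1 H2. apply cder_plus; [exact H1 | apply cder_opp, H2]. Qed.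

Lemma cder_Cmod_sqr (f : R -> C) (t : R) (a : C) :
  cder f t a ->
  is_derive (fun s => Cmod (f s) * Cmod (f s)) t (2 * (Re (f t) * Re a + Im (f t) * Im a)).
Proof.
  intros [H1 H2].
  apply (is_derive_ext (fun s => Re (f s) * Re (f s) + Im (f s) * Im (f s))).
  { intros s. symmetry. apply Cmod_sqr. }
  pose proof (is_derive_plus _ _ t _ _ (is_derive_mult_R _ _ t _ _ H1 H1)
      (is_derive_mult_R _ _ t _ _ H2 H2)) as H.
  eapply (eq_ind _ (fun l => is_derive _ t l) H). unfold plus; simpl. ring.
Qed.

Lemma Cdot_le (x y : C) : Re x * Re y + Im x * Im y <= Cmod x * Cmod y.
Proof.
  pose proof (re_le_Cmod (x * Cconj y)) as H. rewrite Cmod_mult, Cmod_conj in H.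
  pose proof (Rle_abs (Re (x * Cconj y)%C)) as H'. rewrite Re_mult in H, H'.
  unfold Cconj in *. simpl in *. unfold Re, Im in *. lra.
Qed.

Lemma cder_dir (e : C) (f : R -> C) (t : R) (a : C) :
  cder f t a -> is_derive (fun s => Re (e * f s)%C) t (Re (e * a)%C).
Proof. intros H. apply (cder_scal e) in H. exact (proj1 H). Qed.

(** The intermediate point of the real mean value theorem depends on the direction [e], so only an
    inequality survives for complex values. *)
Lemma cder_mean_value (f df : R -> C) (a b M : R) :
  a <= b -> (forall t, a <= t <= b -> cder f t (df t) /\ Cmod (df t) <= M) ->
  Cmod (f b - f a)%C <= M * (b - a).
Proof.
  intros Hab H. apply Cmod_le_dir. intros e He.
  destruct (mean_value (fun s => Re (e * f s)%C) (fun s => Re (e * df s)%C) a b Hab) as [c [Hc E]].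
  { intros t Ht. apply cder_dir, H, Ht. }
  replace (e * (f b - f a))%C with (e * f b - e * f a)%C by ring.
  change (Re (e * f b - e * f a)%C) with (Re (e * f b)%C - Re (e * f a)%C).
  rewrite E. apply Rmult_le_compat_r; [lra|].
  apply Rle_trans with (1 := Re_dir_le e _ He). apply H, Hc.
Qed.

Lemma cder_continuous (f : R -> C) (t : R) (l : C) :
  cder f t l -> forall eps, 0 < eps -> exists d, 0 < d /\
    forall s, Rabs (s - t) < d -> Cmod (f s - f t)%C < eps.
Proof.
  intros [H1 H2] eps Heps.
  assert (C1 : continuous (fun s => Re (f s)) t) by (apply (ex_derive_continuous (fun s => Re (f s))); eexists; exact H1).
  assert (C2 : continuous (fun s => Im (f s)) t) by (apply (ex_derive_continuous (fun s => Im (f s))); eexists; exact H2).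
  assert (He : 0 < eps / 2) by lra.
  destruct (proj1 (filterlim_locally (fun s => Re (f s)) (Re (f t))) C1 (mkposreal _ He)) as [d1 D1].
  destruct (proj1 (filterlim_locally (fun s => Im (f s)) (Im (f t))) C2 (mkposreal _ He)) as [d2 D2].
  exists (Rmin d1 d2). split; [apply Rmin_pos; [apply d1|apply d2]|].
  intros s Hs.
  assert (B1 : Rabs (Re (f s) - Re (f t)) < eps / 2).
  { apply (D1 s). apply Rlt_le_trans with (1 := Hs). apply Rmin_l. }
  assert (B2 : Rabs (Im (f s) - Im (f t)) < eps / 2).
  { apply (D2 s). apply Rlt_le_trans with (1 := Hs). apply Rmin_r. }
  pose proof (Cmod_sqr (f s - f t)%C) as E.
  change (Re (f s - f t)%C) with (Re (f s) - Re (f t)) in E.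
  change (Im (f s - f t)%C) with (Im (f s) - Im (f t)) in E.
  apply Rabs_def2 in B1. apply Rabs_def2 in B2.
  pose proof (Cmod_ge_0 (f s - f t)%C). nra.
Qed.

(** Near [t] the inverse is conj(f) / |f|^2: conjugation commutes with differentiation in a real
    variable, and the denominator is a positive real function. *)
Lemma cder_inv (f : R -> C) (t : R) (a : C) :
  f t <> 0%C -> cder f t a -> cder (fun s => / f s)%C t (- a / (f t * f t))%C.
Proof.
  intros Hn H. pose proof (cder_Cmod_sqr f t a H) as DN. pose proof (proj1 (Cmod_gt_0 _) Hn) as Hpos.
  assert (EN : forall s, RtoC (Cmod (f s) * Cmod (f s)) = (f s * Cconj (f s))%C).
  { intros s. rewrite Cmod_sqr. apply injective_projections; simpl; unfold Re, Im; ring. }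
  assert (Hc : Cconj (f t) <> 0%C) by (apply Cmod_gt_0; rewrite Cmod_conj; exact Hpos).
  assert (DC : cder (fun s => Cconj (f s)) t (Cconj a)).
  { destruct H as [H1 H2]. split; [exact H1|apply (is_derive_opp _ t _ H2)]. }
  apply (cder_ext_loc (fun s => Cconj (f s) * RtoC (/ (Cmod (f s) * Cmod (f s))))%C).
  { destruct (cder_continuous f t a H (Cmod (f t)) Hpos) as [d [Hd B]]. exists d. split; [exact Hd|].
    intros s Hs. specialize (B s Hs). pose proof (Cmod_sub_ge (f t) (f s)) as T. rewrite Cmod_minus_sym in T.
    assert (Hs0 : 0 < Cmod (f s)) by lra. rewrite RtoC_inv by (apply Rgt_not_eq; nra). rewrite EN. field.
    split; apply Cmod_gt_0; rewrite ?Cmod_conj; exact Hs0. }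
  eapply cder_eq.
  - apply cder_mult; [exact DC|]. apply cder_RtoC, is_derive_inv; [exact DN|apply Rgt_not_eq; nra].
  - cbv beta. rewrite RtoC_inv by (apply Rgt_not_eq; nra). rewrite RtoC_div by (apply pow_nonzero, Rgt_not_eq; nra). rewrite RtoC_opp.
    replace (RtoC ((Cmod (f t) * Cmod (f t)) ^ 2)) with ((f t * Cconj (f t)) ^ 2)%C by (rewrite RtoC_pow, EN; reflexivity).
    replace (RtoC (2 * (Re (f t) * Re a + Im (f t) * Im a))) with (a * Cconj (f t) + f t * Cconj a)%C
      by (apply injective_projections; simpl; unfold Re, Im; ring).
    rewrite EN. field. split; assumption.
Qed.

(** [h] is the direction of a segment with real parameter [t]. Gronwall applies to |d|^2 + |d1|^2
    with rate |h| (1 + K), because 2 |d| |d1| is at most this sum. *)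
Lemma linear_ode_zero (d d1 q : R -> C) (h : C) (a b K : R) :
  a <= b ->
  (forall t, a <= t <= b -> cder d t (h * d1 t)%C /\ cder d1 t (h * (q t * d t))%C /\ Cmod (q t) <= K) ->
  d a = 0%C -> d1 a = 0%C -> d b = 0%C /\ d1 b = 0%C.
Proof.
  intros Hab H Ha Ha1.
  set (N := fun t => Cmod (d t) * Cmod (d t) + Cmod (d1 t) * Cmod (d1 t)).
  assert (HN : N b <= N a * exp ((Cmod h * (1 + K)) * (b - a))).
  { apply (gronwall N (fun t => 2 * (Re (d t) * Re (h * d1 t)%C + Im (d t) * Im (h * d1 t)%C)
      + 2 * (Re (d1 t) * Re (h * (q t * d t))%C + Im (d1 t) * Im (h * (q t * d t))%C))); [exact Hab|].
    intros t Ht. destruct (H t Ht) as (H1 & H2 & H3). split.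
    - apply (is_derive_plus (fun s => Cmod (d s) * Cmod (d s)) (fun s => Cmod (d1 s) * Cmod (d1 s)));
        apply cder_Cmod_sqr; assumption.
    - pose proof (Cdot_le (d t) (h * d1 t)) as B1.
      pose proof (Cdot_le (d1 t) (h * (q t * d t))) as B2.
      rewrite Cmod_mult in B1. rewrite !Cmod_mult in B2. unfold N.
      pose proof (Cmod_ge_0 (d t)). pose proof (Cmod_ge_0 (d1 t)). pose proof (Cmod_ge_0 h).
      pose proof (Cmod_ge_0 (q t)).
      set (x := Cmod (d t)) in *. set (y := Cmod (d1 t)) in *. set (m := Cmod h) in *. set (p := Cmod (q t)) in *.
      assert (0 <= x * y) by (apply Rmult_le_pos; assumption).
      assert (0 <= m * (x * y)) by (apply Rmult_le_pos; assumption).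
      assert (y * (m * (p * x)) <= K * (m * (x * y))).
      { replace (y * (m * (p * x))) with (p * (m * (x * y))) by ring. apply Rmult_le_compat_r; assumption. }
      assert (m * (2 * (x * y)) * (1 + K) <= m * (x * x + y * y) * (1 + K)).
      { apply Rmult_le_compat_r; [lra|]. apply Rmult_le_compat_l; [assumption|].
        pose proof (Rle_0_sqr (x - y)). unfold Rsqr in *. lra. }
      apply Rle_trans with (2 * (x * (m * y)) + 2 * (y * (m * (p * x)))); [lra|].
      replace (m * (1 + K) * (x * x + y * y)) with (m * (x * x + y * y) * (1 + K)) by ring.
      lra. }
  assert (N a = 0) as E by (unfold N; rewrite Ha, Ha1, Cmod_0; ring).
  rewrite E, Rmult_0_l in HN. unfold N in HN.
  pose proof (Cmod_ge_0 (d b)). pose proof (Cmod_ge_0 (d1 b)).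
  split; apply Cmod_eq_0; nra.
Qed.

(** * Power series with complex coefficients on the real line *)

Lemma scal_pow_n (x y : R) (n : nat) : scal (pow_n x n) y = y * x ^ n.
Proof. transitivity (pow_n x n * y)%R; [reflexivity|]. rewrite pow_n_pow. apply Rmult_comm. Qed.

(** Radius of convergence at least [rho], in a form preserved by sums, products and differentiation
    without arithmetic on extended reals. *)
Definition cvr (a : nat -> R) (rho : R) : Prop := forall s, Rabs s < rho -> ex_pseries a s.

(** Beyond the radius of convergence the terms do not tend to 0, so convergence at the midpoint of
    |s| and [rho] puts the radius at or beyond that midpoint. *)
Lemma cvr_lt (a : nat -> R) (rho s : R) :
  cvr a rho -> Rabs s < rho -> Rbar_lt (Rabs s) (CV_radius a).
Proof.
  intros H Hs. set (t := (Rabs s + rho) / 2).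
  assert (Ht : Rabs t = t) by (unfold t; apply Rabs_right; pose proof (Rabs_pos s); lra).
  apply Rbar_lt_le_trans with t; [unfold t; simpl; lra|].
  apply Rbar_not_lt_le. intros Hlt.
  assert (E : ex_pseries a t) by (apply H; unfold t in *; lra).
  apply (CV_disk_outside a t); [rewrite Ht; exact Hlt|].
  apply ex_series_lim_0 in E. eapply is_lim_seq_ext; [|exact E].
  intros n. apply scal_pow_n.
Qed.

Lemma cvr_ext (a b : nat -> R) (rho : R) : (forall n, a n = b n) -> cvr a rho -> cvr b rho.
Proof. intros E H s Hs. eapply ex_pseries_ext; [exact E|]. apply H, Hs. Qed.

Lemma cvr_plus (a b : nat -> R) (rho : R) : cvr a rho -> cvr b rho -> cvr (fun n => a n + b n) rho.
Proof. intros H1 H2 s Hs. apply (ex_pseries_plus a b s); [apply H1|apply H2]; exact Hs. Qed.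

Lemma cvr_scal (c : R) (a : nat -> R) (rho : R) : cvr a rho -> cvr (fun n => c * a n) rho.
Proof. intros H s Hs. apply (ex_pseries_scal c a s); [apply Rmult_comm|apply H, Hs]. Qed.

Lemma cvr_mult (a b : nat -> R) (rho : R) : cvr a rho -> cvr b rho -> cvr (PS_mult a b) rho.
Proof. intros H1 H2 s Hs. apply ex_pseries_mult; eapply cvr_lt; eassumption. Qed.

Lemma cvr_deriv (a : nat -> R) (rho : R) : cvr a rho -> cvr (PS_derive a) rho.
Proof. intros H s Hs. apply ex_pseries_derive. eapply cvr_lt; eassumption. Qed.

Lemma PS_incr_derive (a : nat -> R) (n : nat) : PS_incr_1 (PS_derive a) n = INR n * a n.
Proof. destruct n; [simpl; unfold zero; simpl; ring|]. reflexivity. Qed.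

Lemma cvr_euler (j : R) (a : nat -> R) (rho : R) : cvr a rho -> cvr (fun n => (INR n - j) * a n) rho.
Proof.
  intros H. apply (cvr_ext (fun n => PS_incr_1 (PS_derive a) n + - j * a n)).
  { intros n. rewrite PS_incr_derive. ring. }
  apply cvr_plus; [|apply cvr_scal, H].
  intros s Hs. apply ex_pseries_incr_1. apply cvr_deriv with rho; assumption.
Qed.

Lemma PSeries_euler (j : R) (a : nat -> R) (rho s : R) :
  cvr a rho -> Rabs s < rho ->
  PSeries (fun n => (INR n - j) * a n) s = s * PSeries (PS_derive a) s - j * PSeries a s.
Proof.
  intros H Hs.
  rewrite (PSeries_ext _ (PS_plus (PS_incr_1 (PS_derive a)) (PS_scal (- j) a))).
  2:{ intros n. unfold PS_plus, PS_scal. rewrite PS_incr_derive. unfold plus, scal; simpl. unfold mult; simpl. ring. }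
  rewrite PSeries_plus, PSeries_incr_1, PSeries_scal; [ring| |].
  - apply ex_pseries_incr_1. apply cvr_deriv with rho; assumption.
  - apply ex_pseries_scal; [apply Rmult_comm|apply H, Hs].
Qed.

(** A Laurent series is kept as a power series over a monomial. Differentiation multiplies the n-th
    coefficient by n - j and raises the exponent [j] by one. *)
Lemma is_derive_PSeries_div (j : nat) (a : nat -> R) (rho s : R) :
  cvr a rho -> Rabs s < rho -> s <> 0 ->
  is_derive (fun t => PSeries a t / t ^ j) s (PSeries (fun n => (INR n - INR j) * a n) s / s ^ S j).
Proof.
  intros H Hs Hs0. rewrite (PSeries_euler (INR j) a rho s H Hs).
  pose proof (is_derive_PSeries a s (cvr_lt a rho s H Hs)) as D.
  assert (E : ex_derive (PSeries a) s) by (eexists; exact D).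
  auto_derive; [repeat split; trivial; apply pow_nonzero, Hs0|].
  change (Derive (fun x : R => PSeries a x) s) with (Derive (PSeries a) s).
  rewrite (is_derive_unique _ _ _ D).
  destruct j as [|j]; [simpl; field; exact Hs0|].
  change (Init.Nat.pred (S j)) with j. rewrite <- !tech_pow_Rmult. field. split; [|exact Hs0]. apply pow_nonzero, Hs0.
Qed.

Lemma is_pseries_single (m : nat) (x s : R) :
  is_pseries (fun n => if Nat.eqb n m then x else 0) s (x * s ^ m).
Proof.
  apply (is_series_ext (fun n => if Nat.eqb n m then x * s ^ m else 0)).
  { intros n. rewrite scal_pow_n.
    destruct (Nat.eqb_spec n m) as [->|e]; [reflexivity|]. symmetry. apply Rmult_0_l. }
  generalize (x * s ^ m). clear x s. intros y.
  apply (filterlim_ext_loc (fun _ => y)); [|apply filterlim_const].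
  exists m. intros n Hn. rewrite sum_n_Reals.
  induction Hn as [|n Hn IH].
  - destruct m as [|m]; [reflexivity|]. rewrite tech5, Nat.eqb_refl.
    rewrite (sum_eq _ (fun _ => 0)); [rewrite sum_cte; ring|].
    intros i Hi. destruct (Nat.eqb_spec i (S m)); [lia|reflexivity].
  - rewrite tech5, <- IH. destruct (Nat.eqb_spec (S n) m); [lia|]. ring.
Qed.

Lemma cvr_single (m : nat) (x : R) (rho : R) : cvr (fun n => if Nat.eqb n m then x else 0) rho.
Proof. intros s _. eexists. apply is_pseries_single. Qed.

(** Abel's lemma. With its converse [bound_of_cvr] it reduces convergence questions to termwise
    domination. *)
Lemma cvr_of_bound (a : nat -> R) (rho : R) :
  (forall r, 0 <= r < rho -> exists M, forall n, Rabs (a n) * r ^ n <= M) -> cvr a rho.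
Proof.
  intros H s Hs. apply CV_radius_inside. set (t := (Rabs s + rho) / 2).
  pose proof (Rabs_pos s).
  apply Rbar_lt_le_trans with t; [unfold t; simpl; lra|].
  apply (proj1 (CV_radius_bounded a)). destruct (H t) as [M HM]; [unfold t; lra|].
  exists M. intros n. rewrite Rabs_mult, <- RPow_abs, (Rabs_right t); [apply HM|unfold t; lra].
Qed.

Lemma bound_of_cvr (a : nat -> R) (rho r : R) :
  cvr a rho -> 0 <= r < rho -> exists M, forall n, Rabs (a n) * r ^ n <= M.
Proof.
  intros H Hr. assert (Hr' : Rabs r < rho) by (rewrite Rabs_right; lra).
  destruct (CV_disk_inside a r (cvr_lt a rho r H Hr')) as [M HM].
  exists M. intros n.
  apply Rle_trans with (sum_n (fun n => Rabs (a n * r ^ n)) n).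
  - rewrite <- (Rabs_right (r ^ n)), <- Rabs_mult by (apply Rle_ge, pow_le; lra).
    rewrite sum_n_Reals. destruct n; [simpl; lra|]. rewrite tech5.
    assert (0 <= sum_f_R0 (fun n => Rabs (a n * r ^ n)) n); [|lra].
    apply cond_pos_sum. intros; apply Rabs_pos.
  - apply (is_lim_seq_incr_compare (sum_n (fun n => Rabs (a n * r ^ n)))); [exact HM|].
    intros k. rewrite sum_Sn. unfold plus; simpl. pose proof (Rabs_pos (a (S k) * r ^ S k)). simpl in *. lra.
Qed.

(* [csum f n] has the [n + 1] terms [f 0, ..., f n]. *)
Fixpoint csum (f : nat -> C) (n : nat) : C :=
  match n with O => f O | S m => (csum f m + f (S m))%C end.

Definition conv (c d : nat -> C) (n : nat) : C := csum (fun j => c j * d (n - j)%nat)%C n.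

Lemma csum_ext (f g : nat -> C) (n : nat) : (forall j, (j <= n)%nat -> f j = g j) -> csum f n = csum g n.
Proof.
  induction n as [|n IH]; intros H; simpl; [apply H; lia|].
  rewrite IH by (intros; apply H; lia). rewrite H by lia. reflexivity.
Qed.

Lemma csum_scal (x : C) (f : nat -> C) (n : nat) : csum (fun j => x * f j)%C n = (x * csum f n)%C.
Proof. induction n as [|n IH]; simpl; [reflexivity|]. rewrite IH. ring. Qed.

Lemma csum_0 (n : nat) : csum (fun _ => 0%C) n = 0%C.
Proof. induction n as [|n IH]; simpl; [reflexivity|]. rewrite IH. ring. Qed.

Lemma Re_csum (f : nat -> C) (n : nat) : Re (csum f n) = sum_f_R0 (fun j => Re (f j)) n.
Proof. induction n as [|n IH]; [reflexivity|]. cbn [csum sum_f_R0]. rewrite Re_plus, IH. reflexivity. Qed.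

Lemma Im_csum (f : nat -> C) (n : nat) : Im (csum f n) = sum_f_R0 (fun j => Im (f j)) n.
Proof. induction n as [|n IH]; [reflexivity|]. cbn [csum sum_f_R0]. rewrite Im_plus, IH. reflexivity. Qed.

Lemma Cmod_csum (f : nat -> C) (n : nat) : Cmod (csum f n) <= sum_f_R0 (fun j => Cmod (f j)) n.
Proof.
  induction n as [|n IH]; simpl; [lra|]. apply Rle_trans with (1 := Cmod_triangle _ _). lra.
Qed.

(** The coefficients are complex but the argument stays real: a point x s off the real axis is
    reached by absorbing x^n into the coefficients. *)
Definition PC (c : nat -> C) (s : R) : C :=
  (PSeries (fun n => Re (c n)) s, PSeries (fun n => Im (c n)) s).

Definition Rad (c : nat -> C) (rho : R) : Prop :=
  cvr (fun n => Re (c n)) rho /\ cvr (fun n => Im (c n)) rho.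

Lemma Rad_of_bound (c : nat -> C) (rho : R) :
  (forall r, 0 <= r < rho -> exists M, forall n, Cmod (c n) * r ^ n <= M) -> Rad c rho.
Proof.
  intros H. split; apply cvr_of_bound; intros r Hr; destruct (H r Hr) as [M HM]; exists M; intros n;
    (apply Rle_trans with (2 := HM n); apply Rmult_le_compat_r; [apply pow_le; lra|]).
  - apply re_le_Cmod.
  - apply Rle_trans with (2 := Rmax_Cmod (c n)). apply Rmax_r.
Qed.

Lemma Cmod_le_Re_Im (z : C) : Cmod z <= Rabs (Re z) + Rabs (Im z).
Proof.
  pose proof (Cmod_sqr z). pose proof (Cmod_ge_0 z). pose proof (Rabs_pos (Re z)). pose proof (Rabs_pos (Im z)).
  assert (Re z * Re z = Rabs (Re z) * Rabs (Re z)) by (rewrite <- Rabs_mult, Rabs_right; [ring|nra]).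
  assert (Im z * Im z = Rabs (Im z) * Rabs (Im z)) by (rewrite <- Rabs_mult, Rabs_right; [ring|nra]).
  nra.
Qed.

Lemma bound_of_Rad (c : nat -> C) (rho r : R) :
  Rad c rho -> 0 <= r < rho -> exists M, forall n, Cmod (c n) * r ^ n <= M.
Proof.
  intros [H1 H2] Hr. destruct (bound_of_cvr _ _ r H1 Hr) as [M1 B1]. destruct (bound_of_cvr _ _ r H2 Hr) as [M2 B2].
  exists (M1 + M2). intros n. specialize (B1 n). specialize (B2 n).
  pose proof (Cmod_le_Re_Im (c n)). assert (0 <= r ^ n) by (apply pow_le; lra). nra.
Qed.

Lemma Rad_mono (c d : nat -> C) (rho : R) :
  (forall n, Cmod (d n) <= Cmod (c n)) -> Rad c rho -> Rad d rho.
Proof.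
  intros H Hc. apply Rad_of_bound. intros r Hr. destruct (bound_of_Rad c rho r Hc Hr) as [M HM].
  exists M. intros n. apply Rle_trans with (2 := HM n). apply Rmult_le_compat_r; [apply pow_le; lra|apply H].
Qed.

Lemma Rad_le (c : nat -> C) (r rho : R) : r <= rho -> Rad c rho -> Rad c r.
Proof. intros H [H1 H2]. split; intros s Hs; [apply H1|apply H2]; lra. Qed.

Lemma Rad_ext (c d : nat -> C) (rho : R) : (forall n, c n = d n) -> Rad c rho -> Rad d rho.
Proof. intros E. apply Rad_mono. intros n. rewrite E. lra. Qed.

Lemma Rad_plus (c d : nat -> C) (rho : R) : Rad c rho -> Rad d rho -> Rad (fun n => c n + d n)%C rho.
Proof.
  intros [H1 H2] [H3 H4]. split.
  - apply (cvr_plus _ _ _ H1 H3).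
  - apply (cvr_plus _ _ _ H2 H4).
Qed.

Lemma Rad_scal (x : C) (c : nat -> C) (rho : R) : Rad c rho -> Rad (fun n => x * c n)%C rho.
Proof.
  intros [H1 H2]. split.
  - apply (cvr_ext (fun n => Re x * Re (c n) + - Im x * Im (c n))); [intros n; rewrite Re_mult; ring|].
    apply cvr_plus; apply cvr_scal; assumption.
  - apply (cvr_ext (fun n => Re x * Im (c n) + Im x * Re (c n))); [intros n; rewrite Im_mult; ring|].
    apply cvr_plus; apply cvr_scal; assumption.
Qed.

Lemma Re_RtoC_mult (x : R) (z : C) : Re (x * z)%C = x * Re z.
Proof. rewrite Re_mult. simpl. ring. Qed.
Lemma Im_RtoC_mult (x : R) (z : C) : Im (x * z)%C = x * Im z.
Proof. rewrite Im_mult. simpl. ring. Qed.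

Lemma Rad_euler (j : R) (c : nat -> C) (rho : R) : Rad c rho -> Rad (fun n => RtoC (INR n - j) * c n)%C rho.
Proof.
  intros [H1 H2]. split.
  - eapply cvr_ext; [|apply (cvr_euler j _ _ H1)]. intros n. symmetry. apply Re_RtoC_mult.
  - eapply cvr_ext; [|apply (cvr_euler j _ _ H2)]. intros n. symmetry. apply Im_RtoC_mult.
Qed.

Lemma Rad_single (m : nat) (x : C) (rho : R) : Rad (fun n => if Nat.eqb n m then x else 0%C) rho.
Proof.
  split.
  - eapply cvr_ext; [|apply (cvr_single m (Re x))]. intros n. simpl. destruct (Nat.eqb n m); reflexivity.
  - eapply cvr_ext; [|apply (cvr_single m (Im x))]. intros n. simpl. destruct (Nat.eqb n m); reflexivity.
Qed.

Lemma Re_conv (c d : nat -> C) (n : nat) :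
  Re (conv c d n) = PS_mult (fun n => Re (c n)) (fun n => Re (d n)) n
    - PS_mult (fun n => Im (c n)) (fun n => Im (d n)) n.
Proof. unfold conv, PS_mult. rewrite Re_csum, <- minus_sum. apply sum_eq. intros. apply Re_mult. Qed.

Lemma Im_conv (c d : nat -> C) (n : nat) :
  Im (conv c d n) = PS_mult (fun n => Re (c n)) (fun n => Im (d n)) n
    + PS_mult (fun n => Im (c n)) (fun n => Re (d n)) n.
Proof. unfold conv, PS_mult. rewrite Im_csum, <- plus_sum. apply sum_eq. intros. apply Im_mult. Qed.

Lemma Rad_conv (c d : nat -> C) (rho : R) : Rad c rho -> Rad d rho -> Rad (conv c d) rho.
Proof.
  intros [H1 H2] [H3 H4]. split.
  - apply (cvr_ext (fun n => PS_mult (fun n => Re (c n)) (fun n => Re (d n)) n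
      + -1 * PS_mult (fun n => Im (c n)) (fun n => Im (d n)) n)); [intros n; rewrite Re_conv; ring|].
    apply cvr_plus; [|apply cvr_scal]; apply cvr_mult; assumption.
  - apply (cvr_ext (fun n => PS_mult (fun n => Re (c n)) (fun n => Im (d n)) n
      + PS_mult (fun n => Im (c n)) (fun n => Re (d n)) n)); [intros n; rewrite Im_conv; ring|].
    apply cvr_plus; apply cvr_mult; assumption.
Qed.

Lemma PC_ext (c d : nat -> C) (s : R) : (forall n, c n = d n) -> PC c s = PC d s.
Proof. intros E. unfold PC. f_equal; apply PSeries_ext; intros n; rewrite E; reflexivity. Qed.

Lemma PC_0 (c : nat -> C) : PC c 0 = c O.
Proof. unfold PC. rewrite !PSeries_0. destruct (c O); reflexivity. Qed.

Lemma PC_plus (c d : nat -> C) (rho s : R) :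
  Rad c rho -> Rad d rho -> Rabs s < rho -> PC (fun n => c n + d n)%C s = (PC c s + PC d s)%C.
Proof.
  intros [H1 H2] [H3 H4] Hs. unfold PC, Cplus; simpl. f_equal.
  - rewrite <- PSeries_plus; [|apply H1, Hs|apply H3, Hs]. reflexivity.
  - rewrite <- PSeries_plus; [|apply H2, Hs|apply H4, Hs]. reflexivity.
Qed.

Lemma PSeries_lin (x y : R) (a b : nat -> R) (rho s : R) :
  cvr a rho -> cvr b rho -> Rabs s < rho ->
  PSeries (fun n => x * a n + y * b n) s = x * PSeries a s + y * PSeries b s.
Proof.
  intros Ha Hb Hs. rewrite <- !PSeries_scal, <- PSeries_plus; [reflexivity| |];
    apply ex_pseries_scal; try apply Rmult_comm; [apply Ha|apply Hb]; exact Hs.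
Qed.

Lemma Re_scal_PC (x : C) (c : nat -> C) (rho s : R) :
  Rad c rho -> Rabs s < rho -> Re (x * PC c s)%C = PSeries (fun n => Re (x * c n)%C) s.
Proof.
  intros [H1 H2] Hs. rewrite Re_mult. unfold PC; simpl.
  rewrite (PSeries_ext (fun n => Re (x * c n)%C) (fun n => Re x * Re (c n) + - Im x * Im (c n))).
  - rewrite (PSeries_lin _ _ _ _ rho); try assumption. ring.
  - intros n. rewrite Re_mult. ring.
Qed.

Lemma PC_scal (x : C) (c : nat -> C) (rho s : R) :
  Rad c rho -> Rabs s < rho -> PC (fun n => x * c n)%C s = (x * PC c s)%C.
Proof.
  intros H Hs. apply injective_projections.
  - symmetry. apply (Re_scal_PC x c rho s H Hs).
  - destruct H as [H1 H2]. change (Im (PC (fun n => x * c n)%C s) = Im (x * PC c s)%C). rewrite Im_mult. unfold PC; simpl.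
    rewrite (PSeries_ext (fun n => Im (x * c n)%C) (fun n => Re x * Im (c n) + Im x * Re (c n))).
    + rewrite (PSeries_lin _ _ _ _ rho); try assumption. reflexivity.
    + intros n. apply Im_mult.
Qed.

Lemma PC_single (m : nat) (x : C) (s : R) :
  PC (fun n => if Nat.eqb n m then x else 0%C) s = (x * s ^ m)%C.
Proof.
  rewrite <- RtoC_pow. unfold PC.
  rewrite (PSeries_ext _ (fun n => if Nat.eqb n m then Re x else 0)) by (intros n; destruct (Nat.eqb n m); reflexivity).
  rewrite (PSeries_ext (fun n => Im _) (fun n => if Nat.eqb n m then Im x else 0)) by (intros n; destruct (Nat.eqb n m); reflexivity).
  rewrite !(is_pseries_unique _ _ _ (is_pseries_single m _ s)).
  apply injective_projections; unfold Cmult; simpl; unfold Re, Im; ring.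
Qed.

Lemma PC_conv (c d : nat -> C) (rho s : R) :
  Rad c rho -> Rad d rho -> Rabs s < rho -> PC (conv c d) s = (PC c s * PC d s)%C.
Proof.
  intros [H1 H2] [H3 H4] Hs. unfold PC at 1. apply injective_projections; unfold Cmult, PC; simpl.
  - rewrite <- !PSeries_mult by (eapply cvr_lt; eassumption).
    transitivity (PSeries (fun n => 1 * PS_mult (fun n => Re (c n)) (fun n => Re (d n)) n
      + -1 * PS_mult (fun n => Im (c n)) (fun n => Im (d n)) n) s).
    + apply PSeries_ext. intros n. rewrite Re_conv. ring.
    + rewrite (PSeries_lin _ _ _ _ rho); try assumption; try (apply cvr_mult; assumption). ring.
  - rewrite <- !PSeries_mult by (eapply cvr_lt; eassumption).
    transitivity (PSeries (fun n => 1 * PS_mult (fun n => Re (c n)) (fun n => Im (d n)) n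
      + 1 * PS_mult (fun n => Im (c n)) (fun n => Re (d n)) n) s).
    + apply PSeries_ext. intros n. rewrite Im_conv. ring.
    + rewrite (PSeries_lin _ _ _ _ rho); try assumption; try (apply cvr_mult; assumption). ring.
Qed.

Lemma PC_comp_scal (q : R) (c : nat -> C) (s : R) :
  PC (fun n => RtoC (q ^ n) * c n)%C s = PC c (q * s).
Proof.
  unfold PC. f_equal; apply Series_ext; intros n; [rewrite Re_RtoC_mult|rewrite Im_RtoC_mult];
    rewrite Rpow_mult_distr; ring.
Qed.

Lemma cder_PC_div (j : nat) (c : nat -> C) (rho s : R) :
  Rad c rho -> Rabs s < rho -> s <> 0 ->
  cder (fun t => PC c t / RtoC (t ^ j))%C s
    (PC (fun n => RtoC (INR n - INR j) * c n)%C s / RtoC (s ^ S j))%C.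
Proof.
  intros [H1 H2] Hs Hs0.
  assert (G : forall z (t : R), t <> 0 -> Re (z / RtoC t)%C = Re z / t /\ Im (z / RtoC t)%C = Im z / t).
  { intros z t Ht. unfold Cdiv. rewrite <- RtoC_inv by exact Ht. rewrite Re_mult, Im_mult. simpl. split; field; exact Ht. }
  destruct (G (PC (fun n => RtoC (INR n - INR j) * c n)%C s) (s ^ S j) (pow_nonzero _ _ Hs0)) as [G1 G2].
  assert (Hloc : forall P : R -> Prop, (forall t, t <> 0 -> P t) -> locally s P).
  { intros P HP. assert (Hp : 0 < Rabs s) by (apply Rabs_pos_lt, Hs0).
    exists (mkposreal _ Hp). intros y Hy. apply HP. intros ->.
    unfold ball in Hy; simpl in Hy. unfold AbsRing_ball, abs, minus, plus, opp in Hy; simpl in Hy.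
    rewrite Rplus_0_l, Rabs_Ropp in Hy. lra. }
  split.
  - rewrite G1. apply (is_derive_ext_loc (fun t => PSeries (fun n => Re (c n)) t / t ^ j)).
    + apply Hloc. intros t Ht. symmetry. apply G, pow_nonzero, Ht.
    + assert (Ex : Re (PC (fun n => RtoC (INR n - INR j) * c n)%C s) = PSeries (fun n => (INR n - INR j) * Re (c n)) s)
        by (apply PSeries_ext; intros n; apply Re_RtoC_mult).
      rewrite Ex.
      apply is_derive_PSeries_div with rho; assumption.
  - rewrite G2. apply (is_derive_ext_loc (fun t => PSeries (fun n => Im (c n)) t / t ^ j)).
    + apply Hloc. intros t Ht. symmetry. apply G, pow_nonzero, Ht.
    + assert (Ex : Im (PC (fun n => RtoC (INR n - INR j) * c n)%C s) = PSeries (fun n => (INR n - INR j) * Im (c n)) s)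
        by (apply PSeries_ext; intros n; apply Im_RtoC_mult).
      rewrite Ex.
      apply is_derive_PSeries_div with rho; assumption.
Qed.

Lemma PC_unique (c d : nat -> C) (rho : R) (n : nat) :
  0 < rho -> Rad c rho -> Rad d rho ->
  (forall s, Rabs s < rho -> PC c s = PC d s) -> c n = d n.
Proof.
  intros Hr [H1 H2] [H3 H4] E.
  assert (H0 : Rabs 0 < rho) by (rewrite Rabs_R0; exact Hr).
  assert (Hloc : forall P : R -> Prop, (forall t, Rabs t < rho -> P t) -> locally 0 P).
  { intros P HP. exists (mkposreal _ Hr). intros y Hy. apply HP.
    unfold ball in Hy; simpl in Hy. unfold AbsRing_ball, abs, minus, plus, opp in Hy; simpl in Hy.
    rewrite Ropp_0, Rplus_0_r in Hy. exact Hy. }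
  assert (L : forall a, cvr a rho -> Rbar_lt 0 (CV_radius a)).
  { intros a Ha. rewrite <- Rabs_R0. apply cvr_lt with rho; assumption. }
  apply injective_projections.
  - apply (PSeries_ext_recip (fun n => Re (c n)) (fun n => Re (d n))); [apply L, H1|apply L, H3|].
    apply Hloc. intros t Ht. exact (f_equal Re (E t Ht)).
  - apply (PSeries_ext_recip (fun n => Im (c n)) (fun n => Im (d n))); [apply L, H2|apply L, H4|].
    apply Hloc. intros t Ht. exact (f_equal Im (E t Ht)).
Qed.

Lemma PSeries_le (a b : nat -> R) (rho s : R) :
  cvr a rho -> cvr b rho -> 0 <= s < rho -> (forall n, a n <= b n) -> PSeries a s <= PSeries b s.
Proof.
  intros Ha Hb Hs H.
  assert (Hs' : Rabs s < rho) by (rewrite Rabs_right; lra).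
  assert (S : 0 <= PSeries (fun n => 1 * b n + -1 * a n) s).
  { unfold PSeries.
    replace 0 with (Series (fun _ => 0)).
    - apply Series_le.
      + intros n. assert (0 <= s ^ n) by (apply pow_le; lra). specialize (H n). split; [lra|nra].
      + assert (cvr (fun n => 1 * b n + -1 * a n) rho) by (apply cvr_plus; apply cvr_scal; assumption).
        destruct (H0 s Hs') as [l Hl]. exists l. eapply is_series_ext; [|exact Hl].
        intros n. apply scal_pow_n.
    - rewrite (Series_ext _ (fun n => 0 * 0)) by (intros; ring). rewrite Series_scal_l. ring. }
  rewrite (PSeries_lin _ _ _ _ rho) in S by assumption. lra.
Qed.

Lemma Cmod_PC_le (c : nat -> C) (b : nat -> R) (rho s : R) :
  Rad c rho -> cvr b rho -> 0 <= s < rho -> (forall n, Cmod (c n) <= b n) -> Cmod (PC c s) <= PSeries b s.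
Proof.
  intros Hc Hb Hs H. apply Cmod_le_dir. intros e He.
  rewrite (Re_scal_PC e c rho s Hc) by (rewrite Rabs_right; lra).
  apply PSeries_le with rho; try assumption.
  - exact (proj1 (Rad_scal e c rho Hc)).
  - intros n. apply Rle_trans with (2 := H n). apply Re_dir_le, He.
Qed.

(** * Solutions of the differential equation *)

Definition Cder (f : C -> C) (z l : C) : Prop :=
  forall eps, 0 < eps -> exists d, 0 < d /\ forall h : C, Cmod h < d ->
    Cmod (f (z + h) - f z - l * h)%C <= eps * Cmod h.

Definition pole (u : C -> C) (a : C) : Prop :=
  forall M : R, exists d, 0 < d /\ forall z, z <> a -> Cmod (z - a)%C < d -> M < Cmod (u z).

Lemma locally'_Cmod (a : C) (P : C -> Prop) :
  locally' (T := C_UniformSpace) a P <->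
  exists d, 0 < d /\ forall z, z <> a -> Cmod (z - a)%C < d -> P z.
Proof.
  unfold locally', within. split.
  - intros H. apply locally_C in H. destruct H as [d H]. exists d. split; [apply d|].
    intros z Hz Hd. apply H; [exact Hd|exact Hz].
  - intros [d [Hd H]]. apply locally_C. exists (mkposreal d Hd). intros z Hz Hn. apply H; [exact Hn|exact Hz].
Qed.

Lemma is_pole_iff (u : C -> C) (a : C) : is_pole u a <-> pole u a.
Proof.
  unfold is_pole. split.
  - intros H M. apply locally'_Cmod. apply (H (fun y => M < y)). exists M. trivial.
  - intros H P [M HM]. unfold filtermap. apply locally'_Cmod. destruct (H M) as [d [Hd Hz]].
    exists d. split; [exact Hd|]. intros z H1 H2. apply HM, Hz; assumption.
Qed.

Lemma Cder_of_is_derive (f : C -> C) (z l : C) :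
  is_derive (K := C_AbsRing) (V := C_NormedModule) f z l -> Cder f z l.
Proof.
  intros [_ H] eps Heps.
  specialize (H z (fun P HP => HP) (mkposreal eps Heps)). simpl in H.
  destruct H as [d H]. exists d. split; [apply d|]. intros h Hh.
  specialize (H (z + h)%C).
  assert (B : ball (M := AbsRing_UniformSpace C_AbsRing) z d (z + h)%C).
  { unfold ball; simpl. unfold AbsRing_ball, abs; simpl. unfold minus, plus, opp; simpl.
    replace (z + h + - z)%C with h by ring. exact Hh. }
  specialize (H B).
  assert (E1 : norm (minus (z + h)%C z) = Cmod h).
  { unfold norm; simpl. unfold minus, plus, opp; simpl. f_equal. ring. }
  assert (E2 : norm (minus (minus (f (z + h)%C) (f z)) (scal (minus (z + h)%C z) l)) = Cmod (f (z + h) - f z - l * h)%C).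
  { unfold norm; simpl. unfold minus, plus, opp, scal; simpl. unfold mult; simpl. f_equal. ring. }
  cbv beta in H. 
  etransitivity; [|etransitivity; [exact H|]]; [right; symmetry; exact E2|right; f_equal; exact E1].
Qed.

Lemma Cder_bound (f : C -> C) (z l : C) : Cder f z l ->
  exists d, 0 < d /\ forall w, Cmod (w - z)%C < d -> Cmod (f w - f z)%C <= (Cmod l + 1) * Cmod (w - z)%C.
Proof.
  intros H. destruct (H 1 Rlt_0_1) as [d [Hd B]]. exists d. split; [exact Hd|]. intros w Hw.
  specialize (B _ Hw). replace (z + (w - z))%C with w in B by ring.
  pose proof (Cmod_triangle (f w - f z - l * (w - z)) (l * (w - z))) as T.
  replace (f w - f z - l * (w - z) + l * (w - z))%C with (f w - f z)%C in T by ring.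
  rewrite Cmod_mult in T. lra.
Qed.

Lemma Cder_not_pole (f : C -> C) (z l : C) : Cder f z l -> ~ pole f z.
Proof.
  intros H Hp. destruct (Cder_bound f z l H) as [d [Hd B]].
  destruct (Hp (Cmod (f z) + (Cmod l + 1) * d)) as [d' [Hd' B']].
  set (e := Rmin d d' / 2). assert (He : 0 < e < Rmin d d') by (unfold e; pose proof (Rmin_pos d d' Hd Hd'); lra).
  pose proof (Rmin_l d d'). pose proof (Rmin_r d d').
  assert (E : Cmod (z + e - z)%C = e).
  { replace (z + e - z)%C with (RtoC e) by ring. rewrite Cmod_R, Rabs_right; lra. }
  assert (Hne : (z + e)%C <> z).
  { intros Heq. rewrite Heq in E. replace (z - z)%C with (RtoC 0) in E by ring. rewrite Cmod_0 in E. lra. }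
  specialize (B (z + e)%C). specialize (B' (z + e)%C Hne). rewrite E in B, B'.
  pose proof (Cmod_sub_ge (f (z + e)%C) (f z)). pose proof (Cmod_ge_0 l).
  assert ((Cmod l + 1) * e <= (Cmod l + 1) * d) by (apply Rmult_le_compat_l; lra).
  lra.
Qed.

Lemma Cder_scale (f : C -> C) (k a z l : C) :
  a <> 0%C -> Cder f (a * z)%C l -> Cder (fun w => k * f (a * w))%C z (k * a * l)%C.
Proof.
  intros Ha H eps Heps. apply Cmod_gt_0 in Ha as Ha'. pose proof (Cmod_ge_0 k) as Hk.
  set (e := eps / ((Cmod k + 1) * Cmod a)).
  assert (Hpos : 0 < (Cmod k + 1) * Cmod a) by (apply Rmult_lt_0_compat; lra).
  assert (He : 0 < e) by (apply Rdiv_lt_0_compat; assumption).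
  destruct (H e He) as [d [Hd B]]. exists (d / Cmod a). split; [apply Rdiv_lt_0_compat; assumption|].
  intros h Hh. specialize (B (a * h)%C). rewrite Cmod_mult in B.
  assert (Had : Cmod a * Cmod h < d).
  { apply Rlt_div_r in Hh; lra. }
  specialize (B Had).
  replace (k * f (a * (z + h)) - k * f (a * z) - k * a * l * h)%C with (k * (f (a * z + a * h) - f (a * z) - l * (a * h)))%C.
  2:{ replace (a * (z + h))%C with (a * z + a * h)%C by ring. ring. }
  rewrite Cmod_mult.
  apply Rle_trans with (Cmod k * (e * (Cmod a * Cmod h))); [apply Rmult_le_compat_l; assumption|].
  apply Rle_trans with ((Cmod k + 1) * (e * (Cmod a * Cmod h))).
  - apply Rmult_le_compat_r; [|lra]. pose proof (Cmod_ge_0 h). apply Rmult_le_pos; [lra|]. apply Rmult_le_pos; lra.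
  - right. unfold e. field. lra.
Qed.

Lemma cder_line (f : C -> C) (p h l : C) (t : R) :
  Cder f (p + RtoC t * h)%C l -> cder (fun s => f (p + RtoC s * h)%C) t (h * l)%C.
Proof.
  intros H.
  assert (D : forall eps, 0 < eps -> exists d, 0 < d /\ forall s, Rabs s < d ->
     Cmod (f (p + RtoC (t + s) * h) - f (p + RtoC t * h) - h * l * RtoC s)%C <= eps * Rabs s).
  { intros eps Heps. pose proof (Cmod_ge_0 h).
    (* The denominator |h| + 1 covers the degenerate segment h = 0. *)
    assert (He : 0 < eps / (Cmod h + 1)) by (apply Rdiv_lt_0_compat; lra).
    destruct (H _ He) as [d [Hd B]]. exists (d / (Cmod h + 1)). split; [apply Rdiv_lt_0_compat; lra|].
    intros s Hs. specialize (B (RtoC s * h)%C). rewrite Cmod_mult, Cmod_R in B.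
    pose proof (Rabs_pos s).
    assert (Hsd : Rabs s * (Cmod h + 1) < d).
    { apply (Rmult_lt_compat_r (Cmod h + 1)) in Hs; [|lra]. replace (d / (Cmod h + 1) * (Cmod h + 1)) with d in Hs by (field; lra). exact Hs. }
    assert (Hsh : Rabs s * Cmod h < d) by nra. specialize (B Hsh).
    replace (p + RtoC t * h + RtoC s * h)%C with (p + RtoC (t + s) * h)%C in B by (rewrite RtoC_plus; ring).
    replace (l * (RtoC s * h))%C with (h * l * RtoC s)%C in B by ring.
    apply Rle_trans with (1 := B).
    replace (eps * Rabs s) with (eps / (Cmod h + 1) * (Rabs s * (Cmod h + 1))) by (field; lra).
    apply Rmult_le_compat_l; nra. }
  assert (G : forall (g : C -> R), (forall x y, g (x - y)%C = g x - g y) -> (forall x (r : R), g (x * RtoC r)%C = g x * r) ->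
     (forall x, Rabs (g x) <= Cmod x) -> is_derive (fun s => g (f (p + RtoC s * h)%C)) t (g (h * l)%C)).
  { intros g Hsub Hmul Hle. apply is_derive_Reals. intros eps Heps.
    destruct (D (eps / 2) ltac:(lra)) as [d [Hd B]]. exists (mkposreal d Hd). intros s Hs0 Hs.
    specialize (B s Hs). apply (Rle_trans _ _ _ (Hle _)) in B. rewrite !Hsub, Hmul in B.
    assert (0 < Rabs s) by (apply Rabs_pos_lt, Hs0).
    replace ((g (f (p + RtoC (t + s) * h)%C) - g (f (p + RtoC t * h)%C)) / s - g (h * l)%C)
      with ((g (f (p + RtoC (t + s) * h)%C) - g (f (p + RtoC t * h)%C) - g (h * l)%C * s) / s) by (field; exact Hs0).
    unfold Rdiv. rewrite Rabs_mult, Rabs_inv.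
    apply (Rmult_le_compat_r (/ Rabs s)) in B; [|left; apply Rinv_0_lt_compat; assumption].
    rewrite Rmult_assoc, Rinv_r, Rmult_1_r in B by lra. lra. }
  split.
  - apply (G Re); [reflexivity| |apply re_le_Cmod]. intros. rewrite Re_mult. simpl. ring.
  - apply (G Im); [reflexivity| |]. { intros. rewrite Im_mult. simpl. ring. }
    intros x. apply Rle_trans with (2 := Rmax_Cmod x). apply Rmax_r.
Qed.

Lemma cder_real_line (f : C -> C) (t : R) (l : C) : Cder f (RtoC t) l -> cder (fun s => f (RtoC s)) t l.
Proof.
  intros H. pose proof (cder_line f 0%C 1%C l t) as D. replace (0 + t * 1)%C with (RtoC t) in D by ring.
  eapply cder_eq; [|apply Cmult_1_l]. eapply cder_ext_loc; [|exact (D H)].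
  exists 1. split; [lra|]. intros x _. f_equal. ring.
Qed.

Lemma cder_unique (f : R -> C) (t : R) (l l' : C) : cder f t l -> cder f t l' -> l = l'.
Proof.
  intros [H1 H2] [H3 H4]. apply injective_projections.
  - apply is_derive_unique in H1, H3. unfold Re in *. congruence.
  - apply is_derive_unique in H2, H4. unfold Im in *. congruence.
Qed.

Lemma cder_bounded (f df : R -> C) (a b : R) :
  a <= b -> (forall t, a <= t <= b -> cder f t (df t)) -> exists K, forall t, a <= t <= b -> Cmod (f t) <= K.
Proof.
  intros Hab H.
  destruct (continuity_ab_maj (fun t => Cmod (f t) * Cmod (f t)) a b Hab) as [m [Hm _]].
  { intros t Ht. apply continuity_pt_filterlim. apply (ex_derive_continuous (fun t => Cmod (f t) * Cmod (f t))).
    eexists. apply cder_Cmod_sqr, H, Ht. }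
  exists (Cmod (f m)). intros t Ht. specialize (Hm t Ht). simpl in Hm.
  pose proof (Cmod_ge_0 (f t)). pose proof (Cmod_ge_0 (f m)). nra.
Qed.

(** The difference of two solutions satisfies a linear equation with coefficient 6 (u1 + u2), which
    is bounded on the compact interval. *)
Lemma ode_unique_interval (u1 v1 u2 v2 phi : R -> C) (h : C) (a b : R) :
  a <= b ->
  (forall t, a <= t <= b -> cder u1 t (h * v1 t)%C /\ cder v1 t (h * (6 * u1 t ^ 2 - phi t))%C
     /\ cder u2 t (h * v2 t)%C /\ cder v2 t (h * (6 * u2 t ^ 2 - phi t))%C) ->
  u1 a = u2 a -> v1 a = v2 a -> u1 b = u2 b /\ v1 b = v2 b.
Proof.
  intros Hab H Hu Hv.
  destruct (cder_bounded (fun t => 6 * (u1 t + u2 t))%C (fun t => 6 * (h * v1 t + h * v2 t))%C a b Hab) as [K HK].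
  { intros t Ht. destruct (H t Ht) as (H1 & H2 & H3 & H4).
    apply cder_scal. apply cder_plus; assumption. }
  destruct (linear_ode_zero (fun t => u1 t - u2 t)%C (fun t => v1 t - v2 t)%C
     (fun t => 6 * (u1 t + u2 t))%C h a b K Hab) as [E1 E2].
  - intros t Ht. destruct (H t Ht) as (H1 & H2 & H3 & H4). split; [|split].
    + eapply cder_eq; [apply (cder_minus _ _ _ _ _ H1 H3)|]. ring.
    + eapply cder_eq; [apply (cder_minus _ _ _ _ _ H2 H4)|]. ring.
    + apply HK, Ht.
  - cbv beta. rewrite Hu. ring.
  - cbv beta. rewrite Hv. ring.
  - split.
    + replace (u1 b) with (u1 b - u2 b + u2 b)%C by ring. rewrite E1. ring.
    + replace (v1 b) with (v1 b - v2 b + v2 b)%C by ring. rewrite E2. ring.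
Qed.

(** The working form of [is_solution]: the derivative is explicit, g3 survives only through c_6, and
    the expansion of z^2 u is a series at the real point 1 with z^n absorbed into its
    coefficients. *)
Record sol (g lam : C) (u du : C -> C) (c : nat -> C) : Prop := {
  sol_isolated : forall a, exists d, 0 < d /\ forall z, z <> a -> Cmod (z - a)%C < d -> ~ pole u z;
  sol_der : forall z, ~ pole u z ->
    Cder u z (du z) /\ Cder du z (6 * u z ^ 2 - 6 * lam * z - g / 2)%C;
  sol_series : exists r, 0 < r /\ Rad c r /\
    forall z : C, z <> 0%C -> Cmod z < r -> PC (fun n => c n * z ^ n)%C 1 = (z ^ 2 * u z)%C;
  sol_c0 : c O = 1%C
}.

Lemma is_series_C (a : nat -> C) (l : C) :
  is_series (K := C_AbsRing) (V := C_NormedModule) a l ->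
  is_series (fun n => Re (a n)) (Re l) /\ is_series (fun n => Im (a n)) (Im l).
Proof.
  intros H.
  assert (S1 : forall n, sum_n (fun n => Re (a n)) n = Re (sum_n (G := C_AbelianMonoid) a n)).
  { induction n as [|n IH]; [rewrite !sum_O; reflexivity|]. rewrite !sum_Sn, IH. reflexivity. }
  assert (S2 : forall n, sum_n (fun n => Im (a n)) n = Im (sum_n (G := C_AbelianMonoid) a n)).
  { induction n as [|n IH]; [rewrite !sum_O; reflexivity|]. rewrite !sum_Sn, IH. reflexivity. }
  unfold is_series in *. split; apply filterlim_locally; intros eps;
    destruct (proj1 (filterlim_locally _ _) H eps) as [N HN]; exists N; intros n Hn;
    [rewrite S1|rewrite S2]; apply (HN n Hn).
Qed.

Lemma sol_of_is_solution (g lam g3 : C) (u : C -> C) (c : nat -> C) :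
  is_solution g lam g3 u c -> exists du, sol g lam u du c.
Proof.
  intros (Hm & [du Hode] & [r [Hr Hs]] & H0 & _). exists du.
  assert (Hser : forall z : C, z <> 0%C -> Cmod z < r ->
     is_series (fun n => Re (c n * z ^ n)%C) (Re (z ^ 2 * u z)%C) /\
     is_series (fun n => Im (c n * z ^ n)%C) (Im (z ^ 2 * u z)%C)).
  { intros z Hz Hzr. apply is_series_C.
    apply (is_series_ext (fun n => scal (z ^ 2)%C (c n * (z ^ n / z ^ 2))%C)).
    - intros n. unfold scal; simpl; unfold mult; simpl. field. exact Hz.
    - apply (is_series_scal (K := C_AbsRing) (V := C_NormedModule)). apply Hs; assumption. }
  split.
  - intros a. destruct (proj1 (locally'_Cmod _ _) (proj1 (Hm a))) as [d [Hd H]].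
    exists d. split; [exact Hd|]. intros z Hz Hzd. destruct (H z Hz Hzd) as [l Hl].
    apply Cder_not_pole with l. apply Cder_of_is_derive, Hl.
  - intros z Hz. rewrite <- is_pole_iff in Hz. destruct (Hode z Hz) as [H1 H2].
    split; apply Cder_of_is_derive; assumption.
  - exists r. split; [exact Hr|]. split.
    + assert (Hreal : forall s, Rabs s < r -> s <> 0 ->
        ex_pseries (fun n => Re (c n)) s /\ ex_pseries (fun n => Im (c n)) s).
      { intros s Hsr Hs0. destruct (Hser (RtoC s)) as [H1 H2].
        - intros E. apply Hs0. exact (f_equal Re E).
        - rewrite Cmod_R. exact Hsr.
        - split.
          + eexists. eapply is_series_ext; [|exact H1]. intros n. rewrite scal_pow_n, <- RtoC_pow, Re_mult. simpl. unfold Re, Im. ring.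
          + eexists. eapply is_series_ext; [|exact H2]. intros n. rewrite scal_pow_n, <- RtoC_pow, Im_mult. simpl. unfold Re, Im. ring. }
      (* The Laurent expansion says nothing at 0, where the power series converges trivially. *)
      split; intros s Hsr; destruct (Req_dec s 0) as [->|e].
      * exists (Re (c O)). apply (is_pseries_0 (fun n => Re (c n))).
      * exact (proj1 (Hreal s Hsr e)).
      * exists (Im (c O)). apply (is_pseries_0 (fun n => Im (c n))).
      * exact (proj2 (Hreal s Hsr e)).
    + intros z Hz Hzr. destruct (Hser z Hz Hzr) as [H1 H2]. unfold PC, PSeries.
      apply injective_projections; simpl.
      * rewrite (Series_ext _ (fun n => Re (c n * z ^ n)%C)) by (intros n; rewrite pow1; apply Rmult_1_r). apply is_series_unique, H1.
      * rewrite (Series_ext _ (fun n => Im (c n * z ^ n)%C)) by (intros n; rewrite pow1; apply Rmult_1_r). apply is_series_unique, H2.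
  - exact H0.
Qed.

Lemma pole_scale (u : C -> C) (k a z : C) :
  k <> 0%C -> a <> 0%C -> (pole (fun w => k * u (a * w))%C z <-> pole u (a * z)%C).
Proof.
  intros Hk Ha. apply Cmod_gt_0 in Hk as Hk'. apply Cmod_gt_0 in Ha as Ha'. split; intros H M.
  - destruct (H (Cmod k * M)) as [d [Hd B]]. exists (Cmod a * d). split; [apply Rmult_lt_0_compat; assumption|].
    intros w Hw Hwd. specialize (B (w / a)%C). rewrite Cmod_mult in B.
    replace (a * (w / a))%C with w in B by (field; exact Ha).
    apply (Rmult_lt_reg_l (Cmod k)); [exact Hk'|]. apply B.
    + intros E. apply Hw. rewrite <- E. field. exact Ha.
    + replace (w / a - z)%C with ((w - a * z) / a)%C by (field; exact Ha). rewrite Cmod_div by exact Ha.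
      apply (Rmult_lt_reg_l (Cmod a)); [exact Ha'|]. replace (Cmod a * (Cmod (w - a * z) / Cmod a)) with (Cmod (w - a * z)%C) by (field; lra). exact Hwd.
  - destruct (H (M / Cmod k)) as [d [Hd B]]. exists (d / Cmod a). split; [apply Rdiv_lt_0_compat; assumption|].
    intros w Hw Hwd. specialize (B (a * w)%C). rewrite Cmod_mult.
    replace M with (Cmod k * (M / Cmod k)) by (field; lra). apply Rmult_lt_compat_l; [exact Hk'|]. apply B.
    + intros E. apply Hw. replace w with (a * w / a)%C by (field; exact Ha). rewrite E. field. exact Ha.
    + replace (a * w - a * z)%C with (a * (w - z))%C by ring. rewrite Cmod_mult.
      apply Rlt_div_r in Hwd; lra.
Qed.

Lemma Rad_scale (a : C) (c : nat -> C) (r : R) :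
  a <> 0%C -> Rad c r -> Rad (fun n => a ^ n * c n)%C (r / Cmod a).
Proof.
  intros Ha H. apply Cmod_gt_0 in Ha. apply Rad_of_bound. intros t Ht.
  destruct (bound_of_Rad c r (Cmod a * t) H) as [M HM].
  { split; [apply Rmult_le_pos; lra|]. destruct Ht as [_ Ht]. apply Rlt_div_r in Ht; lra. }
  exists M. intros n. apply Rle_trans with (2 := HM n). rewrite Cmod_mult, Cmod_pow, Rpow_mult_distr. right. ring.
Qed.

(** The factor a^2 and two derivatives give u'' the factor a^4; hence weight 4 for [g], and weight 5
    for [lam], whose term also contains z. *)
Lemma sol_scale (g lam : C) (u du : C -> C) (c : nat -> C) (a : C) :
  a <> 0%C -> sol g lam u du c ->
  sol (a ^ 4 * g)%C (a ^ 5 * lam)%C (fun z => a ^ 2 * u (a * z))%C (fun z => a ^ 3 * du (a * z))%C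
    (fun n => a ^ n * c n)%C.
Proof.
  intros Ha [Hi Hd [r [Hr [Hrad Hs]]] H0].
  assert (Ha2 : (a ^ 2)%C <> 0%C) by (apply Cpow_nz, Ha).
  apply Cmod_gt_0 in Ha as Ha'.
  split.
  - intros b. destruct (Hi (a * b)%C) as [d [Hd' B]]. exists (d / Cmod a). split; [apply Rdiv_lt_0_compat; assumption|].
    intros z Hz Hzd. rewrite pole_scale by assumption. apply B.
    + intros E. apply Hz. replace z with (a * z / a)%C by (field; exact Ha). rewrite E. field. exact Ha.
    + replace (a * z - a * b)%C with (a * (z - b))%C by ring. rewrite Cmod_mult.
      apply Rlt_div_r in Hzd; lra.
  - intros z Hz. rewrite pole_scale in Hz by assumption. destruct (Hd _ Hz) as [D1 D2]. split.
    + pose proof (Cder_scale u (a ^ 2)%C a z _ Ha D1) as D. replace (a ^ 3 * du (a * z))%C with (a ^ 2 * a * du (a * z))%C by ring. exact D.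
    + pose proof (Cder_scale du (a ^ 3)%C a z _ Ha D2) as D.
      replace (6 * (a ^ 2 * u (a * z)) ^ 2 - 6 * (a ^ 5 * lam) * z - a ^ 4 * g / 2)%C
        with (a ^ 3 * a * (6 * u (a * z) ^ 2 - 6 * lam * (a * z) - g / 2))%C; [exact D|].
      field.
  - exists (r / Cmod a). split; [apply Rdiv_lt_0_compat; assumption|]. split; [apply Rad_scale; assumption|].
    intros z Hz Hzr.
    rewrite (PC_ext _ (fun n => c n * (a * z) ^ n)%C) by (intros n; rewrite Cpow_mult_l; ring).
    rewrite Hs; [ring| |].
    + apply Cmult_neq_0; assumption.
    + rewrite Cmod_mult. apply Rlt_div_r in Hzr; lra.
  - rewrite H0. simpl. ring.
Qed.

(** * The recurrence for the Laurent coefficients *)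

(** Coefficients of z^4 (6 lam z + g / 2). *)
Definition forcing (g lam : C) (n : nat) : C :=
  ((if Nat.eqb n 5 then 6 * lam else 0) + (if Nat.eqb n 4 then g / 2 else 0))%C.

(* The coefficient of [z ^ (n - 4)] in the differential equation for [u = sum c_n z ^ (n - 2)]. *)
Definition rec (g lam : C) (c : nat -> C) : Prop :=
  forall n, (RtoC (INR n - 3) * (RtoC (INR n - 2) * c n) = 6 * conv c c n - forcing g lam n)%C.

Lemma Rad_forcing (g lam : C) (rho : R) : Rad (forcing g lam) rho.
Proof. apply Rad_plus; apply Rad_single. Qed.

Lemma PC_forcing (g lam : C) (s : R) : PC (forcing g lam) s = (6 * lam * s ^ 5 + g / 2 * s ^ 4)%C.
Proof.
  unfold forcing. rewrite (PC_plus _ _ (Rabs s + 1)); [|apply Rad_single|apply Rad_single|lra].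
  rewrite !PC_single. reflexivity.
Qed.

Lemma PC_rec_rhs (g lam : C) (c : nat -> C) (rho s : R) :
  Rad c rho -> Rabs s < rho ->
  PC (fun n => 6 * conv c c n + -1 * forcing g lam n)%C s
    = (6 * PC c s ^ 2 - (6 * lam * s ^ 5 + g / 2 * s ^ 4))%C.
Proof.
  intros H Hs. rewrite (PC_plus _ _ rho); [|apply Rad_scal, Rad_conv; assumption|apply Rad_scal, Rad_forcing|exact Hs].
  rewrite (PC_scal _ _ rho), (PC_conv _ _ rho), (PC_scal _ _ rho), PC_forcing; try assumption.
  - ring.
  - apply Rad_forcing.
  - apply Rad_conv; assumption.
Qed.

Lemma RtoC_neq_0 (s : R) : s <> 0 -> RtoC s <> 0%C.
Proof. intros H E. apply H. exact (f_equal Re E). Qed.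

Lemma Rad_euler2 (c : nat -> C) (rho : R) : Rad c rho ->
  Rad (fun n => RtoC (INR n - 3) * (RtoC (INR n - 2) * c n))%C rho.
Proof. intros H. apply (Rad_euler 3), (Rad_euler 2), H. Qed.

Lemma cder_PC_div2 (c : nat -> C) (rho s : R) : Rad c rho -> Rabs s < rho -> s <> 0 ->
  cder (fun t => PC c t / RtoC (t ^ 2))%C s (PC (fun n => RtoC (INR n - 2) * c n)%C s / RtoC (s ^ 3))%C
  /\ cder (fun t => PC (fun n => RtoC (INR n - 2) * c n)%C t / RtoC (t ^ 3))%C s
     (PC (fun n => RtoC (INR n - 3) * (RtoC (INR n - 2) * c n))%C s / RtoC (s ^ 4))%C.
Proof.
  intros H Hs Hs0. split.
  - pose proof (cder_PC_div 2 c rho s H Hs Hs0) as D. simpl INR in D. replace (1 + 1) with 2 in D by ring. exact D.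
  - pose proof (cder_PC_div 3 _ rho s (Rad_euler 2 c rho H) Hs Hs0) as D.
    replace (INR 3) with 3 in D by (simpl; ring). exact D.
Qed.

(** A formal solution is an actual one on its whole interval of convergence, so it can be compared
    with [u] by uniqueness for the equation. *)
Lemma series_ode (g lam : C) (c : nat -> C) (rho s : R) :
  rec g lam c -> Rad c rho -> Rabs s < rho -> s <> 0 ->
  cder (fun t => PC (fun n => RtoC (INR n - 2) * c n)%C t / RtoC (t ^ 3))%C s
     (6 * (PC c s / RtoC (s ^ 2)) ^ 2 - 6 * lam * s - g / 2)%C.
Proof.
  intros Hrec H Hs Hs0. eapply cder_eq; [apply (cder_PC_div2 c rho s H Hs Hs0)|].
  rewrite (PC_ext _ (fun n => 6 * conv c c n + -1 * forcing g lam n)%C).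
  2:{ intros n. rewrite Hrec. ring. }
  rewrite (PC_rec_rhs g lam c rho s H Hs). rewrite !RtoC_pow.
  field. exact (RtoC_neq_0 s Hs0).
Qed.

Lemma punctured_neighbourhood (s r : R) : s <> 0 -> Rabs s < r ->
  exists d, 0 < d /\ forall t, Rabs (t - s) < d -> t <> 0 /\ Rabs t < r.
Proof.
  intros Hs Hr. pose proof (Rabs_pos_lt s Hs).
  destruct (pos_min (Rabs s) (r - Rabs s)) as [d [Hd [L1 L2]]]; [lra|lra|]. exists d. split; [exact Hd|].
  intros t Ht. split.
  - intros ->. rewrite Rminus_0_l, Rabs_Ropp in Ht. lra.
  - pose proof (Rabs_triang (t - s) s) as T. replace (t - s + s) with t in T by ring. lra.
Qed.

Lemma sol_real_series (g lam : C) (u du : C -> C) (c : nat -> C) : sol g lam u du c ->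
  exists r, 0 < r /\ Rad c r /\ forall s, s <> 0 -> Rabs s < r -> ~ pole u (RtoC s)
    /\ u (RtoC s) = (PC c s / RtoC (s ^ 2))%C
    /\ du (RtoC s) = (PC (fun n => RtoC (INR n - 2) * c n)%C s / RtoC (s ^ 3))%C.
Proof.
  intros [Hi Hd [r1 [Hr1 [Hrad Hs]]] H0]. destruct (Hi 0%C) as [r2 [Hr2 B]].
  assert (E1 : forall s, s <> 0 -> Rabs s < r1 -> u (RtoC s) = (PC c s / RtoC (s ^ 2))%C).
  { intros s Hs0 Hsr. rewrite <- (Rmult_1_r s) at 2. rewrite <- PC_comp_scal.
    rewrite (PC_ext _ (fun n => c n * RtoC s ^ n)%C) by (intros n; rewrite RtoC_pow; ring).
    rewrite Hs; [|apply RtoC_neq_0, Hs0|rewrite Cmod_R; exact Hsr].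
    rewrite RtoC_pow. field. apply RtoC_neq_0, Hs0. }
  set (r := Rmin r1 r2). assert (Hr : 0 < r) by (apply Rmin_pos; assumption).
  assert (Hl1 : r <= r1) by apply Rmin_l. assert (Hl2 : r <= r2) by apply Rmin_r.
  exists r. split; [exact Hr|]. split; [apply Rad_le with r1; assumption|].
  intros s Hs0 Hsr.
  assert (Hnp : ~ pole u (RtoC s)).
  { apply B; [apply RtoC_neq_0, Hs0|]. replace (s - 0)%C with (RtoC s) by ring. rewrite Cmod_R. lra. }
  split; [exact Hnp|]. split; [apply E1; [exact Hs0|lra]|].
  destruct (Hd _ Hnp) as [D1 _].
  (* Both sides are derivatives of the same curve, so the expansion of [du] comes from
     differentiating that of [u]. *)
  apply (cder_unique (fun t => u (RtoC t)) s).
  - exact (cder_real_line u s _ D1).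
  - eapply cder_ext_loc; [|apply (cder_PC_div2 c r1 s Hrad); [lra|exact Hs0]].
    destruct (punctured_neighbourhood s r1 Hs0 ltac:(lra)) as [d [Hd' B']]. exists d. split; [exact Hd'|].
    intros t Ht. symmetry. apply E1; apply B', Ht.
Qed.

Lemma sol_rec (g lam : C) (u du : C -> C) (c : nat -> C) : sol g lam u du c -> rec g lam c.
Proof.
  intros H n. destruct (sol_real_series _ _ _ _ _ H) as [r [Hr [Hrad E]]].
  transitivity (6 * conv c c n + -1 * forcing g lam n)%C; [|ring].
  apply (PC_unique _ (fun n => 6 * conv c c n + -1 * forcing g lam n)%C r n Hr (Rad_euler2 c r Hrad)).
  { apply Rad_plus; apply Rad_scal; [apply Rad_conv; assumption|apply Rad_forcing]. }
  intros s Hsr. destruct (Req_dec s 0) as [->|Hs0].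
  { rewrite !PC_0. unfold conv, forcing; simpl csum. simpl Nat.eqb. cbv iota. simpl Nat.sub.
    rewrite (sol_c0 _ _ _ _ _ H). simpl INR. apply injective_projections; simpl; ring. }
  rewrite (PC_rec_rhs g lam c r s Hrad Hsr).
  destruct (E s Hs0 Hsr) as (Hnp & E1 & _).
  destruct (sol_der _ _ _ _ _ H _ Hnp) as [_ D2].
  assert (Heq : (PC (fun n => RtoC (INR n - 3) * (RtoC (INR n - 2) * c n))%C s / RtoC (s ^ 4)
     = 6 * u (RtoC s) ^ 2 - 6 * lam * s - g / 2)%C).
  { apply (cder_unique (fun t => du (RtoC t)) s).
    - eapply cder_ext_loc; [|apply (cder_PC_div2 c r s Hrad Hsr Hs0)].
      destruct (punctured_neighbourhood s r Hs0 Hsr) as [d [Hd B]]. exists d. split; [exact Hd|].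
      intros t Ht. symmetry. apply E; apply B, Ht.
    - exact (cder_real_line du s _ D2). }
  rewrite E1, !RtoC_pow in Heq. pose proof (RtoC_neq_0 s Hs0) as Hsc.
  transitivity (s ^ 4 * (PC (fun n => RtoC (INR n - 3) * (RtoC (INR n - 2) * c n))%C s / s ^ 4))%C; [field; exact Hsc|].
  rewrite Heq. field. exact Hsc.
Qed.

(** This replaces analytic continuation along the ray: [u] and the sum of its series solve the same
    equation up to [rho] and have the same initial data at a small starting point. *)
Lemma ray_series (g lam : C) (u du : C -> C) (c : nat -> C) (rho : R) :
  sol g lam u du c -> Rad c rho -> (forall s, 0 < s < rho -> ~ pole u (RtoC s)) ->
  forall s, 0 < s < rho -> u (RtoC s) = (PC c s / RtoC (s ^ 2))%C.
Proof.
  intros H Hrad Hnp s Hs. pose proof (sol_rec _ _ _ _ _ H) as Hrec.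
  destruct (sol_real_series _ _ _ _ _ H) as [r [Hr [_ E]]].
  set (e := Rmin (r / 2) s). assert (He : 0 < e) by (apply Rmin_pos; lra).
  assert (Hes : e <= s) by apply Rmin_r. assert (Her : e < r) by (apply Rle_lt_trans with (1 := Rmin_l _ _); lra).
  destruct (E e ltac:(lra) ltac:(rewrite Rabs_right; lra)) as (_ & E1 & E2).
  refine (proj1 (ode_unique_interval (fun t => u (RtoC t)) (fun t => du (RtoC t))
    (fun t => PC c t / RtoC (t ^ 2))%C (fun t => PC (fun n => RtoC (INR n - 2) * c n)%C t / RtoC (t ^ 3))%C
    (fun t => 6 * lam * t + g / 2)%C 1%C e s Hes _ E1 E2)).
  intros t Ht.
  assert (Hta : Rabs t < rho) by (rewrite Rabs_right; lra).
  assert (Ht0 : t <> 0) by lra.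
  destruct (sol_der _ _ _ _ _ H (RtoC t)) as [D1 D2]; [apply Hnp; lra|].
  split; [|split; [|split]].
  - eapply cder_eq; [exact (cder_real_line u t _ D1)|]. symmetry. apply Cmult_1_l.
  - eapply cder_eq; [exact (cder_real_line du t _ D2)|]. ring.
  - eapply cder_eq; [exact (proj1 (cder_PC_div2 c rho t Hrad Hta Ht0))|]. symmetry. apply Cmult_1_l.
  - eapply cder_eq; [exact (series_ode g lam c rho t Hrec Hrad Hta Ht0)|]. ring.
Qed.

(** * Uniqueness *)

(** With c_0 = 1 the two end terms of the Cauchy square give 2 c_n; the others involve only indices
    strictly between 0 and n. The ends are replaced by 0 so that the range of summation stays the
    same. *)
Lemma conv_S (c : nat -> C) (n : nat) : c O = 1%C -> (0 < n)%nat ->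
  conv c c n = (2 * c n + csum (fun j => if Nat.eqb j 0 then 0 else if Nat.eqb j n then 0 else c j * c (n - j)%nat) n)%C.
Proof.
  intros H0 Hn. unfold conv.
  assert (G : forall (f : nat -> C) (m : nat), (0 < m)%nat -> csum f m = (f O + f m + csum (fun j => if Nat.eqb j 0 then 0 else if Nat.eqb j m then 0 else f j) m)%C).
  { intros f m Hm.
    assert (G1 : forall k, (k < m)%nat -> csum f k = (f O + csum (fun j => if Nat.eqb j 0 then 0 else if Nat.eqb j m then 0 else f j) k)%C).
    { induction k as [|k IH]; intros Hk; [simpl; ring|]. cbn [csum]. rewrite IH by lia.
      destruct (Nat.eqb_spec (S k) m); [lia|]. simpl Nat.eqb. cbv iota. ring. }
    destruct m as [|m]; [lia|]. cbn [csum]. rewrite G1 by lia. rewrite Nat.eqb_refl. simpl Nat.eqb. cbv iota. ring. }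
  rewrite G by exact Hn. rewrite Nat.sub_0_r, Nat.sub_diag, H0. ring.
Qed.

(** Moving 12 c_n to the left leaves (n - 3)(n - 2) - 12 = (n - 6)(n + 1). Its zero at n = 6 is the
    resonance that makes c_6 free. *)
Lemma rec_solved (g lam : C) (c : nat -> C) (n : nat) : rec g lam c -> c O = 1%C -> (0 < n)%nat ->
  (RtoC ((INR n - 6) * (INR n + 1)) * c n =
   6 * csum (fun j => if Nat.eqb j 0 then 0 else if Nat.eqb j n then 0 else c j * c (n - j)%nat) n - forcing g lam n)%C.
Proof.
  intros H H0 Hn. specialize (H n). rewrite (conv_S c n H0 Hn) in H.
  replace ((INR n - 6) * (INR n + 1)) with ((INR n - 3) * (INR n - 2) - 12) by ring.
  rewrite RtoC_minus, RtoC_mult.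
  replace ((RtoC (INR n - 3) * RtoC (INR n - 2) - RtoC 12) * c n)%C
    with (RtoC (INR n - 3) * (RtoC (INR n - 2) * c n) - 12 * c n)%C by ring.
  rewrite H. ring.
Qed.

Lemma rec_unique (g lam : C) (c d : nat -> C) : rec g lam c -> rec g lam d ->
  c O = 1%C -> d O = 1%C -> c 6%nat = d 6%nat -> forall n, c n = d n.
Proof.
  intros Hc Hd Hc0 Hd0 H6 n. induction n as [n IH] using (well_founded_induction Wf_nat.lt_wf).
  destruct (Nat.eq_dec n 0) as [->|Hn0]; [congruence|]. destruct (Nat.eq_dec n 6) as [->|Hn6]; [exact H6|].
  pose proof (rec_solved g lam c n Hc Hc0 ltac:(lia)) as E1. pose proof (rec_solved g lam d n Hd Hd0 ltac:(lia)) as E2.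
  assert (Hz : (INR n - 6) * (INR n + 1) <> 0).
  { apply Rmult_integral_contrapositive. pose proof (pos_INR n). split; [|lra].
    intros E. apply Hn6. apply INR_eq. simpl. lra. }
  assert (E : (RtoC ((INR n - 6) * (INR n + 1)) * c n = RtoC ((INR n - 6) * (INR n + 1)) * d n)%C).
  { rewrite E1, E2. do 2 f_equal. apply csum_ext. intros j Hj.
    destruct (Nat.eqb_spec j 0); [reflexivity|]. destruct (Nat.eqb_spec j n); [reflexivity|].
    rewrite !IH by lia. reflexivity. }
  apply RtoC_neq_0 in Hz. apply (f_equal (fun x => x / RtoC ((INR n - 6) * (INR n + 1)))%C) in E.
  set (x := RtoC ((INR n - 6) * (INR n + 1))) in *.
  replace (x * c n / x)%C with (c n) in E by (field; exact Hz). replace (x * d n / x)%C with (d n) in E by (field; exact Hz). exact E.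
Qed.

(** Punctured, because the values stored at poles are arbitrary. *)
Definition agree (u v : C -> C) (a : C) : Prop :=
  exists d, 0 < d /\ forall z, z <> a -> Cmod (z - a)%C < d -> u z = v z.

Lemma agree_sym (u v : C -> C) (a : C) : agree u v a -> agree v u a.
Proof. intros [d [Hd H]]. exists d. split; [exact Hd|]. intros. symmetry. apply H; assumption. Qed.

Lemma agree_pole (u v : C -> C) (a : C) : agree u v a -> pole u a -> pole v a.
Proof.
  intros [d [Hd H]] Hp M. destruct (Hp M) as [d' [Hd' H']]. exists (Rmin d d').
  split; [apply Rmin_pos; assumption|]. intros z Hz Hzd.
  rewrite <- H; [apply H'| |]; try assumption; apply Rlt_le_trans with (1 := Hzd); [apply Rmin_r|apply Rmin_l].
Qed.

(** Both functions are continuous at [a], and approaching it along one real direction is enough. *)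
Lemma agree_value (u v : C -> C) (a l m : C) : agree u v a -> Cder u a l -> Cder v a m -> u a = v a.
Proof.
  intros [d [Hd H]] Du Dv. assert (E0 : (a + 0 * 1)%C = a) by ring. rewrite <- E0 in Du, Dv.
  apply cder_line in Du, Dv.
  assert (Hz : ~ 0 < Cmod (u a - v a)).
  { intros Hpos. set (x := Cmod (u a - v a)) in *.
    destruct (cder_continuous _ _ _ Du (x / 2)) as [d1 [Hd1 B1]]; [lra|].
    destruct (cder_continuous _ _ _ Dv (x / 2)) as [d2 [Hd2 B2]]; [lra|].
    destruct (pos_min d1 d2 Hd1 Hd2) as [r1 [Hr1 [L1 L2]]]. destruct (pos_min r1 d Hr1 Hd) as [r [Hr [L3 L4]]].
    assert (Ha : Rabs (r / 2 - 0) = r / 2) by (rewrite Rabs_right; lra).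
    specialize (B1 (r / 2)). specialize (B2 (r / 2)). rewrite Ha, E0 in B1, B2.
    specialize (B1 ltac:(lra)). specialize (B2 ltac:(lra)). set (b := (a + RtoC (r / 2) * 1)%C) in *.
    assert (Eb : Cmod (b - a) = r / 2).
    { unfold b. replace (a + RtoC (r / 2) * 1 - a)%C with (RtoC (r / 2)) by ring. rewrite Cmod_R, Rabs_right; lra. }
    rewrite (H b) in B1; [| |lra].
    - pose proof (Cmod_triangle (v b - v a) (- (v b - u a))) as T. rewrite Cmod_opp in T.
      replace (v b - v a + - (v b - u a))%C with (u a - v a)%C in T by ring. fold x in T. lra.
    - intros E. rewrite E in Eb. replace (a - a)%C with (RtoC 0) in Eb by ring. rewrite Cmod_0 in Eb. lra. }
  pose proof (Cmod_ge_0 (u a - v a)).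
  replace (u a) with (u a - v a + v a)%C by ring. rewrite (Cmod_eq_0 (u a - v a)) by lra. ring.
Qed.

Lemma agree_from_punctured (u v : C -> C) (a b : C) (d : R) :
  (forall z, z <> a -> Cmod (z - a)%C < d -> u z = v z) -> Cmod (b - a)%C < d -> agree u v b.
Proof.
  intros H Hb. pose proof (Cmod_ge_0 (b - a)%C).
  assert (T : forall z, Cmod (z - a)%C <= Cmod (z - b)%C + Cmod (b - a)%C).
  { intros z. replace (z - a)%C with ((z - b) + (b - a))%C by ring. apply Cmod_triangle. }
  destruct (Req_dec (Cmod (b - a)%C) 0) as [E|E].
  - apply Cmod_eq_0 in E. assert (b = a) by (replace b with (b - a + a)%C by ring; rewrite E; ring).
    subst b. exists d. split; [lra|exact H].
  (* This radius keeps the disc around [b] inside the larger disc and away from its centre [a]. *)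
  - exists (Rmin (Cmod (b - a)%C) (d - Cmod (b - a)%C)). split; [apply Rmin_pos; lra|].
    intros z Hz Hzd. pose proof (Rmin_l (Cmod (b - a)%C) (d - Cmod (b - a)%C)).
    pose proof (Rmin_r (Cmod (b - a)%C) (d - Cmod (b - a)%C)). specialize (T z).
    apply H; [|lra]. intros ->. rewrite (Cmod_minus_sym a b) in Hzd. lra.
Qed.

Lemma segment_unique (g lam : C) (u du v dv : C -> C) (c d : nat -> C) (a h : C) :
  sol g lam u du c -> sol g lam v dv d ->
  (forall t, 0 <= t <= 1 -> ~ pole u (a + RtoC t * h)%C /\ ~ pole v (a + RtoC t * h)%C) ->
  u a = v a -> du a = dv a -> u (a + h)%C = v (a + h)%C /\ du (a + h)%C = dv (a + h)%C.
Proof.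
  intros Hu Hv Hnp E1 E2.
  assert (P0 : (a + 0 * h)%C = a) by ring. assert (P1 : (a + 1 * h)%C = (a + h)%C) by ring.
  rewrite <- P1.
  apply (ode_unique_interval (fun t => u (a + RtoC t * h)%C) (fun t => du (a + RtoC t * h)%C)
     (fun t => v (a + RtoC t * h)%C) (fun t => dv (a + RtoC t * h)%C)
     (fun t => 6 * lam * (a + RtoC t * h) + g / 2)%C h 0 1); [lra| |rewrite P0; exact E1|rewrite P0; exact E2].
  intros t Ht. destruct (Hnp t Ht) as [N1 N2].
  destruct (sol_der _ _ _ _ _ Hu _ N1) as [D1 D2]. destruct (sol_der _ _ _ _ _ Hv _ N2) as [D3 D4].
  split; [apply cder_line, D1|]. split; [|split; [apply cder_line, D3|]].
  - eapply cder_eq; [apply cder_line, D2|]. ring.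
  - eapply cder_eq; [apply cder_line, D4|]. ring.
Qed.

(** A single segment in a punctured disc may pass through the centre. After division by [p] the
    detour goes through i or -i, chosen on the side of the real axis where q / p lies, so neither
    piece meets 0. *)
Lemma two_segments (p q : C) (d : R) :
  p <> 0%C -> q <> 0%C -> Cmod p < d -> Cmod q < d ->
  exists m, forall t, 0 <= t <= 1 ->
    ((p + RtoC t * (m - p))%C <> 0%C /\ Cmod (p + RtoC t * (m - p))%C < d) /\
    ((m + RtoC t * (q - m))%C <> 0%C /\ Cmod (m + RtoC t * (q - m))%C < d).
Proof.
  intros Hp Hq Hpd Hqd.
  assert (Hconv : forall x y t, 0 <= t <= 1 -> Cmod x < d -> Cmod y < d -> Cmod (x + RtoC t * (y - x))%C < d).
  { intros x y t Ht Hx Hy. replace (x + RtoC t * (y - x))%C with (RtoC (1 - t) * x + RtoC t * y)%C by (rewrite RtoC_minus; ring).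
    apply Rle_lt_trans with (1 := Cmod_triangle _ _). rewrite !Cmod_mult, !Cmod_R, !Rabs_right by lra.
    destruct (Req_dec t 0) as [->|]; [lra|]. nra. }
  set (w := (q / p)%C).
  assert (Hw : q = (w * p)%C) by (unfold w; field; exact Hp).
  assert (Hw0 : w <> 0%C) by (intros E; apply Hq; rewrite Hw, E; ring).
  clearbody w.
  set (e := if Rle_lt_dec 0 (Im w) then 1 else -1).
  assert (Hm : Cmod ((0, e) * p)%C = Cmod p).
  { rewrite Cmod_mult. replace (Cmod (0, e)) with 1; [ring|].
    unfold Cmod; simpl. replace (0 * (0 * 1) + e * (e * 1)) with 1 by (unfold e; destruct Rle_lt_dec; ring).
    symmetry. apply sqrt_1. }
  assert (Hprod : forall x : C, x <> 0%C -> (x * p)%C <> 0%C). { intros x Hx. apply Cmult_neq_0. exact Hx. exact Hp. }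
  exists ((0, e) * p)%C. intros t Ht. split; (split; [|apply Hconv; try rewrite Hm; assumption]).
  - replace (p + RtoC t * ((0, e) * p - p))%C with ((1 + RtoC t * ((0, e) - 1)) * p)%C by ring.
    apply Hprod. intros E. pose proof (f_equal Re E) as E1. pose proof (f_equal Im E) as E2. simpl in E1, E2.
    assert (t = 1) by lra. subst t. unfold e in E2. destruct Rle_lt_dec; lra.
  - rewrite Hw. replace ((0, e) * p + RtoC t * (w * p - (0, e) * p))%C with (((0, e) + RtoC t * (w - (0, e))) * p)%C by ring.
    apply Hprod. intros E. pose proof (f_equal Re E) as E1. pose proof (f_equal Im E) as E2.
    simpl in E1, E2. change (fst w) with (Re w) in *. change (snd w) with (Im w) in *.
    assert (E2' : (1 - t) * e + t * Im w = 0) by lra.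
    assert (E1' : t * Re w = 0) by lra.
    destruct (Req_dec t 1) as [->|Ht1].
    { apply Hw0. apply injective_projections; simpl; unfold Re, Im in *; lra. }
    unfold e in E2'. destruct Rle_lt_dec; nra.
Qed.

Lemma agree_propagate (g lam : C) (u du v dv : C -> C) (c d : nat -> C) (a b : C) (r : R) :
  sol g lam u du c -> sol g lam v dv d ->
  (forall z, z <> a -> Cmod (z - a)%C < r -> ~ pole u z /\ ~ pole v z) ->
  Cmod (b - a)%C < r -> agree u v b ->
  forall z, z <> a -> Cmod (z - a)%C < r -> u z = v z.
Proof.
  intros Hu Hv Hnp Hb [s [Hs Hag]] z Hz Hzr.
  pose proof (Cmod_ge_0 (b - a)%C) as Hba.
  (* [m] is |b - a|, or 1 when b = a; the point [p] at distance [e] from [b] then differs from both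
     [a] and [b]. *)
  set (m := if Req_dec_T (Cmod (b - a)%C) 0 then 1 else Cmod (b - a)%C).
  assert (Hm : 0 < m) by (unfold m; destruct Req_dec_T; lra).
  assert (Hm' : Cmod (b - a)%C = 0 \/ m = Cmod (b - a)%C) by (unfold m; destruct Req_dec_T; [left|right]; trivial).
  set (e := Rmin (Rmin s m) (r - Cmod (b - a)%C) / 2).
  assert (He : 0 < Rmin (Rmin s m) (r - Cmod (b - a)%C)) by (repeat apply Rmin_pos; lra).
  pose proof (Rmin_l (Rmin s m) (r - Cmod (b - a)%C)). pose proof (Rmin_r (Rmin s m) (r - Cmod (b - a)%C)).
  pose proof (Rmin_l s m). pose proof (Rmin_r s m).
  set (p := (b + e)%C).
  assert (Epb : Cmod (p - b)%C = e).
  { unfold p. replace (b + e - b)%C with (RtoC e) by ring. rewrite Cmod_R, Rabs_right; unfold e; lra. }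
  assert (Hpa : p <> a).
  { intros E. rewrite E in Epb. rewrite (Cmod_minus_sym a b) in Epb. unfold e in *. destruct Hm'; lra. }
  assert (Hpr : Cmod (p - a)%C < r).
  { replace (p - a)%C with ((p - b) + (b - a))%C by ring.
    apply Rle_lt_trans with (1 := Cmod_triangle _ _). rewrite Epb. unfold e. lra. }
  assert (Hnear : forall w, Cmod (w - p)%C < e -> u w = v w).
  { intros w Hw. apply Hag.
    - intros E. rewrite E, Cmod_minus_sym in Hw. lra.
    - replace (w - b)%C with ((w - p) + (p - b))%C by ring.
      apply Rle_lt_trans with (1 := Cmod_triangle _ _). rewrite Epb. unfold e in *. lra. }
  assert (Ep : u p = v p).
  { apply Hnear. replace (p - p)%C with (RtoC 0) by ring. rewrite Cmod_0. unfold e; lra. }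
  (* Agreement on a full disc around [p] gives equal derivatives there, hence equal initial data for
     the two segments. *)
  assert (Edp : du p = dv p).
  { destruct (Hnp p Hpa Hpr) as [N1 N2].
    destruct (sol_der _ _ _ _ _ Hu _ N1) as [D1 _]. destruct (sol_der _ _ _ _ _ Hv _ N2) as [D2 _].
    assert (P0 : (p + 0 * 1)%C = p) by ring.
    assert (D1' : Cder u (p + 0 * 1)%C (du p)) by (rewrite P0; exact D1).
    assert (D2' : Cder v (p + 0 * 1)%C (dv p)) by (rewrite P0; exact D2).
    apply cder_line in D1', D2'.
    replace (du p) with (1 * du p)%C by ring. replace (dv p) with (1 * dv p)%C by ring.
    apply (cder_unique (fun t => u (p + RtoC t * 1)%C) 0); [exact D1'|].
    eapply cder_ext_loc; [|exact D2']. exists e. split; [unfold e; lra|]. intros t Ht. symmetry. apply Hnear.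
    replace (p + RtoC t * 1 - p)%C with (RtoC t) by ring. rewrite Cmod_R. rewrite Rminus_0_r in Ht. exact Ht. }
  assert (Hsub : forall x, x <> a -> (x - a)%C <> 0%C).
  { intros x Hx E. apply Hx. replace x with (x - a + a)%C by ring. rewrite E. ring. }
  destruct (two_segments (p - a) (z - a) r (Hsub p Hpa) (Hsub z Hz) Hpr Hzr) as [w Hw].
  assert (Hav : forall x, (x - a)%C <> 0%C -> x <> a).
  { intros x Hx E. apply Hx. rewrite E. ring. }
  destruct (segment_unique g lam u du v dv c d p (w + a - p) Hu Hv) as [F1 F2]; try assumption.
  { intros t Ht. destruct (Hw t Ht) as [[W1 W2] _].
    replace (p - a + RtoC t * (w - (p - a)))%C with (p + RtoC t * (w + a - p) - a)%C in W1, W2 by ring.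
    apply Hnp; [apply Hav, W1|exact W2]. }
  replace (p + (w + a - p))%C with (w + a)%C in F1, F2 by ring.
  destruct (segment_unique g lam u du v dv c d (w + a) (z - (w + a)) Hu Hv) as [G1 G2]; try assumption.
  { intros t Ht. destruct (Hw t Ht) as [_ [W1 W2]].
    replace (w + RtoC t * (z - a - w))%C with (w + a + RtoC t * (z - (w + a)) - a)%C in W1, W2 by ring.
    apply Hnp; [apply Hav, W1|exact W2]. }
  replace (w + a + (z - (w + a)))%C with z in G1 by ring. exact G1.
Qed.

(** The segment from 0 to [z] may run through poles. Around each of its points some punctured disc
    is free of poles of both functions, and agreement spreads over it. *)
Lemma agree_everywhere (g lam : C) (u du v dv : C -> C) (c d : nat -> C) :
  sol g lam u du c -> sol g lam v dv d -> agree u v 0%C -> forall z, agree u v z.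
Proof.
  intros Hu Hv H0 z.
  assert (E0 : (0 * z)%C = 0%C) by ring. assert (E1 : (1 * z)%C = z) by ring.
  rewrite <- E1. apply (locally_constant_prop (fun s => agree u v (RtoC s * z)%C) 0 1); [lra| |rewrite E0; exact H0].
  intros s Hs.
  destruct (sol_isolated _ _ _ _ _ Hu (RtoC s * z)%C) as [r1 [Hr1 B1]].
  destruct (sol_isolated _ _ _ _ _ Hv (RtoC s * z)%C) as [r2 [Hr2 B2]].
  set (r := Rmin r1 r2). assert (Hr : 0 < r) by (apply Rmin_pos; assumption).
  assert (L1 : r <= r1) by apply Rmin_l. assert (L2 : r <= r2) by apply Rmin_r.
  pose proof (Cmod_ge_0 z).
  exists (r / (Cmod z + 1)). split; [apply Rdiv_lt_0_compat; lra|].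
  assert (Hclose : forall t, Rabs (t - s) < r / (Cmod z + 1) -> Cmod (RtoC t * z - RtoC s * z)%C < r).
  { intros t Ht. replace (RtoC t * z - RtoC s * z)%C with (RtoC (t - s) * z)%C by (rewrite RtoC_minus; ring).
    rewrite Cmod_mult, Cmod_R. apply (Rmult_lt_compat_r (Cmod z + 1)) in Ht; [|lra].
    replace (r / (Cmod z + 1) * (Cmod z + 1)) with r in Ht by (field; lra).
    pose proof (Rabs_pos (t - s)). nra. }
  intros s1 s2 _ _ Hs1 Hs2 Hag.
  apply agree_from_punctured with (RtoC s * z)%C r; [|apply Hclose, Hs2].
  apply (agree_propagate g lam u du v dv c d _ (RtoC s1 * z)%C r Hu Hv); [|apply Hclose, Hs1|exact Hag].
  intros w Hw Hwr. split; [apply B1|apply B2]; try assumption; lra.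
Qed.

Lemma sol_unique (g lam : C) (u du v dv : C -> C) (c d : nat -> C) :
  sol g lam u du c -> sol g lam v dv d -> c 6%nat = d 6%nat ->
  forall z, (pole u z <-> pole v z) /\ (~ pole u z -> u z = v z).
Proof.
  intros Hu Hv H6.
  pose proof (rec_unique g lam c d (sol_rec _ _ _ _ _ Hu) (sol_rec _ _ _ _ _ Hv)
    (sol_c0 _ _ _ _ _ Hu) (sol_c0 _ _ _ _ _ Hv) H6) as Ecd.
  assert (H0 : agree u v 0%C).
  { destruct (sol_series _ _ _ _ _ Hu) as [r1 [Hr1 [_ S1]]]. destruct (sol_series _ _ _ _ _ Hv) as [r2 [Hr2 [_ S2]]].
    exists (Rmin r1 r2). split; [apply Rmin_pos; assumption|]. intros z Hz Hzr.
    replace (z - 0)%C with z in Hzr by ring.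
    pose proof (Rmin_l r1 r2). pose proof (Rmin_r r1 r2).
    specialize (S1 z Hz ltac:(lra)). specialize (S2 z Hz ltac:(lra)).
    rewrite (PC_ext _ (fun n => d n * z ^ n)%C) in S1 by (intros n; rewrite Ecd; reflexivity).
    rewrite S2 in S1. replace (u z) with (z ^ 2 * u z / z ^ 2)%C by (field; exact Hz). rewrite <- S1. field. exact Hz. }
  intros z. pose proof (agree_everywhere g lam u du v dv c d Hu Hv H0 z) as Hz.
  assert (Hiff : pole u z <-> pole v z).
  { split; [apply agree_pole, Hz|apply agree_pole, agree_sym, Hz]. }
  split; [exact Hiff|]. intros Hnp.
  assert (Hnp' : ~ pole v z) by (rewrite <- Hiff; exact Hnp).
  apply (agree_value u v z (du z) (dv z) Hz).
  - apply (sol_der _ _ _ _ _ Hu z Hnp).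
  - apply (sol_der _ _ _ _ _ Hv z Hnp').
Qed.

Lemma sol_scaling_invariant (g lam : C) (u du : C -> C) (c : nat -> C) (xi : C) :
  sol g lam u du c -> xi <> 0%C -> (xi ^ 4 * g = g)%C -> (xi ^ 5 * lam = lam)%C -> (xi ^ 6 * c 6%nat = c 6%nat)%C ->
  scaling_invariant u xi.
Proof.
  intros H Hxi E4 E5 E6 z.
  pose proof (sol_scale g lam u du c xi Hxi H) as Hs. rewrite E4, E5 in Hs.
  destruct (sol_unique _ _ _ _ _ _ _ _ H Hs (eq_sym E6) z) as [H1 H2].
  rewrite (pole_scale u (xi ^ 2)%C xi z) in H1 by (try apply Cpow_nz; exact Hxi).
  split.
  - rewrite !is_pole_iff. symmetry. exact H1.
  - rewrite is_pole_iff. intros Hnp. rewrite (H2 Hnp). field. exact Hxi.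
Qed.

(** * Bounds off the positive ray *)

(** As long as domination holds up to x, Y' - Re (e W') is nondecreasing and starts nonnegative, so
    Y - Re (e W) never falls below the initial gap Y(a) - |W(a)|. This strict margin is what
    continues the domination beyond x. *)
Lemma comparison (W W1 W2 : R -> C) (Y Y1 Y2 : R -> R) (a b : R) :
  a <= b ->
  (forall s, a <= s <= b -> cder W s (W1 s) /\ cder W1 s (W2 s)) ->
  (forall s, a <= s <= b -> is_derive Y s (Y1 s) /\ is_derive Y1 s (Y2 s)) ->
  (forall s, a <= s <= b -> Cmod (W s) <= Y s -> Cmod (W2 s) <= Y2 s) ->
  Cmod (W a) < Y a -> Cmod (W1 a) <= Y1 a ->
  forall s, a <= s <= b -> Cmod (W s) <= Y s.
Proof.
  intros Hab HW HY Hsup Ha Ha1.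
  set (gap := Y a - Cmod (W a)). assert (Hgap : 0 < gap) by (unfold gap; lra).
  assert (Hstep : forall x, a <= x <= b -> (forall y, a <= y <= x -> Cmod (W y) <= Y y) -> Cmod (W x) <= Y x - gap).
  { intros x Hx HP. apply Cmod_le_dir. intros e He.
    assert (D : forall s, a <= s <= b -> is_derive (fun t => Y t - Re (e * W t)%C) s (Y1 s - Re (e * W1 s)%C)).
    { intros s Hs. apply (is_derive_minus Y (fun t => Re (e * W t)%C)); [apply HY, Hs|apply cder_dir, HW, Hs]. }
    assert (D1 : forall s, a <= s <= b -> is_derive (fun t => Y1 t - Re (e * W1 t)%C) s (Y2 s - Re (e * W2 s)%C)).
    { intros s Hs. apply (is_derive_minus Y1 (fun t => Re (e * W1 t)%C)); [apply HY, Hs|apply cder_dir, HW, Hs]. }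
    assert (P1 : forall s, a <= s <= x -> 0 <= Y1 s - Re (e * W1 s)%C).
    { intros s Hs. destruct (mean_value _ _ a s (proj1 Hs) (fun t Ht => D1 t ltac:(lra))) as [c [Hc E]].
      pose proof (Re_dir_le e (W1 a) He). pose proof (Re_dir_le e (W2 c) He).
      pose proof (Hsup c ltac:(lra) (HP c ltac:(lra))).
      assert (0 <= (Y2 c - Re (e * W2 c)%C) * (s - a)) by (apply Rmult_le_pos; lra). lra. }
    destruct (mean_value _ _ a x (proj1 Hx) (fun t Ht => D t ltac:(lra))) as [c [Hc E]].
    pose proof (Re_dir_le e (W a) He). specialize (P1 c Hc).
    assert (0 <= (Y1 c - Re (e * W1 c)%C) * (x - a)) by (apply Rmult_le_pos; lra). unfold gap. lra. }
  assert (Hcont : forall x, a <= x <= b -> forall eps, 0 < eps -> exists d, 0 < d /\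
     forall y, Rabs (y - x) < d -> Cmod (W y - W x)%C < eps /\ Rabs (Y y - Y x) < eps).
  { intros x Hx eps Heps.
    destruct (cder_continuous W x _ (proj1 (HW x Hx)) eps Heps) as [d1 [Hd1 B1]].
    destruct (cder_continuous _ x _ (cder_RtoC Y x _ (proj1 (HY x Hx))) eps Heps) as [d2 [Hd2 B2]].
    exists (Rmin d1 d2). split; [apply Rmin_pos; assumption|]. intros y Hy. split.
    - apply B1. apply Rlt_le_trans with (1 := Hy), Rmin_l.
    - rewrite <- Cmod_R, RtoC_minus. apply B2. apply Rlt_le_trans with (1 := Hy), Rmin_r. }
  apply (real_induction (fun s => Cmod (W s) <= Y s) a b Hab); [lra| |].
  - intros x Hx HP. pose proof (Hstep x ltac:(lra) HP) as Hg.
    destruct (Hcont x ltac:(lra) (gap / 2) ltac:(lra)) as [d [Hd B]]. exists d. split; [exact Hd|].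
    intros y Hy Hyb. destruct (B y) as [B1 B2]; [apply Rabs_def1; lra|]. apply Rabs_def2 in B2.
    pose proof (Cmod_sub_ge (W y) (W x)). lra.
  - intros x Hx HP. apply Rnot_lt_le. intros Hlt.
    set (eps := (Cmod (W x) - Y x) / 2).
    destruct (Hcont x ltac:(lra) eps ltac:(unfold eps; lra)) as [d [Hd B]].
    set (y := Rmax a (x - d / 2)).
    assert (Hy : a <= y < x /\ x - d < y).
    { unfold y. split; [split; [apply Rmax_l|apply Rmax_lub_lt; lra]|]. apply Rlt_le_trans with (2 := Rmax_r _ _). lra. }
    destruct (B y) as [B1 B2]; [apply Rabs_def1; lra|]. apply Rabs_def2 in B2.
    pose proof (HP y (proj1 Hy)). pose proof (Cmod_sub_ge (W x) (W y)). rewrite Cmod_minus_sym in H0.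
    unfold eps in *. lra.
Qed.

(* [tl0 b] are the coefficients of [z ^ 2 * u - 1], and [hi k b] (below) those of
   [z ^ 2 * u - 1 - b_k * z ^ k]. *)
Definition tl0 (b : nat -> R) (n : nat) : R := if Nat.eqb n 0 then 0 else b n.

(** The square of [tl0 b] contains no 2 b_n, so the linear factor is already (n - 6)(n + 1). At n =
    k the forcing term enters, or the free coefficient when k = 6. *)
Record pos_coeffs (k : nat) (b : nat -> R) : Prop := {
  pc_k : (4 <= k <= 6)%nat;
  pc_0 : b O = 1;
  pc_pos : forall n, 0 <= b n;
  pc_div : forall n, (n mod k <> 0)%nat -> b n = 0;
  pc_bk : 0 < b k;
  pc_rec : forall n, n <> k -> (INR n - 6) * (INR n + 1) * tl0 b n = 6 * PS_mult (tl0 b) (tl0 b) n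
}.

Lemma tl0_pos (k : nat) (b : nat -> R) (n : nat) : pos_coeffs k b -> 0 <= tl0 b n.
Proof. intros H. unfold tl0. destruct (Nat.eqb n 0); [lra|apply (pc_pos _ _ H)]. Qed.

Lemma tl0_low (k : nat) (b : nat -> R) (n : nat) : pos_coeffs k b -> (n < k)%nat -> tl0 b n = 0.
Proof.
  intros H Hn. unfold tl0. destruct (Nat.eqb_spec n 0); [reflexivity|]. apply (pc_div _ _ H).
  rewrite Nat.mod_small by exact Hn. assumption.
Qed.

Lemma PS_mult_low (k : nat) (b : nat -> R) (n : nat) : pos_coeffs k b -> (n <= k)%nat -> PS_mult (tl0 b) (tl0 b) n = 0.
Proof.
  intros H Hn. pose proof (pc_k _ _ H). unfold PS_mult. rewrite (sum_eq _ (fun _ => 0)); [rewrite sum_cte; ring|].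
  intros i Hi. destruct (Nat.lt_ge_cases i k) as [h|h].
  - rewrite (tl0_low k b i H h). ring.
  - rewrite (tl0_low k b (n - i) H) by lia. ring.
Qed.

Lemma sum_f_R0_ge_term (f : nat -> R) (n i : nat) : (forall j, 0 <= f j) -> (i <= n)%nat -> f i <= sum_f_R0 f n.
Proof.
  intros Hf Hi. induction Hi as [|n Hi IH].
  - destruct i; [simpl; lra|]. rewrite tech5. pose proof (cond_pos_sum f i Hf). lra.
  - rewrite tech5. specialize (Hf (S n)). lra.
Qed.

(** The term j = k of the convolution is b_k b_(n - k), positive by induction, and n >= 8 makes (n -
    6)(n + 1) positive. The indices 2k and 3k will provide the strict gap. *)
Lemma pos_coeffs_multiple (k : nat) (b : nat -> R) (m : nat) : pos_coeffs k b -> 0 < b (k * S m)%nat.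
Proof.
  intros H. pose proof (pc_k _ _ H) as Hk. induction m as [|m IH].
  - rewrite Nat.mul_1_r. apply (pc_bk _ _ H).
  - set (n := (k * S (S m))%nat). assert (Hn : (n >= 8)%nat /\ n <> k) by (unfold n; nia).
    pose proof (pc_rec _ _ H n (proj2 Hn)) as E.
    assert (Ht : tl0 b n = b n) by (unfold tl0; destruct (Nat.eqb_spec n 0); [lia|reflexivity]).
    rewrite Ht in E.
    assert (Hs : tl0 b k * tl0 b (n - k) <= PS_mult (tl0 b) (tl0 b) n).
    { unfold PS_mult. apply (sum_f_R0_ge_term (fun j => tl0 b j * tl0 b (n - j)) n k); [|unfold n; nia].
      intros j. apply Rmult_le_pos; apply (tl0_pos k b); exact H. }
    replace (n - k)%nat with (k * S m)%nat in Hs by (unfold n; nia).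
    assert (T1 : tl0 b k = b k) by (unfold tl0; destruct (Nat.eqb_spec k 0); [lia|reflexivity]).
    assert (T2 : tl0 b (k * S m) = b (k * S m)%nat) by (unfold tl0; destruct (Nat.eqb_spec (k * S m) 0); [nia|reflexivity]).
    rewrite T1, T2 in Hs. pose proof (pc_bk _ _ H).
    assert (0 < b k * b (k * S m)%nat) by (apply Rmult_lt_0_compat; assumption).
    assert (Hn8 : 8 <= INR n) by (replace 8 with (INR 8) by (simpl; ring); apply le_INR; lia).
    apply Rnot_le_lt. intros Hle.
    assert ((INR n - 6) * (INR n + 1) * b n <= 0); [|lra].
    assert (0 < (INR n - 6) * (INR n + 1)) by (apply Rmult_lt_0_compat; lra). nra.
Qed.

(** Coefficients, in the real variable s, of the function evaluated at x s. *)
Definition dir (b : nat -> R) (x : C) (n : nat) : C := (RtoC (b n) * x ^ n)%C.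

Lemma Cmod_dir (b : nat -> R) (x : C) (n : nat) : Cmod x = 1 -> Cmod (dir b x n) = Rabs (b n).
Proof. intros Hx. unfold dir. rewrite Cmod_mult, Cmod_R, Cmod_pow, Hx, pow1. ring. Qed.

Lemma Rad_dir (b : nat -> R) (x : C) (rho : R) : Cmod x = 1 -> cvr b rho -> Rad (dir b x) rho.
Proof.
  intros Hx Hb. apply Rad_of_bound. intros r Hr. destruct (bound_of_cvr b rho r Hb Hr) as [M HM].
  exists M. intros n. rewrite Cmod_dir by exact Hx. apply HM.
Qed.

Lemma cvr_mono (a b : nat -> R) (rho : R) : (forall n, Rabs (a n) <= Rabs (b n)) -> cvr b rho -> cvr a rho.
Proof.
  intros H Hb. apply cvr_of_bound. intros r Hr. destruct (bound_of_cvr b rho r Hb Hr) as [M HM].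
  exists M. intros n. apply Rle_trans with (2 := HM n). apply Rmult_le_compat_r; [apply pow_le; lra|apply H].
Qed.

Lemma PSeries_plus' (a b : nat -> R) (rho s : R) : cvr a rho -> cvr b rho -> Rabs s < rho ->
  PSeries (fun n => a n + b n) s = PSeries a s + PSeries b s.
Proof. intros Ha Hb Hs. apply (PSeries_plus a b s (Ha s Hs) (Hb s Hs)). Qed.

Lemma PSeries_single (m : nat) (x s : R) : PSeries (fun n => if Nat.eqb n m then x else 0) s = x * s ^ m.
Proof. apply is_pseries_unique, is_pseries_single. Qed.

(* The strict triangle inequality for the two terms of index 2k and 3k makes the
   whole sum strictly smaller off the ray [x ^ k = 1]. *)
Lemma dir_gap (k : nat) (b : nat -> R) (x : C) (s eta : R) :
  (0 < k)%nat -> (forall n, 0 <= b n) -> 0 < b (2 * k)%nat -> 0 < b (3 * k)%nat -> cvr b 1 -> Cmod x = 1 ->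
  Re (x ^ k)%C <= 1 - eta -> 0 < s < 1 ->
  Cmod (PC (dir b x) s) <= PSeries b s
    - b (2 * k)%nat * s ^ (2 * k) * (b (3 * k)%nat * s ^ (3 * k)) * eta
      / (b (2 * k)%nat * s ^ (2 * k) + b (3 * k)%nat * s ^ (3 * k)).
Proof.
  intros Hk Hb H2 H3 Hc Hx Heta Hs.
  assert (Hsa : Rabs s < 1) by (rewrite Rabs_right; lra).
  set (r := fun n => if Nat.eqb n (2 * k) then 0 else if Nat.eqb n (3 * k) then 0 else b n).
  set (f2 := fun n => if Nat.eqb n (2 * k) then b (2 * k)%nat else 0).
  set (f3 := fun n => if Nat.eqb n (3 * k) then b (3 * k)%nat else 0).
  assert (Er : forall n, b n = f2 n + f3 n + r n).
  { intros n. unfold f2, f3, r. destruct (Nat.eqb_spec n (2 * k)) as [e2|e2]; destruct (Nat.eqb_spec n (3 * k)) as [e3|e3]; try lia; [rewrite <- e2|rewrite <- e3|]; ring. }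
  assert (Hr0 : forall n, 0 <= r n) by (intros n; unfold r; destruct Nat.eqb; [lra|]; destruct Nat.eqb; [lra|apply Hb]).
  assert (Cr : cvr r 1).
  { apply cvr_mono with b; [|exact Hc]. intros n. rewrite !Rabs_right; [|apply Rle_ge, Hb|apply Rle_ge, Hr0].
    unfold r. specialize (Hb n). destruct Nat.eqb; [lra|]; destruct Nat.eqb; lra. }
  assert (C2 : cvr f2 1) by apply cvr_single. assert (C3 : cvr f3 1) by apply cvr_single.
  set (A := b (2 * k)%nat * s ^ (2 * k)). set (B := b (3 * k)%nat * s ^ (3 * k)).
  assert (HA : 0 < A) by (apply Rmult_lt_0_compat; [exact H2|apply pow_lt; lra]).
  assert (HB : 0 < B) by (apply Rmult_lt_0_compat; [exact H3|apply pow_lt; lra]).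
  assert (Ser : PSeries b s = A + B + PSeries r s).
  { rewrite (PSeries_ext b (fun n => (f2 n + f3 n) + r n)) by exact Er.
    rewrite (PSeries_plus' _ _ 1), (PSeries_plus' _ _ 1); try assumption; [|apply cvr_plus; assumption].
    unfold f2, f3. rewrite !PSeries_single. reflexivity. }
  set (y := (x ^ k)%C) in *.
  assert (Hy : Cmod y = 1) by (unfold y; rewrite Cmod_pow, Hx, pow1; reflexivity).
  assert (SerC : PC (dir b x) s = (y ^ 2 * (RtoC A + RtoC B * y) + PC (dir r x) s)%C).
  { rewrite (PC_ext (dir b x) (fun n => ((if Nat.eqb n (2 * k) then dir b x (2 * k)%nat else 0) + (if Nat.eqb n (3 * k) then dir b x (3 * k)%nat else 0)) + dir r x n)%C).
    - rewrite (PC_plus _ _ 1); [|apply Rad_plus; apply Rad_single|apply Rad_dir; assumption|exact Hsa].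
      rewrite (PC_plus _ _ 1); [|apply Rad_single|apply Rad_single|exact Hsa].
      rewrite !PC_single. f_equal. unfold dir, A, B, y. rewrite !RtoC_mult, !RtoC_pow.
      rewrite <- !Cpow_mult_r.
      replace (x ^ (3 * k))%C with (x ^ (k * 2) * x ^ k)%C by (rewrite <- Cpow_add_r; f_equal; lia).
      replace (x ^ (2 * k))%C with (x ^ (k * 2))%C by (f_equal; lia). ring.
    - intros n. unfold dir, r. destruct (Nat.eqb_spec n (2 * k)) as [e2|e2]; destruct (Nat.eqb_spec n (3 * k)) as [e3|e3]; try lia; [rewrite <- e2|rewrite <- e3|]; ring. }
  (* Here |A + B y|^2 = (A + B)^2 - 2 A B (1 - Re y); under the square root a deficit of 2 A B eta
     becomes one of at least A B eta / (A + B). *)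
  assert (Hsq : Cmod (RtoC A + RtoC B * y)%C <= A + B - A * B * eta / (A + B)).
  { pose proof (Cmod_sqr (RtoC A + RtoC B * y)) as E. pose proof (Cmod_ge_0 (RtoC A + RtoC B * y)) as Hge.
    rewrite Re_plus, Im_plus, Re_RtoC_mult, Im_RtoC_mult in E. simpl (Re (RtoC A)) in E. simpl (Im (RtoC A)) in E.
    pose proof (Cmod_sqr y) as Ey. rewrite Hy in Ey.
    set (m := Cmod (RtoC A + RtoC B * y)%C) in *. set (t := A * B * eta / (A + B)).
    assert (HAB : 0 < A * B) by (apply Rmult_lt_0_compat; assumption).
    assert (Et : t * (A + B) = A * B * eta) by (unfold t; field; lra).
    assert (Hre : A * B * Re y <= A * B * (1 - eta)) by (apply Rmult_le_compat_l; lra).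
    assert (Hm2 : m * m <= (A + B) * (A + B) - 2 * (t * (A + B))).
    { rewrite Et, E. replace ((A + B * Re y) * (A + B * Re y) + (0 + B * Im y) * (0 + B * Im y))
        with (A * A + 2 * (A * B * Re y) + B * B * (Re y * Re y + Im y * Im y)) by ring. rewrite <- Ey. lra. }
    (* [m ^ 2 <= (A + B - t) ^ 2], and [A + B - t >= 0] because [eta <= 2]. *)
    assert (Heta2 : eta <= 2).
    { pose proof (re_le_Cmod y) as Hr1. rewrite Hy in Hr1. unfold Rabs in Hr1. destruct (Rcase_abs (Re y)); lra. }
    assert (Ht : 0 <= A + B - t).
    { apply (Rmult_le_reg_r (A + B)); [lra|]. rewrite Rmult_0_l. replace ((A + B - t) * (A + B)) with ((A + B) * (A + B) - t * (A + B)) by ring.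
      rewrite Et. nra. }
    apply Rnot_lt_le. intros Hlt. fold t in Hlt. pose proof (Rle_0_sqr t). unfold Rsqr in *. nra. }
  rewrite SerC, Ser. apply Rle_trans with (1 := Cmod_triangle _ _).
  rewrite Cmod_mult, Cmod_pow, Hy, pow1, Rmult_1_l.
  assert (Cmod (PC (dir r x) s) <= PSeries r s).
  { apply Cmod_PC_le with 1; [apply Rad_dir; assumption|exact Cr|lra|].
    intros n. rewrite Cmod_dir by exact Hx. rewrite Rabs_right; [lra|apply Rle_ge, Hr0]. }
  fold A B. lra.
Qed.

Lemma PSeries_comp_scal (q : R) (a : nat -> R) (s : R) : PSeries (fun n => q ^ n * a n) s = PSeries a (q * s).
Proof. apply Series_ext. intros n. rewrite Rpow_mult_distr. ring. Qed.

Lemma PSeries_mono (a : nat -> R) (s r : R) :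
  cvr a 1 -> (forall n, 0 <= a n) -> 0 <= s <= r -> 0 < r < 1 -> PSeries a s <= PSeries a r.
Proof.
  intros Ha Ha0 Hs Hr. set (q := s / r). assert (Hq : 0 <= q <= 1).
  { unfold q. split; [apply Rmult_le_pos; [lra|left; apply Rinv_0_lt_compat; lra]|].
    apply Rle_div_l; lra. }
  replace s with (q * r) by (unfold q; field; lra). rewrite <- PSeries_comp_scal.
  assert (Hqn : forall n, 0 <= q ^ n <= 1) by (intros n; split; [apply pow_le; lra|apply pow_le_1; lra]).
  apply PSeries_le with 1; [|exact Ha|lra|intros n; specialize (Ha0 n); specialize (Hqn n); nra].
  apply cvr_mono with a; [|exact Ha]. intros n. specialize (Ha0 n). specialize (Hqn n).
  rewrite !Rabs_right; nra.
Qed.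

(** Continuity at q = 1: some q < 1 loses less than the strict gap at s = 1/2. The term with [K] is
    the contribution of the s^k coefficient of the supersolution. *)
Lemma PSeries_near_one (h : nat -> R) (k : nat) (K eps : R) : cvr h 1 -> 0 < eps ->
  exists d, 0 < d < 1 /\ forall q, 1 - d < q < 1 -> PSeries h (1 / 2) - eps < PSeries h (q * (1 / 2)) + (q ^ k - 1) * K.
Proof.
  intros Hh Heps.
  assert (D : ex_derive (fun q => PSeries h (q * (1 / 2)) + (q ^ k - 1) * K) 1).
  { assert (Dh : ex_derive (PSeries h) (1 * (1 / 2))).
    { eexists. apply is_derive_PSeries. apply cvr_lt with (rho := 1); [exact Hh|]. rewrite Rabs_right; lra. }
    auto_derive. exact Dh. }
  apply (ex_derive_continuous (fun q => PSeries h (q * (1 / 2)) + (q ^ k - 1) * K)) in D.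
  destruct (proj1 (filterlim_locally (fun q => PSeries h (q * (1 / 2)) + (q ^ k - 1) * K) _) D (mkposreal eps Heps)) as [d Hd].
  exists (Rmin d (1 / 2)). split; [split; [apply Rmin_pos; [apply d|lra]|apply Rle_lt_trans with (1 := Rmin_r _ _); lra]|].
  intros q Hq. pose proof (Rmin_l d (1 / 2)).
  assert (B : Rabs ((PSeries h (q * (1 / 2)) + (q ^ k - 1) * K) - (PSeries h (1 * (1 / 2)) + (1 ^ k - 1) * K)) < eps).
  { apply (Hd q). change (Rabs (q - 1) < d). apply Rabs_def1; lra. }
  apply Rabs_def2 in B. rewrite pow1, Rmult_1_l in B. lra.
Qed.

Definition hi (k : nat) (b : nat -> R) (n : nat) : R := if Nat.leb n k then 0 else b n.

Lemma csum_RtoC (f : nat -> R) (n : nat) : csum (fun j => RtoC (f j)) n = RtoC (sum_f_R0 f n).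
Proof. induction n as [|n IH]; [reflexivity|]. cbn [csum sum_f_R0]. rewrite IH, RtoC_plus. reflexivity. Qed.

Lemma conv_dir (t : nat -> R) (x : C) (n : nat) : conv (dir t x) (dir t x) n = dir (PS_mult t t) x n.
Proof.
  unfold conv, dir at 3, PS_mult. rewrite <- csum_RtoC, Cmult_comm, <- csum_scal.
  apply csum_ext. intros j Hj. unfold dir. rewrite RtoC_mult.
  replace (x ^ n)%C with (x ^ j * x ^ (n - j))%C by (rewrite <- Cpow_add_r; f_equal; lia). ring.
Qed.

(** * Comparison with a rescaled copy of the positive solution *)

Section Away.

Variables (k : nat) (b : nat -> R).
Hypothesis H : pos_coeffs k b.
Hypothesis Hb : cvr b 1.

Let p := b k.
Let t := tl0 b.
Let h := hi k b.

Lemma hi_pos (n : nat) : 0 <= h n.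
Proof. unfold h, hi. destruct (Nat.leb n k); [lra|apply (pc_pos _ _ H)]. Qed.

Lemma cvr_hi : cvr h 1.
Proof.
  apply cvr_mono with b; [|exact Hb]. intros n. unfold h, hi. destruct (Nat.leb n k); [|lra].
  rewrite Rabs_R0. apply Rabs_pos.
Qed.

Lemma cvr_tl0 : cvr t 1.
Proof.
  apply cvr_mono with b; [|exact Hb]. intros n. unfold t, tl0. destruct (Nat.eqb n 0); [|lra].
  rewrite Rabs_R0. apply Rabs_pos.
Qed.

Lemma tl0_split (n : nat) : t n = h n + (if Nat.eqb n k then p else 0).
Proof.
  unfold t, h, hi. destruct (Nat.leb_spec n k) as [l|l].
  - destruct (Nat.eqb_spec n k) as [->|e].
    + unfold tl0. pose proof (pc_k _ _ H). destruct (Nat.eqb_spec k 0); [lia|]. unfold p. ring.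
    + rewrite (tl0_low k b n H) by lia. ring.
  - destruct (Nat.eqb_spec n k); [lia|]. unfold tl0. destruct (Nat.eqb_spec n 0); [lia|]. ring.
Qed.

(** For n > k this is (n - 6)(n + 1) + 12 = (n - 3)(n - 2), the 12 coming from the cross term of 1 /
    s^2 in 6 u^2. For n <= k both sides vanish. *)
Lemma hi_rec (n : nat) : (INR n - 3) * ((INR n - 2) * h n) = 12 * h n + 6 * PS_mult t t n.
Proof.
  destruct (Nat.le_gt_cases n k) as [l|l].
  - unfold t. rewrite (PS_mult_low k b n H l). unfold h, hi. apply Nat.leb_le in l. rewrite l. ring.
  - pose proof (pc_rec _ _ H n ltac:(lia)) as E. fold t in E. rewrite <- E.
    rewrite tl0_split. destruct (Nat.eqb_spec n k); [lia|]. ring.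
Qed.

Lemma PC_tl0 (x : C) (s : R) : Cmod x = 1 -> Rabs s < 1 ->
  PC (dir t x) s = (PC (dir h x) s + RtoC p * x ^ k * RtoC s ^ k)%C.
Proof.
  intros Hx Hs.
  rewrite (PC_ext _ (fun n => dir h x n + (if Nat.eqb n k then RtoC p * x ^ k else 0))%C).
  - rewrite (PC_plus _ _ 1); [|apply Rad_dir; [exact Hx|apply cvr_hi]|apply Rad_single|exact Hs].
    rewrite PC_single. reflexivity.
  - intros n. unfold dir. rewrite tl0_split. destruct (Nat.eqb_spec n k) as [->|]; rewrite RtoC_plus; ring.
Qed.

Lemma PSeries_tl0 (s : R) : Rabs s < 1 -> PSeries t s = PSeries h s + p * s ^ k.
Proof.
  intros Hs. rewrite (PSeries_ext t _ s tl0_split).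
  rewrite (PSeries_plus' _ _ 1); [|apply cvr_hi|apply cvr_single|exact Hs]. rewrite PSeries_single. reflexivity.
Qed.

Lemma PC_hi_rec (x : C) (s : R) : Cmod x = 1 -> Rabs s < 1 ->
  PC (fun n => RtoC (INR n - 3) * (RtoC (INR n - 2) * dir h x n))%C s
  = (12 * PC (dir h x) s + 6 * (PC (dir h x) s + RtoC p * x ^ k * RtoC s ^ k) ^ 2)%C.
Proof.
  intros Hx Hs.
  assert (R1 : Rad (dir h x) 1) by (apply Rad_dir; [exact Hx|apply cvr_hi]).
  assert (R2 : Rad (dir t x) 1) by (apply Rad_dir; [exact Hx|apply cvr_tl0]).
  rewrite (PC_ext _ (fun n => 12 * dir h x n + 6 * conv (dir t x) (dir t x) n)%C).
  - rewrite (PC_plus _ _ 1), (PC_scal _ _ 1), (PC_scal _ _ 1), (PC_conv _ _ 1), PC_tl0; try assumption.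
    + ring.
    + apply Rad_conv; assumption.
    + apply Rad_scal; assumption.
    + apply Rad_scal, Rad_conv; assumption.
  - intros n. rewrite conv_dir. unfold dir.
    replace (RtoC (INR n - 3) * (RtoC (INR n - 2) * (RtoC (h n) * x ^ n)))%C
      with (RtoC ((INR n - 3) * ((INR n - 2) * h n)) * x ^ n)%C by (rewrite !RtoC_mult; ring).
    rewrite hi_rec, RtoC_plus, !RtoC_mult. ring.
Qed.

(* Coefficients of [s ^ 2 * (q ^ 2 * U (q * s) - s ^ (-2) - p * s ^ (k - 2))], where [U] is the
   solution on the positive ray: subtracting the unscaled term [p * s ^ (k - 2)] makes
   this a supersolution, because [(k - 6) * (k + 1) * (q ^ k - 1) >= 0]. *)
Let y (q : R) (n : nat) : R := q ^ n * h n + (if Nat.eqb n k then (q ^ k - 1) * p else 0).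

Lemma cvr_scaled (q : R) (a : nat -> R) : 0 < q < 1 -> cvr a 1 -> cvr (fun n => q ^ n * a n) 1.
Proof.
  intros Hq Ha. apply cvr_mono with a; [|exact Ha]. intros n. rewrite Rabs_mult.
  rewrite (Rabs_right (q ^ n)) by (apply Rle_ge, pow_le; lra).
  assert (q ^ n <= 1) by (apply pow_le_1; lra).
  pose proof (Rabs_pos (a n)). nra.
Qed.

Lemma cvr_super (q : R) : 0 < q < 1 -> cvr (y q) 1.
Proof. intros Hq. apply cvr_plus; [apply cvr_scaled; [exact Hq|apply cvr_hi]|apply cvr_single]. Qed.

Lemma PSeries_super (q s : R) : 0 < q < 1 -> Rabs s < 1 -> PSeries (y q) s = PSeries h (q * s) + (q ^ k - 1) * p * s ^ k.
Proof.
  intros Hq Hs. unfold y. rewrite (PSeries_plus' _ _ 1); [|apply cvr_scaled; [exact Hq|apply cvr_hi]|apply cvr_single|exact Hs].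
  rewrite PSeries_single, PSeries_comp_scal. reflexivity.
Qed.

Lemma Rabs_scaled (q s : R) : 0 < q < 1 -> Rabs s < 1 -> Rabs (q * s) < 1.
Proof. intros Hq Hs. rewrite Rabs_mult, (Rabs_right q) by lra. pose proof (Rabs_pos s). nra. Qed.

Lemma PSeries_super_rec (q s : R) : 0 < q < 1 -> Rabs s < 1 ->
  PSeries (fun n => (INR n - 3) * ((INR n - 2) * y q n)) s
  = 12 * PSeries (y q) s + 6 * (PSeries (y q) s + p * s ^ k) ^ 2
    + (INR k - 6) * (INR k + 1) * (q ^ k - 1) * p * s ^ k.
Proof.
  intros Hq Hs. pose proof (cvr_super q Hq) as Cy. pose proof (Rabs_scaled q s Hq Hs) as Hqs.
  assert (Cm : cvr (fun n => q ^ n * PS_mult t t n) 1) by (apply cvr_scaled; [exact Hq|apply cvr_mult; apply cvr_tl0]).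
  rewrite (PSeries_ext _ (fun n => (12 * y q n + 6 * (q ^ n * PS_mult t t n))
     + (if Nat.eqb n k then (INR k - 6) * (INR k + 1) * (q ^ k - 1) * p else 0))).
  - rewrite (PSeries_plus' _ _ 1); [|apply cvr_plus; apply cvr_scal; assumption|apply cvr_single|exact Hs].
    rewrite (PSeries_lin _ _ _ _ 1), PSeries_single, PSeries_comp_scal by assumption.
    rewrite PSeries_mult by (apply cvr_lt with 1; [apply cvr_tl0|exact Hqs]).
    rewrite PSeries_tl0 by exact Hqs. rewrite PSeries_super by assumption. rewrite Rpow_mult_distr. ring.
  - intros n. pose proof (hi_rec n) as E. unfold y. destruct (Nat.eqb_spec n k) as [->|e].
    + assert (h k = 0) as -> by (unfold h, hi; rewrite Nat.leb_refl; reflexivity).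
      unfold t. rewrite (PS_mult_low k b k H) by lia. ring.
    + rewrite !Rplus_0_r. replace ((INR n - 3) * ((INR n - 2) * (q ^ n * h n))) with (q ^ n * ((INR n - 3) * ((INR n - 2) * h n))) by ring.
      rewrite E. ring.
Qed.

(** The series is evaluated at q s < q, strictly inside the disc, so the bound persists as s tends
    to 1. *)
Lemma super_bound (q s : R) : 0 < q < 1 -> 0 <= s < 1 -> PSeries (y q) s <= PSeries t q.
Proof.
  intros Hq Hs. assert (Hsa : Rabs s < 1) by (rewrite Rabs_right; lra).
  rewrite PSeries_super by assumption.
  assert (E1 : PSeries h (q * s) + (q ^ k - 1) * p * s ^ k <= PSeries t (q * s)).
  { rewrite PSeries_tl0 by (apply Rabs_scaled; assumption). rewrite Rpow_mult_distr.
    assert (0 <= p * s ^ k) by (apply Rmult_le_pos; [apply (pc_pos _ _ H)|apply pow_le; lra]). lra. }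
  apply Rle_trans with (1 := E1). apply PSeries_mono; [apply cvr_tl0|intros n; apply (tl0_pos k), H|nra|exact Hq].
Qed.

(** The comparison starts at s = 1/2, an arbitrary interior point. The gap there depends on [eta]
    but not on [x], so a single q, and hence a single bound, serves all directions. *)
Lemma away_bound_hi (eta : R) : 0 < eta ->
  exists M, forall x s, Cmod x = 1 -> Re (x ^ k)%C <= 1 - eta -> 1 / 2 <= s < 1 -> Cmod (PC (dir h x) s) <= M.
Proof.
  intros Heta. pose proof (pc_k _ _ H) as Hk.
  assert (Hkr : 4 <= INR k <= 6).
  { split; [replace 4 with (INR 4) by (simpl; ring)|replace 6 with (INR 6) by (simpl; ring)]; apply le_INR; lia. }
  (* Up to the factor 1 / s^3 these are the coefficients of the derivative; they are nonnegative
     too, so the same gap argument compares the initial slopes. *)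
  set (beta := fun n => (INR n - 2) * h n).
  assert (Cbeta : cvr beta 1) by (apply cvr_euler, cvr_hi).
  assert (Hbeta : forall n, 0 <= beta n).
  { intros n. unfold beta. pose proof (hi_pos n). destruct (Nat.le_gt_cases n k) as [l|l].
    - unfold h, hi. apply Nat.leb_le in l. rewrite l. lra.
    - apply Rmult_le_pos; [|assumption]. apply lt_INR in l. lra. }
  assert (Hm : forall j, (2 <= j)%nat -> 0 < h (j * k)%nat /\ 0 < beta (j * k)%nat).
  { intros j Hj. assert (Hpos : 0 < h (j * k)%nat).
    { unfold h, hi. destruct (Nat.leb_spec (j * k) k); [nia|].
      replace (j * k)%nat with (k * S (j - 1))%nat by nia. apply pos_coeffs_multiple, H. }
    split; [exact Hpos|]. apply Rmult_lt_0_compat; [|exact Hpos].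
    assert (INR k <= INR (j * k)) by (apply le_INR; nia). lra. }
  set (gap := fun (a : nat -> R) => a (2 * k)%nat * (1 / 2) ^ (2 * k) * (a (3 * k)%nat * (1 / 2) ^ (3 * k)) * eta
      / (a (2 * k)%nat * (1 / 2) ^ (2 * k) + a (3 * k)%nat * (1 / 2) ^ (3 * k))).
  assert (Hgap : forall a, 0 < a (2 * k)%nat -> 0 < a (3 * k)%nat -> 0 < gap a).
  { intros a A2 A3. assert (0 < (1 / 2) ^ (2 * k)) by (apply pow_lt; lra). assert (0 < (1 / 2) ^ (3 * k)) by (apply pow_lt; lra).
    assert (0 < a (2 * k)%nat * (1 / 2) ^ (2 * k)) by (apply Rmult_lt_0_compat; assumption).
    assert (0 < a (3 * k)%nat * (1 / 2) ^ (3 * k)) by (apply Rmult_lt_0_compat; assumption).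
    unfold gap. apply Rdiv_lt_0_compat; [|lra]. repeat apply Rmult_lt_0_compat; assumption. }
  destruct (Hm 2%nat ltac:(lia)) as [P2 B2]. destruct (Hm 3%nat ltac:(lia)) as [P3 B3].
  destruct (PSeries_near_one h k (p * (1 / 2) ^ k) (gap h) cvr_hi (Hgap h P2 P3)) as [d1 [Hd1 Q1]].
  destruct (PSeries_near_one beta k ((INR k - 2) * (p * (1 / 2) ^ k)) (gap beta) Cbeta (Hgap beta B2 B3)) as [d2 [Hd2 Q2]].
  set (q := 1 - Rmin d1 d2 / 2).
  assert (Hd : 0 < Rmin d1 d2) by (apply Rmin_pos; lra). pose proof (Rmin_l d1 d2). pose proof (Rmin_r d1 d2).
  assert (Hq : 0 < q < 1) by (unfold q; lra).
  specialize (Q1 q ltac:(unfold q; lra)). specialize (Q2 q ltac:(unfold q; lra)).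
  exists (PSeries t q). intros x s Hx Hre Hs.
  apply Rle_trans with (PSeries (y q) s); [|apply super_bound; lra].
  pose proof (cvr_super q Hq) as Cy.
  assert (Rh : Rad (dir h x) 1) by (apply Rad_dir; [exact Hx|apply cvr_hi]).
  assert (Cq : forall r, 1 / 2 <= r <= s -> Rabs r < 1 /\ r <> 0 /\ 0 < r ^ 2 /\ 0 < r ^ 3 /\ 0 < r ^ 4).
  { intros r Hr. rewrite Rabs_right by lra. repeat split; try lra; apply pow_lt; lra. }
  assert (Cd : forall z r, 0 < r -> Cmod (z / RtoC r)%C = Cmod z / r).
  { intros z r Hr. rewrite Cmod_div by (apply RtoC_neq_0; lra). rewrite Cmod_R, Rabs_right by lra. reflexivity. }
  assert (Hdiv : forall a c r, 0 < r -> (a <= c <-> a / r <= c / r)).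
  { intros a c r Hr. unfold Rdiv. assert (0 < / r) by (apply Rinv_0_lt_compat; exact Hr). split; intros Hle.
    - apply Rmult_le_compat_r; lra.
    - apply Rmult_le_reg_r with (/ r); assumption. }
  assert (Hdl : forall a c r, 0 < r -> a < c -> a / r < c / r).
  { intros a c r Hr Hlt. unfold Rdiv. apply Rmult_lt_compat_r; [apply Rinv_0_lt_compat; exact Hr|exact Hlt]. }
  assert (G : Cmod (PC (dir h x) s / RtoC (s ^ 2))%C <= PSeries (y q) s / s ^ 2).
  { apply (comparison (fun r => PC (dir h x) r / RtoC (r ^ 2))%C
      (fun r => PC (fun n => RtoC (INR n - 2) * dir h x n)%C r / RtoC (r ^ 3))%C
      (fun r => PC (fun n => RtoC (INR n - 3) * (RtoC (INR n - 2) * dir h x n))%C r / RtoC (r ^ 4))%C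
      (fun r => PSeries (y q) r / r ^ 2)
      (fun r => PSeries (fun n => (INR n - 2) * y q n) r / r ^ 3)
      (fun r => PSeries (fun n => (INR n - 3) * ((INR n - 2) * y q n)) r / r ^ 4) (1 / 2) s); [lra| | | | | |lra].
    - intros r Hr. destruct (Cq r Hr) as (C1 & C2 & _). apply (cder_PC_div2 (dir h x) 1 r Rh C1 C2).
    - intros r Hr. destruct (Cq r Hr) as (C1 & C2 & _). split.
      + pose proof (is_derive_PSeries_div 2 (y q) 1 r Cy C1 C2) as D. replace (INR 2) with 2 in D by (simpl; ring). exact D.
      + pose proof (is_derive_PSeries_div 3 _ 1 r (cvr_euler 2 _ 1 Cy) C1 C2) as D. replace (INR 3) with 3 in D by (simpl; ring). exact D.
    (* The right-hand side 12 w + 6 (w + p x^k r^k)^2 is increasing in moduli, and the leftover term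
       of the supersolution is nonnegative because k <= 6 and q <= 1. *)
    - intros r Hr Hle. destruct (Cq r Hr) as (C1 & C2 & P2' & P3' & P4'). rewrite Cd in Hle by exact P2'. rewrite Cd by exact P4'.
      apply (Hdiv _ _ _ P2') in Hle. apply Hdiv; [exact P4'|].
      rewrite PC_hi_rec, PSeries_super_rec by assumption.
      assert (Hpk : 0 <= p * r ^ k) by (apply Rmult_le_pos; [apply (pc_pos _ _ H)|apply pow_le; lra]).
      assert (Hqk : q ^ k <= 1) by (apply pow_le_1; lra).
      assert (Hextra : 0 <= (INR k - 6) * (INR k + 1) * (q ^ k - 1) * p * r ^ k).
      { replace ((INR k - 6) * (INR k + 1) * (q ^ k - 1) * p * r ^ k)
          with ((6 - INR k) * ((INR k + 1) * ((1 - q ^ k) * (p * r ^ k)))) by ring.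
        do 3 (apply Rmult_le_pos; [lra|]). exact Hpk. }
      apply Rle_trans with (1 := Cmod_triangle _ _). rewrite !Cmod_mult, Cmod_pow.
      rewrite (Cmod_R 12), (Cmod_R 6), !Rabs_right by lra.
      assert (T : Cmod (PC (dir h x) r + RtoC p * x ^ k * RtoC r ^ k)%C <= PSeries (y q) r + p * r ^ k).
      { apply Rle_trans with (1 := Cmod_triangle _ _). rewrite !Cmod_mult, !Cmod_pow, Hx, pow1, !Cmod_R.
        rewrite (Rabs_right p), (Rabs_right r) by (try lra; apply Rle_ge, (pc_pos _ _ H)). lra. }
      pose proof (Cmod_ge_0 (PC (dir h x) r + RtoC p * x ^ k * RtoC r ^ k)%C) as T0.
      assert (Cmod (PC (dir h x) r + RtoC p * x ^ k * RtoC r ^ k)%C ^ 2 <= (PSeries (y q) r + p * r ^ k) ^ 2) by (apply pow_incr; split; assumption).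
      lra.
    - assert (P2' : 0 < (1 / 2) ^ 2) by (apply pow_lt; lra). rewrite Cd by exact P2'. apply Hdl; [exact P2'|].
      rewrite PSeries_super by (try rewrite Rabs_right; lra).
      pose proof (dir_gap k h x (1 / 2) eta ltac:(lia) hi_pos P2 P3 cvr_hi Hx Hre ltac:(lra)) as Hg. fold (gap h) in Hg. lra.
    - assert (P3' : 0 < (1 / 2) ^ 3) by (apply pow_lt; lra). rewrite Cd by exact P3'. apply Hdiv; [exact P3'|].
      pose proof (dir_gap k beta x (1 / 2) eta ltac:(lia) Hbeta B2 B3 Cbeta Hx Hre ltac:(lra)) as Hg. fold (gap beta) in Hg.
      rewrite (PC_ext _ (dir beta x)) by (intros n; unfold dir, beta; rewrite RtoC_mult; ring).
      rewrite (PSeries_ext _ (fun n => q ^ n * beta n + (if Nat.eqb n k then (INR k - 2) * ((q ^ k - 1) * p) else 0))).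
      + rewrite (PSeries_plus' _ _ 1); [|apply cvr_scaled; assumption|apply cvr_single|rewrite Rabs_right; lra].
        rewrite PSeries_single, PSeries_comp_scal. lra.
      + intros n. unfold y, beta. destruct (Nat.eqb_spec n k) as [->|]; ring. }
  assert (P2' : 0 < s ^ 2) by (apply pow_lt; lra). rewrite Cd in G by exact P2'. apply (Hdiv _ _ _ P2'). exact G.
Qed.

Lemma away_bound (eta : R) : 0 < eta ->
  exists M, forall x s, Cmod x = 1 -> Re (x ^ k)%C <= 1 - eta -> 0 <= s < 1 -> Cmod (PC (dir b x) s) <= M.
Proof.
  intros Heta. destruct (away_bound_hi eta Heta) as [M HM].
  exists (Rmax (1 + p + M) (PSeries b (1 / 2))). intros x s Hx Hre Hs.
  pose proof (pc_k _ _ H) as Hk.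
  destruct (Rle_lt_dec (1 / 2) s) as [l|l].
  - apply Rle_trans with (2 := Rmax_l _ _).
    assert (Hsa : Rabs s < 1) by (rewrite Rabs_right; lra).
    assert (E : PC (dir b x) s = (1 + (PC (dir h x) s + RtoC p * x ^ k * RtoC s ^ k))%C).
    { rewrite <- PC_tl0 by assumption.
      rewrite (PC_ext _ (fun n => (if Nat.eqb n 0 then 1 else 0) + dir t x n)%C).
      - rewrite (PC_plus _ _ 1); [|apply Rad_single|apply Rad_dir; [exact Hx|apply cvr_tl0]|exact Hsa].
        rewrite PC_single. simpl. ring.
      - intros n. unfold dir, t, tl0. destruct (Nat.eqb_spec n 0) as [->|]; [|ring]. rewrite (pc_0 _ _ H). simpl. ring. }
    rewrite E. apply Rle_trans with (1 := Cmod_triangle _ _). rewrite Cmod_1.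
    pose proof (Cmod_triangle (PC (dir h x) s) (RtoC p * x ^ k * RtoC s ^ k)) as T.
    rewrite !Cmod_mult, !Cmod_pow, Hx, pow1, !Cmod_R, (Rabs_right p), (Rabs_right s) in T by (try lra; apply Rle_ge, (pc_pos _ _ H)).
    specialize (HM x s Hx Hre ltac:(lra)).
    assert (s ^ k <= 1) by (apply pow_le_1; lra). pose proof (pc_pos _ _ H k). fold p in H1. nra.
  - apply Rle_trans with (2 := Rmax_r _ _).
    assert (Cmod (PC (dir b x) s) <= PSeries b s).
    { apply Cmod_PC_le with 1; [apply Rad_dir; assumption|exact Hb|lra|]. intros n. rewrite Cmod_dir by exact Hx.
      rewrite Rabs_right; [lra|apply Rle_ge, (pc_pos _ _ H)]. }
    apply Rle_trans with (1 := H0). apply PSeries_mono; [exact Hb|apply (pc_pos _ _ H)|lra|lra].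
Qed.

End Away.

(** * Positivity and radius of convergence *)

Lemma forcing_zero (g lam g3 : C) (k n : nat) :
  only_nonzero_parameter g lam g3 k -> n <> k -> forcing g lam n = 0%C.
Proof.
  unfold forcing.
  intros [(_ & -> & _ & ->)|[(-> & _ & _ & ->)|(-> & -> & _ & ->)]] Hn;
    destruct (Nat.eqb_spec n 5); destruct (Nat.eqb_spec n 4); try lia; field; apply RtoC_neq_0; lra.
Qed.

(** Below 6 the factor (n - 6)(n + 1) is negative, but there the only multiples of k are 0 and k, so
    the other coefficients vanish; above 6 it is positive and nonnegativity propagates through the
    convolution. *)
Lemma sol_pos_coeffs (g lam g3 : C) (k : nat) (u du : C -> C) (c : nat -> C) (p : R) :
  only_nonzero_parameter g lam g3 k -> sol g lam u du c -> c 6%nat = (g3 / 28)%C ->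
  0 < p -> c k = RtoC p ->
  exists b, (forall n, c n = RtoC (b n)) /\ pos_coeffs k b.
Proof.
  intros Hone Hsol H6 Hp Hck. exists (fun n => Re (c n)).
  assert (Hk : (4 <= k <= 6)%nat) by (destruct Hone as [(_ & _ & _ & ->)|[(_ & _ & _ & ->)|(_ & _ & _ & ->)]]; lia).
  pose proof (sol_rec _ _ _ _ _ Hsol) as Hrec. pose proof (sol_c0 _ _ _ _ _ Hsol) as H0.
  assert (Hdiv : forall j n, (j <= n)%nat -> (n mod k <> 0)%nat -> (j mod k <> 0)%nat \/ ((n - j) mod k <> 0)%nat).
  { intros j n Hj Hn. destruct (Nat.eq_dec (j mod k) 0) as [e1|]; [|left; assumption].
    destruct (Nat.eq_dec ((n - j) mod k) 0) as [e2|]; [|right; assumption]. exfalso. apply Hn.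
    apply Nat.Div0.mod_divides in e1, e2. apply Nat.Div0.mod_divides.
    destruct e1 as [x Ex], e2 as [y Ey]. exists (x + y)%nat. lia. }
  assert (Hsolved : forall n, (0 < n)%nat -> n <> k ->
     (RtoC ((INR n - 6) * (INR n + 1)) * c n =
      6 * csum (fun j => if Nat.eqb j 0 then 0 else if Nat.eqb j n then 0 else c j * c (n - j)%nat) n)%C).
  { intros n Hn Hnk. rewrite (rec_solved g lam c n Hrec H0 Hn), (forcing_zero g lam g3 k n Hone Hnk). ring. }
  assert (Claim : forall n, Im (c n) = 0 /\ 0 <= Re (c n) /\ ((n mod k <> 0)%nat -> c n = 0%C)).
  { intros n. induction n as [n IH] using (well_founded_induction Wf_nat.lt_wf).
    destruct (Nat.eq_dec n 0) as [->|Hn0].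
    { rewrite H0. simpl. repeat split; [lra|]. rewrite Nat.Div0.mod_0_l. tauto. }
    destruct (Nat.eq_dec n k) as [->|Hnk].
    { rewrite Hck. simpl. repeat split; [lra|]. rewrite Nat.Div0.mod_same. tauto. }
    (* At the resonant index the recurrence gives no information; here k <> 6, so g3 = 0 settles
       it. *)
    destruct (Nat.eq_dec n 6) as [->|Hn6].
    { assert (c 6%nat = 0%C) as ->; [|simpl; repeat split; lra].
      rewrite H6. assert (g3 = 0%C) as ->; [|field; apply RtoC_neq_0; lra].
      destruct Hone as [(_ & _ & E & _)|[(_ & _ & E & _)|(_ & _ & _ & E)]]; [exact E|exact E|congruence]. }
    pose proof (Hsolved n ltac:(lia) Hnk) as E.
    set (f := (fun j => if Nat.eqb j 0 then 0 else if Nat.eqb j n then 0 else c j * c (n - j)%nat)%C : nat -> C) in *.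
    assert (Hf : forall j, (j <= n)%nat -> Im (f j) = 0 /\ 0 <= Re (f j) /\ ((n mod k <> 0)%nat -> f j = 0%C)).
    { intros j Hj. unfold f. destruct (Nat.eqb_spec j 0); [split; [reflexivity|split; [apply Rle_refl|reflexivity]]|].
      destruct (Nat.eqb_spec j n); [split; [reflexivity|split; [apply Rle_refl|reflexivity]]|].
      destruct (IH j ltac:(lia)) as (I1 & P1 & Z1). destruct (IH (n - j)%nat ltac:(lia)) as (I2 & P2 & Z2).
      rewrite Im_mult, Re_mult, I1, I2. split; [ring|]. split.
      - assert (0 <= Re (c j) * Re (c (n - j)%nat)) by (apply Rmult_le_pos; assumption). lra.
      - intros Hn. destruct (Hdiv j n Hj Hn) as [h|h]; [rewrite (Z1 h)|rewrite (Z2 h)]; ring. }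
    assert (Hz : (n mod k <> 0)%nat -> csum f n = 0%C).
    { intros Hn. rewrite <- (csum_0 n). apply csum_ext. intros j Hj. apply Hf; assumption. }
    assert (HS : Im (csum f n) = 0 /\ 0 <= Re (csum f n)).
    { clear - Hf. assert (G : forall m, (m <= n)%nat -> Im (csum f m) = 0 /\ 0 <= Re (csum f m)).
      { induction m as [|m IHm]; intros Hm; [destruct (Hf O Hm) as (h1 & h2 & _); split; assumption|].
        cbn [csum]. rewrite Im_plus, Re_plus. destruct (IHm ltac:(lia)) as [h1 h2].
        destruct (Hf (S m) Hm) as (h3 & h4 & _). lra. }
      apply G. lia. }
    assert (Hfac : (INR n - 6) * (INR n + 1) <> 0).
    { apply Rmult_integral_contrapositive. pose proof (pos_INR n). split; [|lra].
      intros Heq. apply Hn6. apply INR_eq. simpl. lra. }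
    assert (Hzero : (n mod k <> 0)%nat -> c n = 0%C).
    { intros Hn. rewrite (Hz Hn), Cmult_0_r in E.
      destruct (Ceq_dec (c n) 0) as [e|e]; [exact e|]. exfalso. revert E. apply Cmult_neq_0; [apply RtoC_neq_0, Hfac|exact e]. }
    destruct (Nat.lt_ge_cases n 6) as [Hlt|Hge].
    { assert (Hn : (n mod k <> 0)%nat).
      { destruct (Nat.lt_ge_cases n k); [rewrite Nat.mod_small by assumption; assumption|].
        replace n with ((n - k) + 1 * k)%nat by lia. rewrite Nat.Div0.mod_add, Nat.mod_small by lia. lia. }
      rewrite (Hzero Hn). simpl. repeat split; lra. }
    assert (Hn7 : 7 <= INR n) by (replace 7 with (INR 7) by (simpl; ring); apply le_INR; lia).
    assert (Hpos : 0 < (INR n - 6) * (INR n + 1)) by (apply Rmult_lt_0_compat; lra).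
    pose proof (f_equal Re E) as E1. pose proof (f_equal Im E) as E2.
    rewrite !Re_RtoC_mult in E1. rewrite !Im_RtoC_mult in E2. destruct HS as [S1 S2]. rewrite S1 in E2.
    split; [|split; [|exact Hzero]]; nra. }
  assert (Hre : forall n, c n = RtoC (Re (c n))).
  { intros n. apply injective_projections; [reflexivity|]. apply Claim. }
  split; [exact Hre|]. split.
  - exact Hk.
  - rewrite H0. reflexivity.
  - intros n. apply Claim.
  - intros n Hn. destruct (Claim n) as (_ & _ & Z). rewrite (Z Hn). reflexivity.
  - rewrite Hck. exact Hp.
  - intros n Hnk. destruct (Nat.eq_dec n 0) as [->|Hn0]; [unfold PS_mult, tl0; simpl; ring|].
    pose proof (Hsolved n ltac:(lia) Hnk) as E.
    rewrite (csum_ext _ (fun j => RtoC (tl0 (fun n => Re (c n)) j * tl0 (fun n => Re (c n)) (n - j)))) in E.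
    + rewrite csum_RtoC in E. apply (f_equal Re) in E. rewrite !Re_RtoC_mult in E. simpl (Re (RtoC _)) in E.
      unfold tl0 at 1. destruct (Nat.eqb_spec n 0); [lia|]. exact E.
    + intros j Hj. unfold tl0. destruct (Nat.eqb_spec j 0); [f_equal; ring|].
      destruct (Nat.eqb_spec j n) as [->|]; [rewrite Nat.sub_diag; simpl; f_equal; ring|].
      destruct (Nat.eqb_spec (n - j) 0); [lia|]. rewrite RtoC_mult, <- !Hre. reflexivity.
Qed.

(* If [D_n = b_n r ^ n] is bounded by [K] up to some large [N], the convolution is at most
   [(n + 1) K ^ 2] against the factor [(n - 6)(n + 1)], so the bound propagates to all [n];
   for fixed [N] this leaves room to enlarge [r]. *)
Lemma pos_coeffs_growth (k : nat) (b : nat -> R) (r M : R) :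
  pos_coeffs k b -> 0 < r -> (forall n, b n * r ^ n <= M) ->
  exists r' M', r < r' /\ forall n, b n * r' ^ n <= M'.
Proof.
  intros H Hr HM. pose proof (pc_k _ _ H) as Hk.
  assert (HM1 : 1 <= M) by (specialize (HM O); rewrite (pc_0 _ _ H) in HM; simpl in HM; lra).
  (* Beyond [N] one has n - 6 > 6 K, which absorbs the 6 K^2 of the convolution; since t^N = 2
     below, the terms up to [N] grow at most from [M] to K = 2 M. *)
  set (K := 2 * M). destruct (INR_unbounded (6 * K + 6)) as [N HN].
  assert (HNpos : 0 < INR N) by (unfold K in HN; lra).
  set (t := Rpower 2 (/ INR N)).
  assert (Ht0 : 0 < t) by apply exp_pos.
  assert (HtN : t ^ N = 2).
  { rewrite <- Rpower_pow by exact Ht0. unfold t. rewrite Rpower_mult, Rinv_l by lra. apply Rpower_1. lra. }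
  assert (Ht1 : 1 < t).
  { apply Rnot_le_lt. intros Hle. assert (t ^ N <= 1 ^ N) by (apply pow_incr; lra). rewrite pow1 in H0. lra. }
  assert (HNk : (6 < N)%nat) by (apply INR_lt; simpl; unfold K in HN; lra).
  set (D := fun n => tl0 b n * (r * t) ^ n).
  assert (HD0 : forall n, 0 <= D n) by (intros n; apply Rmult_le_pos; [apply (tl0_pos k), H|apply pow_le; nra]).
  assert (Hsum : forall n, PS_mult (tl0 b) (tl0 b) n * (r * t) ^ n = sum_f_R0 (fun j => D j * D (n - j)%nat) n).
  { intros n. unfold PS_mult. rewrite Rmult_comm, scal_sum. apply sum_eq. intros j Hj. unfold D.
    replace ((r * t) ^ n) with ((r * t) ^ j * (r * t) ^ (n - j)) by (rewrite <- pow_add; f_equal; lia). ring. }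
  assert (HD : forall n, D n <= K).
  { intros n. induction n as [n IH] using (well_founded_induction Wf_nat.lt_wf).
    destruct (Nat.le_gt_cases n N) as [l|l].
    - unfold D, K. rewrite Rpow_mult_distr.
      assert (T1 : tl0 b n * r ^ n <= M).
      { unfold tl0. destruct (Nat.eqb n 0); [lra|apply HM]. }
      assert (T2 : t ^ n <= 2) by (rewrite <- HtN; apply Rle_pow; [lra|exact l]).
      assert (T3 : 0 <= t ^ n) by (apply pow_le; lra).
      assert (T4 : 0 <= tl0 b n * r ^ n) by (apply Rmult_le_pos; [apply (tl0_pos k), H|apply pow_le; lra]).
      replace (tl0 b n * (r ^ n * t ^ n)) with (tl0 b n * r ^ n * t ^ n) by ring.
      apply Rle_trans with (M * t ^ n); [apply Rmult_le_compat_r; assumption|nra].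
    - pose proof (pc_rec _ _ H n ltac:(lia)) as E.
      assert (E' : (INR n - 6) * (INR n + 1) * D n = 6 * sum_f_R0 (fun j => D j * D (n - j)%nat) n).
      { rewrite <- Hsum. unfold D. rewrite <- Rmult_assoc, E. ring. }
      assert (HnN : INR N < INR n) by (apply lt_INR; exact l).
      assert (Hs : sum_f_R0 (fun j => D j * D (n - j)%nat) n <= sum_f_R0 (fun _ => K * K) n).
      { apply sum_Rle. intros j Hj.
        (* The end terms of the convolution vanish with [tl0 b 0], so the induction hypothesis is
           used only below n. *)
        assert (D0 : D O = 0) by (unfold D, tl0; simpl; ring).
        assert (HK : 0 <= K * K) by (unfold K; nra).
        destruct (Nat.eq_dec j 0) as [->|]; [rewrite D0, Rmult_0_l; exact HK|].
        destruct (Nat.eq_dec j n) as [->|]; [rewrite Nat.sub_diag, D0, Rmult_0_r; exact HK|].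
        apply Rmult_le_compat; [apply HD0|apply HD0|apply IH; lia|apply IH; lia]. }
      rewrite sum_cte, S_INR in Hs.
      assert (E2 : (INR n + 1) * ((INR n - 6) * D n) <= (INR n + 1) * (6 * (K * K))) by lra.
      apply Rmult_le_reg_l in E2; [|lra].
      apply Rmult_le_reg_l with (INR n - 6); [unfold K in HN; lra|].
      apply Rle_trans with (1 := E2). replace (6 * (K * K)) with (6 * K * K) by ring.
      apply Rmult_le_compat_r; [unfold K; lra|lra]. }
  exists (r * t), (K + 1). split; [nra|]. intros n. specialize (HD n). unfold D, tl0 in HD.
  destruct (Nat.eqb_spec n 0) as [e|]; [rewrite e, (pc_0 _ _ H); simpl; unfold K; lra|lra].
Qed.

Lemma PC_real (b : nat -> R) (s : R) : PC (fun n => RtoC (b n)) s = RtoC (PSeries b s).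
Proof.
  unfold PC, RtoC. f_equal.
  rewrite (PSeries_ext _ (fun n => if Nat.eqb n 0 then 0 else 0)) by (intros n; simpl; destruct (Nat.eqb n 0); reflexivity).
  rewrite PSeries_single. ring.
Qed.

Lemma le_at_left_endpoint (f : R -> R) (x d B : R) : ex_derive f x -> 0 < d ->
  (forall s, x - d < s < x -> f s <= B) -> f x <= B.
Proof.
  intros D Hd H. apply Rnot_lt_le. intros Hlt.
  apply (ex_derive_continuous f) in D.
  destruct (proj1 (filterlim_locally f _) D (mkposreal (f x - B) ltac:(lra))) as [e He].
  set (s := x - Rmin d e / 2). assert (Hm : 0 < Rmin d e) by (apply Rmin_pos; [exact Hd|apply e]).
  pose proof (Rmin_l d e). pose proof (Rmin_r d e).
  assert (B1 : Rabs (f s - f x) < f x - B).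
  { apply (He s). change (Rabs (s - x) < e). apply Rabs_def1; unfold s; lra. }
  apply Rabs_def2 in B1. specialize (H s ltac:(unfold s; lra)). lra.
Qed.

(* While the terms are bounded for all smaller radii, [u] equals its series up to [x < 1], where it is
   regular; nonnegative terms are then bounded at [x] too, and hence slightly beyond. *)
Lemma sol_radius (g lam : C) (u du : C -> C) (c : nat -> C) (k : nat) (b : nat -> R) :
  sol g lam u du c -> (forall n, c n = RtoC (b n)) -> pos_coeffs k b ->
  (forall s, 0 < s < 1 -> ~ pole u (RtoC s)) -> cvr b 1.
Proof.
  intros H Hcb Hp Hnp.
  assert (Hb0 : forall n, 0 <= b n) by (intros n; apply (pc_pos _ _ Hp)).
  set (Q := fun r => exists M, forall n, b n * r ^ n <= M).
  assert (Qmono : forall r s, 0 <= s <= r -> Q r -> Q s).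
  { intros r s Hs [M HM]. exists M. intros n. apply Rle_trans with (2 := HM n).
    apply Rmult_le_compat_l; [apply Hb0|]. apply pow_incr. exact Hs. }
  assert (Qcvr : forall x, (forall r, 0 <= r < x -> Q r) -> cvr b x).
  { intros x Hx. apply cvr_of_bound. intros r Hr. destruct (Hx r Hr) as [M HM]. exists M. intros n.
    rewrite Rabs_right by (apply Rle_ge, Hb0). apply HM. }
  apply Qcvr. intros r1 Hr1.
  destruct (sol_real_series _ _ _ _ _ H) as [r [Hr [Hrad _]]].
  set (r0 := r / 2).
  assert (Q0 : Q r0).
  { destruct (bound_of_Rad c r r0 Hrad) as [M HM]; [unfold r0; lra|]. exists M. intros n. specialize (HM n).
    rewrite Hcb, Cmod_R, Rabs_right in HM by (apply Rle_ge, Hb0). exact HM. }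
  destruct (Rle_lt_dec r1 r0) as [l|l]; [apply Qmono with r0; [lra|exact Q0]|].
  apply (real_induction Q r0 r1); [lra|exact Q0| | |lra].
  - intros x Hx HP. destruct (HP x ltac:(lra)) as [M HM].
    destruct (pos_coeffs_growth k b x M Hp ltac:(unfold r0 in *; lra) HM) as [x' [M' [Hx' HM']]].
    exists (x' - x). split; [lra|]. intros y Hy _. apply Qmono with x'; [unfold r0 in *; lra|]. exists M'. exact HM'.
  - intros x Hx HP.
    assert (Hx0 : 0 < x) by (unfold r0 in *; lra).
    assert (Cx : cvr b x).
    { apply Qcvr. intros s Hs. destruct (Rle_lt_dec r0 s); [apply HP; lra|]. apply Qmono with r0; [lra|exact Q0]. }
    assert (Radx : Rad c x).
    { apply Rad_of_bound. intros s Hs. destruct (bound_of_cvr b x s Cx Hs) as [M HM]. exists M. intros n.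
      rewrite Hcb, Cmod_R. apply HM. }
    pose proof (ray_series g lam u du c x H Radx (fun s Hs => Hnp s ltac:(lra))) as Hser.
    destruct (sol_der _ _ _ _ _ H _ (Hnp x ltac:(lra))) as [D _].
    destruct (Cder_bound _ _ _ D) as [d [Hd B]].
    set (d' := Rmin d x). assert (Hd' : 0 < d') by (apply Rmin_pos; lra).
    assert (L1 : d' <= d) by apply Rmin_l. assert (L2 : d' <= x) by apply Rmin_r.
    exists (Cmod (u x) + (Cmod (du x) + 1) * d). intros n.
    apply (le_at_left_endpoint (fun s => b n * s ^ n) x d'); [auto_derive; trivial|exact Hd'|].
    intros s Hs.
    assert (Esx : Cmod (s - x)%C = x - s).
    { rewrite <- RtoC_minus, Cmod_R, Rabs_left; lra. }
    specialize (B (RtoC s)). rewrite Esx in B. specialize (B ltac:(lra)).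
    pose proof (Cmod_sub_ge (u s) (u x)) as T. pose proof (Cmod_ge_0 (du x)) as T'.
    assert (T2 : (Cmod (du x) + 1) * (x - s) <= (Cmod (du x) + 1) * d) by (apply Rmult_le_compat_l; lra).
    (* Since s < 1, dividing the sum by s^2 can only enlarge it. *)
    assert (Hus : PSeries b s <= Cmod (u s)).
    { rewrite (Hser s ltac:(lra)), (PC_ext c _ s Hcb), PC_real.
      assert (Hs2 : 0 < s ^ 2) by (apply pow_lt; lra).
      assert (Hs21 : s ^ 2 <= 1) by (apply pow_le_1; lra).
      rewrite Cmod_div by (apply RtoC_neq_0; lra). rewrite !Cmod_R, (Rabs_right (s ^ 2)) by lra.
      apply Rle_trans with (1 := Rle_abs _). pose proof (Rabs_pos (PSeries b s)).
      apply Rle_div_r; [exact Hs2|]. nra. }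
    assert (Hterm : b n * s ^ n <= PSeries b s).
    { rewrite <- (PSeries_single n (b n) s). apply PSeries_le with x; [apply cvr_single|exact Cx|lra|].
      intros m. destruct (Nat.eqb_spec m n) as [->|]; [lra|apply Hb0]. }
    lra.
Qed.

(** * The double pole *)

(* Almost conserved along solutions: the energy [V^2 - 4U^3 + 12 lam z U + g U] has
   derivative [12 lam U], which the last term cancels to leading order. *)
Definition energy (g lam z U V : C) : C :=
  (V * V - 4 * (U * (U * U)) + 12 * lam * (z * U) + g * U - 6 * lam * (V * / U))%C.

(** The derivative of [energy] along a solution, with V^2 eliminated in favour of the energy itself;
    every term carries a negative power of U. *)
Definition energy_rate (g lam z U V : C) : C :=
  (6 * lam * energy g lam z U V / U ^ 2 + 36 * lam ^ 2 * V / U ^ 3 - (36 * lam ^ 2 * z + 3 * lam * g) / U)%C.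

Lemma cder_energy (g lam h : C) (Z U V : R -> C) (t : R) :
  U t <> 0%C -> cder Z t h -> cder U t (h * V t)%C -> cder V t (h * (6 * U t ^ 2 - 6 * lam * Z t - g / 2))%C ->
  cder (fun s => energy g lam (Z s) (U s) (V s)) t (h * energy_rate g lam (Z t) (U t) (V t))%C.
Proof.
  intros Hn DZ DU DV. unfold energy.
  eapply cder_eq.
  - apply cder_minus; [apply cder_plus; [apply cder_plus; [apply cder_minus|]|]|].
    + apply cder_mult; exact DV.
    + apply cder_scal, cder_mult; [exact DU|apply cder_mult; exact DU].
    + apply cder_scal, cder_mult; [exact DZ|exact DU].
    + apply cder_scal, DU.
    + apply cder_scal, cder_mult; [exact DV|apply cder_inv; [exact Hn|exact DU]].
  - cbv beta. unfold energy_rate, energy. field. exact Hn.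
Qed.

(** The term 6 lam V / U is linear in V: half of |V|^2 absorbs it at the cost of 18 |lam|^2, and
    doubling the rest gives the stated constants. *)
Lemma energy_speed (g lam z U V : C) : 1 <= Cmod U -> Cmod z <= 1 ->
  Cmod V ^ 2 <= 2 * Cmod (energy g lam z U V)
    + (8 + 24 * Cmod lam + 2 * Cmod g + 36 * Cmod lam ^ 2) * Cmod U ^ 3.
Proof.
  intros HU Hz. set (D := energy g lam z U V).
  assert (HU0 : U <> 0%C) by (intros E; rewrite E, Cmod_0 in HU; lra).
  assert (E : (V ^ 2 = D + 4 * U ^ 3 - 12 * lam * z * U - g * U + 6 * lam * V / U)%C).
  { unfold D, energy. field. exact HU0. }
  apply (f_equal Cmod) in E. rewrite Cmod_pow in E.
  assert (T : Cmod V ^ 2 <= Cmod D + 4 * Cmod U ^ 3 + 12 * Cmod lam * Cmod z * Cmod U + Cmod g * Cmod U + 6 * Cmod lam * Cmod V / Cmod U).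
  { rewrite E.
    apply Rle_trans with (1 := Cmod_triangle _ _). unfold Cminus.
    assert (E1 : Cmod (6 * lam * V / U)%C = 6 * Cmod lam * Cmod V / Cmod U).
    { rewrite Cmod_div by exact HU0. rewrite !Cmod_mult, Cmod_R, Rabs_right by lra. reflexivity. }
    rewrite E1. apply Rplus_le_compat_r.
    apply Rle_trans with (1 := Cmod_triangle _ _). rewrite Cmod_opp, Cmod_mult. apply Rplus_le_compat_r.
    apply Rle_trans with (1 := Cmod_triangle _ _). rewrite Cmod_opp, !Cmod_mult, Cmod_R, (Rabs_right 12) by lra. apply Rplus_le_compat_r.
    apply Rle_trans with (1 := Cmod_triangle _ _). rewrite Cmod_mult, Cmod_pow, Cmod_R, (Rabs_right 4) by lra. lra. }
  clear E. pose proof (Cmod_ge_0 V). pose proof (Cmod_ge_0 lam). pose proof (Cmod_ge_0 g). pose proof (Cmod_ge_0 z).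
  set (v := Cmod V) in *. set (l := Cmod lam) in *. set (x := Cmod U) in *. set (G := Cmod g) in *. set (zz := Cmod z) in *. set (d := Cmod D) in *.
  assert (F1 : 6 * l * v / x <= v ^ 2 / 2 + 18 * l ^ 2).
  { apply Rle_trans with (6 * l * v).
    - apply Rle_div_l; [lra|].
      assert (0 <= l * v) by (apply Rmult_le_pos; assumption). nra.
    - pose proof (Rle_0_sqr (v - 6 * l)) as Hs. unfold Rsqr in Hs. lra. }
  assert (X1 : x <= x ^ 3) by (simpl; nra).
  assert (X2 : 1 <= x ^ 3) by lra.
  assert (F2 : 12 * l * zz * x <= 12 * l * x ^ 3).
  { apply Rle_trans with (12 * l * x); [|apply Rmult_le_compat_l; lra].
    apply Rmult_le_compat_r; [lra|]. rewrite <- (Rmult_1_r (12 * l)) at 2. apply Rmult_le_compat_l; lra. }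
  assert (F3 : G * x <= G * x ^ 3) by (apply Rmult_le_compat_l; assumption).
  assert (F4 : l ^ 2 <= l ^ 2 * x ^ 3) by (rewrite <- (Rmult_1_r (l ^ 2)) at 1; apply Rmult_le_compat_l; [simpl; nra|assumption]).
  lra.
Qed.

(** A bound linear in the energy is what Gronwall asks for. The term with V / U^3 is harmless
    because |V| <= 1 + |V|^2, and |V|^2 is controlled by the energy and |U|^3. *)
Lemma energy_rate_bound (g lam : C) : exists K, 0 <= K /\ forall z U V, 1 <= Cmod U -> Cmod z <= 1 ->
  Cmod (energy_rate g lam z U V) <= K * (1 + Cmod (energy g lam z U V)).
Proof.
  pose proof (Cmod_ge_0 lam) as Hl. pose proof (Cmod_ge_0 g) as Hg.
  set (l := Cmod lam) in *. set (G := Cmod g) in *.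
  set (K2 := 8 + 24 * l + 2 * G + 36 * l ^ 2).
  assert (Hl2 : 0 <= l ^ 2) by (simpl; nra).
  assert (HlG : 0 <= l * G) by (apply Rmult_le_pos; assumption).
  exists (6 * l + 36 * l ^ 2 * (3 + K2) + 36 * l ^ 2 + 3 * (l * G)). split.
  { assert (0 <= l ^ 2 * (3 + K2)) by (apply Rmult_le_pos; unfold K2; lra). lra. }
  intros z U V HU Hz. pose proof (energy_speed g lam z U V HU Hz) as Hs. unfold energy_rate.
  fold l G in Hs. fold K2 in Hs.
  assert (HU0 : U <> 0%C) by (intros E; rewrite E, Cmod_0 in HU; lra).
  set (D := energy g lam z U V) in *. pose proof (Cmod_ge_0 D) as HD. pose proof (Cmod_ge_0 z) as Hz0. pose proof (Cmod_ge_0 V) as HV.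
  assert (E1 : Cmod (6 * lam * D / U ^ 2)%C <= 6 * l * Cmod D).
  { rewrite Cmod_div by (apply Cpow_nz, HU0). rewrite !Cmod_mult, Cmod_pow, Cmod_R, (Rabs_right 6) by lra. fold l.
    apply Rle_div_l; [simpl; nra|].
    assert (0 <= l * Cmod D) by (apply Rmult_le_pos; assumption). assert (1 <= Cmod U ^ 2) by (simpl; nra). nra. }
  assert (E2 : Cmod (36 * lam ^ 2 * V / U ^ 3)%C <= 36 * l ^ 2 * ((3 + K2) * (1 + Cmod D))).
  { rewrite Cmod_div by (apply Cpow_nz, HU0). rewrite !Cmod_mult, !Cmod_pow, Cmod_R, (Rabs_right 36) by lra. fold l.
    unfold Rdiv. rewrite Rmult_assoc. apply Rmult_le_compat_l; [lra|].
    assert (X3 : 1 <= Cmod U ^ 3) by (apply pow_R1_Rle; lra).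
    apply Rmult_le_reg_r with (Cmod U ^ 3); [lra|]. rewrite Rmult_assoc, Rinv_l, Rmult_1_r by lra.
    assert (V1 : Cmod V <= 1 + Cmod V ^ 2) by (pose proof (Rle_0_sqr (Cmod V - 1)) as Hq; unfold Rsqr in Hq; simpl; nra).
    apply Rle_trans with (1 := V1).
    assert (0 <= K2) by (unfold K2; lra).
    apply Rle_trans with ((1 + 2 * Cmod D + K2) * Cmod U ^ 3); [nra|].
    apply Rmult_le_compat_r; [lra|]. nra. }
  assert (E3 : Cmod ((36 * lam ^ 2 * z + 3 * lam * g) / U)%C <= 36 * l ^ 2 + 3 * (l * G)).
  { rewrite Cmod_div by exact HU0. apply Rle_div_l; [lra|].
    apply Rle_trans with (1 := Cmod_triangle _ _). rewrite !Cmod_mult, !Cmod_pow, !Cmod_R, (Rabs_right 36), (Rabs_right 3) by lra. fold l G.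
    assert (l ^ 2 * Cmod z <= l ^ 2) by nra. nra. }
  unfold Cminus. pose proof (Cmod_triangle (6 * lam * D / U ^ 2 + 36 * lam ^ 2 * V / U ^ 3) (- ((36 * lam ^ 2 * z + 3 * lam * g) / U))) as T1.
  pose proof (Cmod_triangle (6 * lam * D / U ^ 2) (36 * lam ^ 2 * V / U ^ 3)) as T2. rewrite Cmod_opp in T1.
  assert (0 <= l ^ 2 * (3 + K2)) by (apply Rmult_le_pos; unfold K2; lra).
  assert (0 <= l ^ 2 * (3 + K2) * Cmod D) by (apply Rmult_le_pos; assumption).
  assert (0 <= l ^ 2 * Cmod D) by (apply Rmult_le_pos; assumption).
  assert (0 <= l * G * Cmod D) by (apply Rmult_le_pos; assumption).
  apply Rle_trans with (6 * l * Cmod D + 36 * l ^ 2 * ((3 + K2) * (1 + Cmod D)) + (36 * l ^ 2 + 3 * (l * G))); [lra|].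
  replace ((6 * l + 36 * l ^ 2 * (3 + K2) + 36 * l ^ 2 + 3 * (l * G)) * (1 + Cmod D))
    with (6 * l * Cmod D + 36 * l ^ 2 * ((3 + K2) * (1 + Cmod D)) + (36 * l ^ 2 + 3 * (l * G)) + (6 * l + 36 * (l ^ 2 * Cmod D) + 3 * (l * G * Cmod D))) by ring.
  lra.
Qed.

Lemma sol_line (g lam : C) (u du : C -> C) (c : nat -> C) (p h : C) (t : R) :
  sol g lam u du c -> ~ pole u (p + RtoC t * h)%C ->
  cder (fun s => p + RtoC s * h)%C t h /\
  cder (fun s => u (p + RtoC s * h)%C) t (h * du (p + RtoC t * h))%C /\
  cder (fun s => du (p + RtoC s * h)%C) t
    (h * (6 * u (p + RtoC t * h) ^ 2 - 6 * lam * (p + RtoC t * h) - g / 2))%C.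
Proof.
  intros H Hn. destruct (sol_der _ _ _ _ _ H _ Hn) as [D1 D2]. split; [|split; apply cder_line; assumption].
  eapply cder_eq; [apply cder_plus; [apply cder_const|apply cder_mult; [apply cder_id|apply cder_const]]|]. cbv beta. ring.
Qed.

(* The half-neighbourhood |z| < 1, |z - 1| < r of the pole is convex, which is all
   that the estimates along segments need. *)
Definition near1 (r : R) (z : C) : Prop := Cmod z < 1 /\ Cmod (z - 1)%C < r.

Lemma near1_convex (r : R) (x y : C) (t : R) : 0 <= t <= 1 -> near1 r x -> near1 r y -> near1 r (x + RtoC t * (y - x))%C.
Proof.
  intros Ht [X1 X2] [Y1 Y2].
  assert (G : forall a b m, Cmod a < m -> Cmod b < m -> Cmod (RtoC (1 - t) * a + RtoC t * b)%C < m).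
  { intros a b m Ha Hb. apply Rle_lt_trans with (1 := Cmod_triangle _ _). rewrite !Cmod_mult, !Cmod_R, !Rabs_right by lra.
    destruct (Req_dec t 0) as [->|]; [lra|]. nra. }
  split.
  - replace (x + RtoC t * (y - x))%C with (RtoC (1 - t) * x + RtoC t * y)%C by (rewrite RtoC_minus; ring). apply G; assumption.
  - replace (x + RtoC t * (y - x) - 1)%C with (RtoC (1 - t) * (x - 1) + RtoC t * (y - 1))%C by (rewrite RtoC_minus; ring). apply G; assumption.
Qed.

(** Gronwall along segments from a fixed base point, applied to 1 + |D|^2: the modulus itself is not
    differentiable at 0, and the 1 absorbs the inhomogeneous part of the rate. *)
Lemma energy_bounded (g lam : C) (u du : C -> C) (c : nat -> C) (r : R) :
  sol g lam u du c -> 0 < r < 1 ->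
  (forall z, near1 r z -> ~ pole u z /\ 1 <= Cmod (u z)) ->
  exists B, 0 <= B /\ forall z, near1 r z -> Cmod (energy g lam z (u z) (du z)) <= B.
Proof.
  intros H Hr Hn. destruct (energy_rate_bound g lam) as [K [HK0 HK]].
  set (x0 := RtoC (1 - r / 2)).
  assert (Hx0 : near1 r x0).
  { unfold x0. split.
    - rewrite Cmod_R, Rabs_right; lra.
    - rewrite <- RtoC_minus, Cmod_R, Rabs_left; lra. }
  set (N0 := 1 + Cmod (energy g lam x0 (u x0) (du x0)) * Cmod (energy g lam x0 (u x0) (du x0))).
  assert (HN0 : 1 <= N0) by (unfold N0; pose proof (Cmod_ge_0 (energy g lam x0 (u x0) (du x0))); nra).
  exists (N0 * exp (2 * (3 * K) * (1 - 0))). pose proof (exp_pos (2 * (3 * K) * (1 - 0))) as Hexp. split; [nra|].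
  intros z Hz. set (h := (z - x0)%C).
  assert (Hh : Cmod h <= 2).
  { unfold h, Cminus. apply Rle_trans with (1 := Cmod_triangle _ _). rewrite Cmod_opp. destruct Hz, Hx0. lra. }
  set (D := fun t : R => energy g lam (x0 + RtoC t * h)%C (u (x0 + RtoC t * h)%C) (du (x0 + RtoC t * h)%C)).
  set (D' := fun t : R => (h * energy_rate g lam (x0 + RtoC t * h)%C (u (x0 + RtoC t * h)%C) (du (x0 + RtoC t * h)%C))%C).
  (* The rate 6 K combines |h| <= 2 with 2 d (1 + d) <= 3 (1 + d^2) for d = |D|. *)
  pose proof (gronwall (fun t => 1 + Cmod (D t) * Cmod (D t))
    (fun t => 0 + 2 * (Re (D t) * Re (D' t) + Im (D t) * Im (D' t))) (2 * (3 * K)) 0 1 ltac:(lra)) as GW.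
  assert (Hend : 1 + Cmod (D 1) * Cmod (D 1) <= (1 + Cmod (D 0) * Cmod (D 0)) * exp (2 * (3 * K) * (1 - 0))).
  { apply GW. clear GW. intros t Ht.
    pose proof (near1_convex r x0 z t Ht Hx0 Hz) as Hy. fold h in Hy. destruct (Hn _ Hy) as [Hnp Hu1].
    destruct (sol_line g lam u du c x0 h t H Hnp) as (D1 & D2 & D3).
    assert (Hu0 : u (x0 + RtoC t * h)%C <> 0%C) by (intros E; rewrite E, Cmod_0 in Hu1; lra).
    pose proof (cder_energy g lam h _ _ _ t Hu0 D1 D2 D3) as DD. split.
    - apply (is_derive_plus (fun _ => 1)); [apply @is_derive_const|]. apply (cder_Cmod_sqr D t (D' t)). exact DD.
    - pose proof (Cdot_le (D t) (D' t)) as B1. unfold D' at 3 in B1. rewrite Cmod_mult in B1.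
      pose proof (HK (x0 + RtoC t * h)%C (u (x0 + RtoC t * h)%C) (du (x0 + RtoC t * h)%C) Hu1 ltac:(destruct Hy; lra)) as B2.
      fold (D t) in B2. pose proof (Cmod_ge_0 (D t)) as P0. pose proof (Cmod_ge_0 h) as P1.
      set (e := Cmod (energy_rate g lam (x0 + RtoC t * h)%C (u (x0 + RtoC t * h)%C) (du (x0 + RtoC t * h)%C))) in *.
      assert (P2 : 0 <= e) by apply Cmod_ge_0. set (d := Cmod (D t)) in *. set (m := Cmod h) in *.
      assert (Q1 : m * e <= 2 * (K * (1 + d))) by (apply Rmult_le_compat; assumption).
      assert (Q2 : d * (m * e) <= d * (2 * (K * (1 + d)))) by (apply Rmult_le_compat_l; assumption).
      assert (Q3 : 2 * (d * (1 + d)) <= 3 * (1 + d * d)) by (pose proof (Rle_0_sqr (d - 1)) as Hq; unfold Rsqr in Hq; lra).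
      assert (Q4 : 2 * K * (2 * (d * (1 + d))) <= 2 * K * (3 * (1 + d * d))) by (apply Rmult_le_compat_l; lra).
      lra. }
  assert (E1 : (x0 + 1 * h)%C = z) by (unfold h; ring). assert (E0 : (x0 + 0 * h)%C = x0) by ring.
  unfold D in Hend. rewrite E1, E0 in Hend. fold N0 in Hend.
  set (e := Cmod (energy g lam z (u z) (du z))) in *. assert (0 <= e) by apply Cmod_ge_0.
  assert (e <= 1 + e * e) by nra. lra.
Qed.

Lemma pole_near1 (g lam : C) (u du : C -> C) (c : nat -> C) (A : R) :
  sol g lam u du c -> pole u 1%C ->
  exists r, 0 < r < 1 /\ forall z, near1 r z -> ~ pole u z /\ A <= Cmod (u z).
Proof.
  intros H Hp. destruct (sol_isolated _ _ _ _ _ H 1%C) as [d1 [Hd1 B1]]. destruct (Hp A) as [d2 [Hd2 B2]].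
  set (r := Rmin (Rmin d1 d2) 1 / 2).
  assert (Hm : 0 < Rmin (Rmin d1 d2) 1) by (repeat apply Rmin_pos; lra).
  pose proof (Rmin_l (Rmin d1 d2) 1). pose proof (Rmin_r (Rmin d1 d2) 1). pose proof (Rmin_l d1 d2). pose proof (Rmin_r d1 d2).
  exists r. split; [unfold r; lra|]. intros z [Hz1 Hz2].
  assert (Hne : z <> 1%C) by (intros ->; rewrite Cmod_1 in Hz1; lra).
  split; [apply B1; [exact Hne|unfold r in *; lra]|left; apply B2; [exact Hne|unfold r in *; lra]].
Qed.

(* With [q = u / u'], the energy bound gives [q' = -1/2 + O(1 / u)], hence
   [q = -(z - 1) / 2 + O((z - 1)^3)] and [u = 1 / (4 q^2) + O(1 / u)]. *)
Lemma log_derivative_bounds (g lam : C) (u du : C -> C) (c : nat -> C) :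
  sol g lam u du c -> pole u 1%C ->
  exists r K, 0 < r < 1 /\ 0 <= K /\ forall z, near1 r z ->
    ~ pole u z /\ 1 <= Cmod (u z) /\ du z <> 0%C /\
    / (5 * Cmod (u z)) <= Cmod (u z / du z)%C ^ 2 <= / (3 * Cmod (u z)) /\
    Cmod (1 + / 2 - u z * (6 * u z ^ 2 - 6 * lam * z - g / 2) / du z ^ 2)%C <= K / Cmod (u z) /\
    K / Cmod (u z) <= 1 / 4 /\
    Cmod (u z - du z ^ 2 / (4 * u z ^ 2))%C <= 1.
Proof.
  intros H Hp. destruct (pole_near1 g lam u du c 1 H Hp) as [r1 [Hr1 N1]].
  destruct (energy_bounded g lam u du c r1 H Hr1 N1) as [B [HB0 HB]].
  pose proof (Cmod_ge_0 lam) as Hl. pose proof (Cmod_ge_0 g) as Hg.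
  set (l := Cmod lam) in *. set (G := Cmod g) in *.
  set (C2 := 2 * B + (8 + 24 * l + 2 * G + 36 * l ^ 2)).
  assert (Hl2 : 0 <= l ^ 2) by (simpl; nra).
  assert (HC2 : 0 <= C2) by (unfold C2; lra).
  assert (HlC : 0 <= l * (1 + C2)) by (apply Rmult_le_pos; lra).
  set (C4 := B + 6 * (l * (1 + C2)) + 12 * l + G).
  assert (HC4 : 0 <= C4) by (unfold C4; lra).
  set (C5 := 1.5 * C4 + 6 * l + G).
  assert (HC5 : 0 <= C5) by (unfold C5; lra).
  (* Where |u| is at least this threshold, the error R = u'^2 - 4 u^3 is at most |u|^3 and C5 / |u|
     is at most 1/4. *)
  destruct (pole_near1 g lam u du c (1 + C4 + 4 * C5) H Hp) as [r2 [Hr2 N2]].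
  set (r := Rmin r1 r2). assert (Hr : 0 < r) by (apply Rmin_pos; lra).
  assert (L1 : r <= r1) by apply Rmin_l. assert (L2 : r <= r2) by apply Rmin_r.
  exists r, C5. split; [lra|]. split; [exact HC5|]. intros z Hz.
  assert (Hz1 : near1 r1 z) by (destruct Hz; split; lra). assert (Hz2 : near1 r2 z) by (destruct Hz; split; lra).
  destruct (N2 z Hz2) as [Hnp HA]. specialize (HB z Hz1). destruct Hz as [Hzu _].
  set (U := u z) in *. set (V := du z) in *. set (x := Cmod U) in *.
  assert (Hx1 : 1 <= x) by lra.
  assert (HU0 : U <> 0%C) by (apply Cmod_gt_0; fold x; lra).
  pose proof (energy_speed g lam z U V Hx1 ltac:(lra)) as Hs. fold l G x in Hs.
  set (D := energy g lam z U V) in *.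
  assert (X2 : x <= x ^ 2) by (simpl; nra). assert (X3 : x ^ 2 <= x ^ 3) by (simpl; nra). assert (X4 : x ^ 3 <= x ^ 4) by (simpl; nra).
  assert (HV2 : Cmod V ^ 2 <= C2 * x ^ 3) by (unfold C2; nra).
  assert (HV : Cmod V <= (1 + C2) * x ^ 2).
  { apply Rnot_lt_le. intros Hlt.
    assert (0 <= (1 + C2) * x ^ 2) by (apply Rmult_le_pos; lra).
    assert (Hq : ((1 + C2) * x ^ 2) ^ 2 < Cmod V ^ 2) by (simpl; nra).
    assert (C2 * x ^ 3 <= ((1 + C2) * x ^ 2) ^ 2); [|lra].
    replace (((1 + C2) * x ^ 2) ^ 2) with ((1 + C2) ^ 2 * x ^ 4) by ring.
    apply Rmult_le_compat; [lra|lra|nra|lra]. }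
  set (R := (V ^ 2 - 4 * U ^ 3)%C).
  assert (ER : R = (D + 6 * lam * V / U - 12 * lam * z * U - g * U)%C).
  { unfold R, D, energy. field. exact HU0. }
  assert (HR : Cmod R <= C4 * x).
  { rewrite ER. unfold Cminus.
    pose proof (Cmod_triangle (D + 6 * lam * V / U + - (12 * lam * z * U)) (- (g * U))) as T1.
    pose proof (Cmod_triangle (D + 6 * lam * V / U) (- (12 * lam * z * U))) as T2.
    pose proof (Cmod_triangle D (6 * lam * V / U)) as T3.
    rewrite Cmod_opp, Cmod_mult in T1. rewrite Cmod_opp, !Cmod_mult, Cmod_R, (Rabs_right 12) in T2 by lra.
    rewrite Cmod_div in T3 by exact HU0. rewrite !Cmod_mult, Cmod_R, (Rabs_right 6) in T3 by lra. fold l G x in T1, T2, T3.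
    assert (F1 : 6 * l * Cmod V / x <= 6 * (l * (1 + C2)) * x).
    { apply Rle_div_l; [lra|].
      replace (6 * (l * (1 + C2)) * x * x) with (6 * l * ((1 + C2) * x ^ 2)) by ring. apply Rmult_le_compat_l; lra. }
    assert (F2 : 12 * l * Cmod z * x <= 12 * l * x).
    { apply Rmult_le_compat_r; [lra|]. rewrite <- (Rmult_1_r (12 * l)) at 2. apply Rmult_le_compat_l; lra. }
    assert (F3 : B <= B * x) by nra.
    unfold C4. lra. }
  assert (HR3 : Cmod R <= x ^ 3).
  { apply Rle_trans with (1 := HR). replace (x ^ 3) with (x ^ 2 * x) by ring. apply Rmult_le_compat_r; lra. }
  assert (EV : (V ^ 2)%C = (4 * U ^ 3 + R)%C) by (unfold R; ring).
  assert (HUmod : Cmod (4 * U ^ 3)%C = 4 * x ^ 3) by (rewrite Cmod_mult, Cmod_pow, Cmod_R, Rabs_right by lra; reflexivity).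
  assert (HVup : Cmod V ^ 2 <= 5 * x ^ 3).
  { rewrite <- Cmod_pow, EV. apply Rle_trans with (1 := Cmod_triangle _ _). lra. }
  assert (HVlo : 3 * x ^ 3 <= Cmod V ^ 2).
  { rewrite <- Cmod_pow, EV. pose proof (Cmod_sub_ge (4 * U ^ 3) (- R)) as T. rewrite Cmod_opp in T.
    replace (4 * U ^ 3 - - R)%C with (4 * U ^ 3 + R)%C in T by ring. lra. }
  assert (HV0 : V <> 0%C).
  { intros E. rewrite E, Cmod_0 in HVlo. simpl in HVlo. lra. }
  assert (Hpos3 : 0 < x ^ 3) by lra. assert (HVpos : 0 < Cmod V ^ 2) by lra.
  split; [exact Hnp|]. split; [exact Hx1|]. split; [exact HV0|]. split; [|split; [|split]].
  - rewrite Cmod_div by exact HV0. fold x. replace ((x / Cmod V) ^ 2) with (x ^ 2 / Cmod V ^ 2) by (field; intros E; rewrite E in HVpos; simpl in HVpos; lra).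
    split; [apply Rle_div_r|apply Rle_div_l]; try exact HVpos.
    + apply Rmult_le_reg_l with (5 * x); [lra|]. rewrite <- Rmult_assoc, Rinv_r, Rmult_1_l by lra. simpl in *. lra.
    + apply Rmult_le_reg_l with (3 * x); [lra|]. rewrite <- (Rmult_assoc _ (/ _)), Rinv_r, Rmult_1_l by lra. simpl in *. lra.
  (* 1 - u u'' / u'^2 is the derivative of u / u'; adding 1/2 cancels the leading terms, since 3/2
     V^2 - 6 U^3 = 3/2 R. *)
  - replace (1 + / 2 - U * (6 * U ^ 2 - 6 * lam * z - g / 2) / V ^ 2)%C
      with ((RtoC 1.5 * R + 6 * lam * z * U + g / 2 * U) / V ^ 2)%C.
    2:{ replace (RtoC 1.5) with (RtoC 3 / RtoC 2)%C by (rewrite <- RtoC_div; f_equal; lra). unfold R. field. exact HV0. }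
    rewrite Cmod_div by (apply Cpow_nz, HV0). rewrite Cmod_pow.
    assert (HN : Cmod (RtoC 1.5 * R + 6 * lam * z * U + g / 2 * U)%C <= C5 * x).
    { pose proof (Cmod_triangle (RtoC 1.5 * R + 6 * lam * z * U) (g / 2 * U)) as T1.
      pose proof (Cmod_triangle (RtoC 1.5 * R) (6 * lam * z * U)) as T2.
      rewrite !Cmod_mult, !Cmod_R, (Rabs_right 1.5), (Rabs_right 6) in T2 by lra.
      rewrite Cmod_mult, Cmod_div, Cmod_R, (Rabs_right 2) in T1 by (try lra; apply RtoC_neq_0; lra). fold l G x in T1, T2.
      assert (F2 : 6 * l * Cmod z * x <= 6 * l * x).
      { apply Rmult_le_compat_r; [lra|]. rewrite <- (Rmult_1_r (6 * l)) at 2. apply Rmult_le_compat_l; lra. }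
      assert (0 <= G * x) by (apply Rmult_le_pos; lra).
      unfold C5. lra. }
    apply Rle_div_l; [exact HVpos|].
    apply Rle_trans with (1 := HN). apply Rle_trans with (C5 / x * (3 * x ^ 3)).
    + replace (C5 / x * (3 * x ^ 3)) with (3 * (C5 * x ^ 2)) by (field; lra).
      assert (C5 * x <= C5 * x ^ 2) by (apply Rmult_le_compat_l; lra).
      assert (0 <= C5 * x ^ 2) by (apply Rmult_le_pos; lra). lra.
    + apply Rmult_le_compat_l; [|exact HVlo]. apply Rmult_le_pos; [exact HC5|left; apply Rinv_0_lt_compat; lra].
  - apply Rmult_le_reg_r with x; [lra|]. replace (C5 / x * x) with C5 by (field; lra). lra.
  - replace (U - V ^ 2 / (4 * U ^ 2))%C with (- R / (4 * U ^ 2))%C by (unfold R; field; exact HU0).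
    assert (H4 : RtoC 4 <> 0%C) by (apply RtoC_neq_0; lra).
    rewrite Cmod_div by (apply Cmult_neq_0; [exact H4|apply Cpow_nz, HU0]).
    rewrite Cmod_opp, Cmod_mult, Cmod_pow, Cmod_R, (Rabs_right 4) by lra. fold x.
    apply Rle_div_l; [lra|].
    apply Rle_trans with (1 := HR). replace (1 * (4 * x ^ 2)) with (4 * x * x) by ring. apply Rmult_le_compat_r; lra.
Qed.

(** The same estimate is used twice. The crude K / |u| <= 1/4 gives |q + (z - 1)/2| <= |z - 1| / 4,
    hence 1 / |u| <= 3 |z - 1|^2; fed back, this makes the error cubic, the order that a later
    division by |z - 1|^4 requires. *)
Lemma double_pole_bound (g lam : C) (u du : C -> C) (c : nat -> C) :
  sol g lam u du c -> pole u 1%C ->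
  exists r M, 0 < r /\ forall z, near1 r z -> Cmod (u z - / (z - 1) ^ 2)%C <= M.
Proof.
  intros H Hp. destruct (log_derivative_bounds g lam u du c H Hp) as (r & K & Hr & HK & HN).
  exists r, (1 + 60 * K). split; [lra|].
  assert (Hseg : forall z s, near1 r z -> 0 < s <= 1 -> near1 r (1 + RtoC s * (z - 1))%C).
  { intros z s [Hz1 Hz2] Hs. split.
    - replace (1 + RtoC s * (z - 1))%C with (RtoC (1 - s) + RtoC s * z)%C by (rewrite RtoC_minus; ring).
      apply Rle_lt_trans with (1 := Cmod_triangle _ _). rewrite Cmod_mult, !Cmod_R, !Rabs_right by lra. nra.
    - replace (1 + RtoC s * (z - 1) - 1)%C with (RtoC s * (z - 1))%C by ring.
      rewrite Cmod_mult, Cmod_R, Rabs_right by lra. pose proof (Cmod_ge_0 (z - 1)%C). nra. }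
  assert (Hstep : forall z M, near1 r z ->
     (forall s, 0 < s <= 1 -> K / Cmod (u (1 + RtoC s * (z - 1))%C) <= M) ->
     Cmod (u z / du z + (z - 1) / 2)%C <= M * Cmod (z - 1)%C).
  { intros z M Hz HM. set (h := (z - 1)%C) in *.
    set (f := fun s : R => (u (1 + RtoC s * h) / du (1 + RtoC s * h) + RtoC s * (h / 2))%C).
    set (df := fun s : R => (h * (1 + / 2 - u (1 + RtoC s * h)%C * (6 * u (1 + RtoC s * h)%C ^ 2 - 6 * lam * (1 + RtoC s * h) - g / 2) / du (1 + RtoC s * h)%C ^ 2))%C).
    assert (Hder : forall s, 0 < s <= 1 -> cder f s (df s)).
    { intros s Hs. destruct (HN _ (Hseg z s Hz Hs)) as (Hnp & _ & Hd0 & _). fold h in Hnp, Hd0.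
      destruct (sol_line g lam u du c 1%C h s H Hnp) as (_ & D2 & D3).
      eapply cder_eq.
      - apply cder_plus; [apply cder_mult; [exact D2|apply cder_inv; [exact Hd0|exact D3]]|apply cder_mult; [apply cder_id|apply cder_const]].
      - unfold df. cbv beta. field. exact Hd0. }
    assert (Hbd : forall s, 0 < s <= 1 -> Cmod (f 1 - f s)%C <= M * Cmod h * (1 - s)).
    { intros s Hs. apply (cder_mean_value f df); [lra|]. intros t Ht. split; [apply Hder; lra|].
      unfold df. rewrite Cmod_mult, Rmult_comm. apply Rmult_le_compat_r; [apply Cmod_ge_0|].
      destruct (HN _ (Hseg z t Hz ltac:(lra))) as (_ & _ & _ & _ & Hq & _). fold h in Hq.
      apply Rle_trans with (1 := Hq). apply HM. lra. }
    assert (M0 : 0 <= M).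
    { apply Rle_trans with (2 := HM 1 ltac:(lra)). apply Rmult_le_pos; [exact HK|].
      destruct (HN _ (Hseg z 1 Hz ltac:(lra))) as (_ & Hu & _). fold h in Hu. left. apply Rinv_0_lt_compat. lra. }
    assert (Hh0 : 0 < Cmod h).
    { apply Cmod_gt_0. intros E. destruct Hz as [Hz1 _]. replace z with (h + 1)%C in Hz1 by (unfold h; ring).
      rewrite E in Hz1. replace (0 + 1)%C with (RtoC 1) in Hz1 by ring. rewrite Cmod_1 in Hz1. lra. }
    assert (E1 : f 1 = (u z / du z + h / 2)%C).
    { unfold f. replace (1 + 1 * h)%C with z by (unfold h; ring). ring. }
    (* The segment starts at the pole, where [f] has no meaningful value; the estimate from s to 1
       is used with s close to 0, where |q|^2 <= 1 / (3 |u|) is small. *)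
    rewrite <- E1. apply Rnot_lt_le. intros Hlt.
    set (eps := (Cmod (f 1) - M * Cmod h) / 2). assert (Heps : 0 < eps) by (unfold eps; lra).
    destruct (Hp (/ (eps * eps))) as [d [Hd HP]].
    set (s := Rmin (Rmin 1 (eps / Cmod h)) (d / Cmod h) / 2).
    assert (Hs0 : 0 < Rmin (Rmin 1 (eps / Cmod h)) (d / Cmod h)) by (repeat apply Rmin_pos; try lra; apply Rdiv_lt_0_compat; assumption).
    pose proof (Rmin_l (Rmin 1 (eps / Cmod h)) (d / Cmod h)) as A1. pose proof (Rmin_r (Rmin 1 (eps / Cmod h)) (d / Cmod h)) as A2.
    pose proof (Rmin_l 1 (eps / Cmod h)) as A3. pose proof (Rmin_r 1 (eps / Cmod h)) as A4.
    assert (Hs : 0 < s <= 1) by (unfold s; lra).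
    assert (Hsd : s * Cmod h < d).
    { apply Rlt_le_trans with (d / Cmod h * Cmod h); [apply Rmult_lt_compat_r; [exact Hh0|unfold s; lra]|right; field; lra]. }
    assert (Hse : s * Cmod h < eps).
    { apply Rlt_le_trans with (eps / Cmod h * Cmod h); [apply Rmult_lt_compat_r; [exact Hh0|unfold s; lra]|right; field; lra]. }
    specialize (Hbd s Hs). pose proof (Cmod_sub_ge (f 1) (f s)) as T.
    destruct (HN _ (Hseg z s Hz Hs)) as (_ & Hu1 & _ & [_ Hq] & _). fold h in Hu1, Hq.
    assert (Hhh : Cmod (h / 2)%C = Cmod h / 2).
    { rewrite Cmod_div by (apply RtoC_neq_0; lra). rewrite Cmod_R, Rabs_right by lra. reflexivity. }
    assert (Hfs : Cmod (f s) <= Cmod (u (1 + RtoC s * h) / du (1 + RtoC s * h))%C + s * Cmod h / 2).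
    { unfold f. apply Rle_trans with (1 := Cmod_triangle _ _).
      rewrite (Cmod_mult (RtoC s)), Hhh, Cmod_R, (Rabs_right s) by lra. lra. }
    assert (Hularge : / (eps * eps) < Cmod (u (1 + RtoC s * h)%C)).
    { assert (Eh : Cmod (1 + RtoC s * h - 1)%C = s * Cmod h).
      { replace (1 + RtoC s * h - 1)%C with (RtoC s * h)%C by ring. rewrite Cmod_mult, Cmod_R, Rabs_right by lra. reflexivity. }
      apply HP; [|rewrite Eh; exact Hsd].
      intros E. rewrite E in Eh. replace (1 - 1)%C with (RtoC 0) in Eh by ring. rewrite Cmod_0 in Eh.
      assert (0 < s * Cmod h) by (apply Rmult_lt_0_compat; lra). lra. }
    set (w := Cmod (u (1 + RtoC s * h)%C)) in *. set (qq := Cmod (u (1 + RtoC s * h) / du (1 + RtoC s * h))%C) in *.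
    assert (Hqq : 0 <= qq) by apply Cmod_ge_0.
    assert (Hee : 0 < eps * eps) by (apply Rmult_lt_0_compat; assumption).
    assert (Hinv : / (3 * w) < eps * eps).
    { rewrite <- (Rinv_inv (eps * eps)). apply Rinv_lt_contravar; [|lra].
      apply Rmult_lt_0_compat; [apply Rinv_0_lt_compat; exact Hee|lra]. }
    assert (Hqe : qq < eps) by (apply Rnot_le_lt; intros Hle; simpl in Hq; nra).
    assert (Hms : M * Cmod h * (1 - s) <= M * Cmod h).
    { assert (0 <= M * Cmod h) by (apply Rmult_le_pos; lra). nra. }
    unfold eps in *. lra. }
  intros z Hz.
  assert (Hq1 : forall y, near1 r y -> Cmod (u y / du y + (y - 1) / 2)%C <= 1 / 4 * Cmod (y - 1)%C).
  { intros y Hy. apply Hstep; [exact Hy|]. intros s Hs. apply (HN _ (Hseg y s Hy Hs)). }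
  assert (Hhalf : forall w : C, Cmod (w / 2)%C = Cmod w / 2).
  { intros w. rewrite Cmod_div by (apply RtoC_neq_0; lra). rewrite Cmod_R, Rabs_right by lra. reflexivity. }
  assert (Hinvu : forall y, near1 r y -> / Cmod (u y) <= 3 * Cmod (y - 1)%C ^ 2).
  { intros y Hy. destruct (HN _ Hy) as (_ & Hu1 & _ & [Hlo _] & _). specialize (Hq1 y Hy).
    pose proof (Cmod_sub_ge (u y / du y) (- ((y - 1) / 2))) as T.
    replace (u y / du y - - ((y - 1) / 2))%C with (u y / du y + (y - 1) / 2)%C in T by ring. rewrite Cmod_opp, Hhalf in T.
    set (qq := Cmod (u y / du y)%C) in *. set (w := Cmod (y - 1)%C) in *. assert (0 <= qq) by apply Cmod_ge_0. assert (0 <= w) by apply Cmod_ge_0.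
    assert (Hqw : qq <= 3 / 4 * w) by lra.
    assert (qq ^ 2 <= (3 / 4 * w) ^ 2) by (apply pow_incr; lra).
    rewrite Rinv_mult in Hlo. simpl in *. nra. }
  assert (Hq2 : Cmod (u z / du z + (z - 1) / 2)%C <= 3 * K * Cmod (z - 1)%C ^ 2 * Cmod (z - 1)%C).
  { apply Hstep; [exact Hz|]. intros s Hs. specialize (Hinvu _ (Hseg z s Hz Hs)).
    replace (1 + RtoC s * (z - 1) - 1)%C with (RtoC s * (z - 1))%C in Hinvu by ring.
    rewrite Cmod_mult, Cmod_R, Rabs_right in Hinvu by lra.
    unfold Rdiv. apply Rle_trans with (K * (3 * (s * Cmod (z - 1)%C) ^ 2)); [apply Rmult_le_compat_l; assumption|].
    replace (3 * K * Cmod (z - 1)%C ^ 2) with (K * (3 * Cmod (z - 1)%C ^ 2)) by ring.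
    apply Rmult_le_compat_l; [exact HK|]. apply Rmult_le_compat_l; [lra|]. pose proof (Cmod_ge_0 (z - 1)%C). apply pow_incr. nra. }
  destruct (HN _ Hz) as (_ & Hu1 & Hd0 & _ & _ & _ & Hlast). specialize (Hq1 z Hz).
  set (q := (u z / du z)%C) in *. set (w := (z - 1)%C) in *.
  assert (Hw0 : w <> 0%C).
  { intros E. destruct Hz as [Hz1 _]. replace z with (w + 1)%C in Hz1 by (unfold w; ring).
    rewrite E in Hz1. replace (0 + 1)%C with (RtoC 1) in Hz1 by ring. rewrite Cmod_1 in Hz1. lra. }
  assert (Hu0 : u z <> 0%C) by (apply Cmod_gt_0; lra).
  assert (Hq0 : q <> 0%C).
  { unfold q, Cdiv. apply Cmult_neq_0; [exact Hu0|]. intros E. apply (f_equal (fun x => x * du z)%C) in E.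
    rewrite Cinv_l in E by exact Hd0. apply (f_equal Re) in E. simpl in E. lra. }
  assert (Hwp : 0 < Cmod w) by (apply Cmod_gt_0, Hw0). assert (Hqp : 0 < Cmod q) by (apply Cmod_gt_0, Hq0).
  pose proof (Cmod_sub_ge (w / 2) (- q)) as T1. rewrite Cmod_opp, Hhalf in T1.
  replace (w / 2 - - q)%C with (q + w / 2)%C in T1 by ring.
  assert (Hqlo : Cmod w / 4 <= Cmod q) by lra.
  pose proof (Cmod_sub_ge q (- (w / 2))) as T2. rewrite Cmod_opp, Hhalf in T2.
  replace (q - - (w / 2))%C with (q + w / 2)%C in T2 by ring.
  replace (du z ^ 2 / (4 * u z ^ 2))%C with (/ (4 * q ^ 2))%C in Hlast by (unfold q; field; split; assumption).
  (* 1/(4 q^2) - 1/w^2 has numerator (w - 2q)(w + 2q), a linear factor times a cubic one. The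
     constant 60 is 5/2 times 2 times 3 times 4, the last from |q| >= |w| / 4 in the denominator. *)
  replace (u z - / w ^ 2)%C with ((u z - / (4 * q ^ 2)) + (w - 2 * q) * (2 * (q + w / 2)) / (4 * q ^ 2 * w ^ 2))%C by (field; split; assumption).
  apply Rle_trans with (1 := Cmod_triangle _ _). apply Rplus_le_compat; [exact Hlast|].
  assert (H4 : RtoC 4 <> 0%C) by (apply RtoC_neq_0; lra).
  rewrite Cmod_div by (apply Cmult_neq_0; [apply Cmult_neq_0; [exact H4|apply Cpow_nz, Hq0]|apply Cpow_nz, Hw0]).
  rewrite !Cmod_mult, !Cmod_pow, !Cmod_R, (Rabs_right 4), (Rabs_right 2) by lra.
  assert (T3 : Cmod (w - 2 * q)%C <= 5 / 2 * Cmod w).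
  { unfold Cminus. apply Rle_trans with (1 := Cmod_triangle _ _). rewrite Cmod_opp, Cmod_mult, Cmod_R, Rabs_right by lra. lra. }
  set (W := Cmod w) in *. set (Q := Cmod q) in *.
  assert (Hden : W ^ 4 / 4 <= 4 * Q ^ 2 * W ^ 2).
  { replace (W ^ 4 / 4) with (4 * (W / 4) ^ 2 * W ^ 2) by field. apply Rmult_le_compat_r; [apply pow_le; lra|].
    apply Rmult_le_compat_l; [lra|]. apply pow_incr. lra. }
  assert (HW4 : 0 < W ^ 4) by (apply pow_lt; exact Hwp).
  apply Rmult_le_reg_r with (4 * Q ^ 2 * W ^ 2); [lra|].
  unfold Rdiv at 1. rewrite Rmult_assoc, Rinv_l, Rmult_1_r by lra.
  apply Rle_trans with (5 / 2 * W * (2 * (3 * K * W ^ 2 * W))).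
  - apply Rmult_le_compat; [apply Cmod_ge_0|apply Rmult_le_pos; [lra|apply Cmod_ge_0]|exact T3|].
    apply Rmult_le_compat_l; [lra|exact Hq2].
  - apply Rle_trans with (60 * K * (W ^ 4 / 4)); [right; field|]. apply Rmult_le_compat_l; lra.
Qed.

(** * Roots of unity and the Cauchy estimate *)

Definition expi (t : R) : C := (cos t, sin t).

Lemma expi_pow (t : R) (n : nat) : (expi t ^ n)%C = expi (INR n * t).
Proof.
  induction n as [|n IH].
  - unfold expi. rewrite Rmult_0_l, cos_0, sin_0. reflexivity.
  - rewrite Cpow_S, IH, S_INR. replace ((INR n + 1) * t) with (t + INR n * t) by ring.
    unfold expi. rewrite cos_plus, sin_plus. apply injective_projections; simpl; ring.
Qed.

Lemma Cmod_expi (t : R) : Cmod (expi t) = 1.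
Proof.
  unfold Cmod, expi; simpl. replace (cos t * (cos t * 1) + sin t * (sin t * 1)) with 1.
  - apply sqrt_1.
  - pose proof (sin2_cos2 t) as E. unfold Rsqr in E. lra.
Qed.

Lemma expi_surj (x : C) : Cmod x = 1 -> exists t, - PI <= t <= PI /\ x = expi t.
Proof.
  intros Hx. pose proof (Cmod_sqr x) as E. rewrite Hx in E.
  assert (Hre : -1 <= Re x <= 1).
  { pose proof (re_le_Cmod x) as B. rewrite Hx in B. unfold Rabs in B. destruct (Rcase_abs (Re x)); lra. }
  pose proof (acos_bound (Re x)) as Hb. pose proof (cos_acos (Re x) Hre) as Hc.
  assert (Hs : sin (acos (Re x)) = Rabs (Im x)).
  { rewrite sin_acos by exact Hre. rewrite <- sqrt_Rsqr_abs. f_equal. unfold Rsqr. lra. }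
  destruct (Rle_lt_dec 0 (Im x)) as [h|h].
  - exists (acos (Re x)). split; [lra|]. unfold expi. rewrite Hc, Hs, Rabs_right by lra. destruct x; reflexivity.
  - exists (- acos (Re x)). split; [lra|]. unfold expi. rewrite cos_neg, sin_neg, Hc, Hs, Rabs_left by exact h.
    destruct x; simpl. f_equal. ring.
Qed.

Lemma unit_root (x : C) (k : nat) : (0 < k)%nat -> Cmod x = 1 -> exists y, Cmod y = 1 /\ (y ^ k)%C = x.
Proof.
  intros Hk Hx. destruct (expi_surj x Hx) as [t [_ ->]]. exists (expi (t / INR k)).
  split; [apply Cmod_expi|]. rewrite expi_pow. f_equal. field. apply not_0_INR. lia.
Qed.

Lemma expi_neq_1 (a : R) : 0 < a < 2 * PI -> a <> PI -> expi (2 * a) <> 1%C.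
Proof.
  intros Ha Hne E. apply (f_equal Re) in E. simpl in E.
  assert (Hs : sin a <> 0).
  { destruct (Rlt_le_dec a PI); [pose proof (sin_gt_0 a); lra|]. pose proof (sin_lt_0 a). lra. }
  rewrite cos_2a_sin in E. nra.
Qed.

Lemma csum_geom (x : C) (m : nat) : (csum (fun j => x ^ j) m * (x - 1) = x ^ S m - 1)%C.
Proof.
  induction m as [|m IH]; cbn [csum]; [simpl; ring|].
  rewrite Cmult_plus_distr_r, IH. rewrite (Cpow_S _ (S m)). ring.
Qed.

Lemma csum_const_1 (m : nat) : csum (fun _ => 1%C) m = RtoC (INR (S m)).
Proof.
  induction m as [|m IH]; [reflexivity|]. cbn [csum]. rewrite IH, (S_INR (S m)), RtoC_plus. reflexivity.
Qed.

(** Strictly between 0 and 2 (m + 1) the only multiple of m + 1 is m + 1 itself; at any other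
    exponent the ratio differs from 1 and the geometric sum vanishes. The order of the root is [S m]
    because [csum] up to [m] has m + 1 terms. *)
Lemma root_sum (m e : nat) :
  (0 < e < 2 * S m)%nat ->
  csum (fun j => (expi (2 * PI / INR (S m)) ^ e) ^ j)%C m = (if Nat.eqb e (S m) then RtoC (INR (S m)) else 0%C).
Proof.
  intros He. set (N := INR (S m)). assert (HN : 0 < N) by apply lt_0_INR, Nat.lt_0_succ.
  pose proof PI_RGT_0 as Hpi.
  set (x := (expi (2 * PI / N) ^ e)%C).
  assert (HxN : (x ^ S m = 1)%C).
  { unfold x. rewrite <- Cpow_mult_r, Nat.mul_comm, Cpow_mult_r, expi_pow. fold N.
    replace (N * (2 * PI / N)) with (2 * PI) by (field; lra).
    unfold expi. rewrite cos_2PI, sin_2PI. apply Cpow_1_l. }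
  destruct (Nat.eqb_spec e (S m)) as [E|E].
  - assert (Hx : x = 1%C).
    { unfold x. rewrite E, expi_pow. fold N. replace (N * (2 * PI / N)) with (2 * PI) by (field; lra).
      unfold expi. rewrite cos_2PI, sin_2PI. reflexivity. }
    rewrite Hx, (csum_ext _ (fun _ => 1%C)) by (intros; apply Cpow_1_l). apply csum_const_1.
  - assert (Hx : x <> 1%C).
    { unfold x. rewrite expi_pow. replace (INR e * (2 * PI / N)) with (2 * (INR e * PI / N)) by (field; lra).
      destruct He as [He1 He2]. apply lt_INR in He1, He2. rewrite mult_INR in He2. fold N in He2. simpl in He1, He2.
      apply expi_neq_1.
      - split; [apply Rdiv_lt_0_compat; [apply Rmult_lt_0_compat|]; assumption|].
        apply Rlt_div_l; [exact HN|].
        replace (2 * PI * N) with (2 * N * PI) by ring. apply Rmult_lt_compat_r; [exact Hpi|lra].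
      - intros Heq. apply E. apply INR_eq. fold N. apply Rmult_eq_reg_r with (PI / N).
        + replace (N * (PI / N)) with PI by (field; lra). rewrite <- Heq at 2. unfold Rdiv. ring.
        + apply Rgt_not_eq, Rdiv_lt_0_compat; assumption. }
    destruct (Ceq_dec (csum (fun j => x ^ j)%C m) 0) as [h|h]; [exact h|exfalso].
    pose proof (csum_geom x m) as G. rewrite HxN in G. replace (1 - 1)%C with (RtoC 0) in G by ring.
    revert G. apply Cmult_neq_0; [exact h|]. intros G. apply Hx. replace x with (x - 1 + 1)%C by ring. rewrite G. ring.
Qed.

Lemma PC_csum (f : nat -> nat -> C) (m : nat) (s : R) : (forall j, Rad (f j) 1) -> Rabs s < 1 ->
  Rad (fun l => csum (fun j => f j l) m) 1 /\ PC (fun l => csum (fun j => f j l) m) s = csum (fun j => PC (f j) s) m.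
Proof.
  intros H Hs. induction m as [|m [IH1 IH2]]; [split; [apply H|reflexivity]|]. cbn [csum]. split.
  - apply Rad_plus; [exact IH1|apply H].
  - rewrite (PC_plus _ _ 1), IH2; [reflexivity|exact IH1|apply H|exact Hs].
Qed.

Lemma dir_tail_le (h : nat -> R) (N : nat) (r r' : R) : cvr h 1 -> 0 < r < r' -> r' < 1 ->
  PSeries (fun l => if Nat.ltb l N then 0 else Rabs (h l)) r <= (r / r') ^ N * PSeries (fun l => Rabs (h l)) r'.
Proof.
  intros Hh Hr Hr'.
  assert (Ca : cvr (fun l => Rabs (h l)) 1) by (apply cvr_mono with h; [intros; rewrite Rabs_Rabsolu; lra|exact Hh]).
  set (tl := fun l => if Nat.ltb l N then 0 else Rabs (h l)).
  assert (Ht : forall l, 0 <= tl l <= Rabs (h l)) by (intros l; unfold tl; pose proof (Rabs_pos (h l)); destruct Nat.ltb; lra).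
  set (q := r / r'). assert (Hq : 0 < q < 1).
  { unfold q. split; [apply Rdiv_lt_0_compat; lra|]. apply Rlt_div_l; [lra|]. lra. }
  assert (Er : r = q * r') by (unfold q; field; lra).
  rewrite Er at 1. rewrite <- PSeries_comp_scal.
  assert (Hq1 : forall l, 0 <= q ^ l <= 1) by (intros l; split; [apply pow_le; lra|apply pow_le_1; lra]).
  rewrite <- PSeries_scal. apply PSeries_le with 1; [| |lra|].
  - apply cvr_mono with h; [|exact Hh]. intros l. specialize (Ht l). specialize (Hq1 l).
    rewrite Rabs_right by (apply Rle_ge, Rmult_le_pos; lra). fold (tl l). nra.
  - apply cvr_scal, Ca.
  - intros l. unfold PS_scal, scal; simpl. unfold mult; simpl. fold (tl l).
    unfold tl. destruct (Nat.ltb_spec l N) as [h'|h'].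
    + rewrite Rmult_0_r. apply Rmult_le_pos; [apply pow_le; lra|apply Rabs_pos].
    + apply Rmult_le_compat_r; [apply Rabs_pos|].
      replace l with (N + (l - N))%nat by lia. rewrite pow_add. rewrite <- (Rmult_1_r (q ^ N)) at 2.
      apply Rmult_le_compat_l; [apply pow_le; lra|apply Hq1].
Qed.

(** The average over N-th roots of unity isolates the n-th coefficient up to aliases of index at
    least N, whose contribution decays like (r / r')^N. *)
Lemma cauchy_estimate (h : nat -> R) (M : R) : cvr h 1 ->
  (forall x s, Cmod x = 1 -> 0 <= s < 1 -> Cmod (PC (dir h x) s) <= M) -> forall n, Rabs (h n) <= M.
Proof.
  intros Hh HM n.
  replace (Rabs (h n)) with (Rabs (h n) * 1 ^ n) by (rewrite pow1; ring).
  apply (le_at_left_endpoint (fun s => Rabs (h n) * s ^ n) 1 1); [auto_derive; trivial|lra|].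
  intros r Hr. assert (Hr0 : 0 < r < 1) by lra. assert (Hra : Rabs r < 1) by (rewrite Rabs_right; lra).
  set (r' := (r + 1) / 2). assert (Hr' : r < r' < 1) by (unfold r'; lra).
  set (S0 := PSeries (fun l => Rabs (h l)) r').
  assert (Key : forall m, (n <= m)%nat -> Rabs (h n) * r ^ n <= M + (r / r') ^ S m * S0).
  { intros m Hm. set (N := S m). set (z := expi (2 * PI / INR N)).
    assert (HN : 0 < INR N) by apply lt_0_INR, Nat.lt_0_succ.
    assert (Hz : forall j, Cmod (z ^ j)%C = 1) by (intros j; unfold z; rewrite Cmod_pow, Cmod_expi; apply pow1).
    (* The factor z^(j (N - n)) stands for z^(-j n) with a natural exponent; for l < N the total N -
       n + l stays in the range of [root_sum]. *)
    set (f := fun j l => ((z ^ j) ^ (N - n) * dir h (z ^ j)%C l)%C).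
    assert (Rf : forall j, Rad (f j) 1) by (intros j; apply Rad_scal, Rad_dir; [apply Hz|exact Hh]).
    destruct (PC_csum f m r Rf Hra) as [R1 E1].
    assert (Ef : forall l, csum (fun j => f j l) m = (RtoC (h l) * csum (fun j => (z ^ (N - n + l)) ^ j) m)%C).
    { intros l. rewrite <- csum_scal. apply csum_ext. intros j _. unfold f, dir.
      rewrite <- !Cpow_mult_r. replace (z ^ ((N - n + l) * j))%C with (z ^ (j * (N - n)) * z ^ (j * l))%C by (rewrite <- Cpow_add_r; f_equal; lia). ring. }
    set (rest := (fun l => if Nat.ltb l N then RtoC 0 else csum (fun j => f j l) m)).
    assert (Esplit : forall l, csum (fun j => f j l) m = ((if Nat.eqb l n then RtoC (INR N * h n) else 0) + rest l)%C).
    { intros l. unfold rest. destruct (Nat.ltb_spec l N) as [hl|hl].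
      - rewrite Ef. unfold z, N. rewrite root_sum by (unfold N in *; lia).
        destruct (Nat.eqb_spec l n) as [->|e].
        + destruct (Nat.eqb_spec (S m - n + n) (S m)); [|lia]. rewrite RtoC_mult. ring.
        + destruct (Nat.eqb_spec (S m - n + l) (S m)); [unfold N in *; lia|]. ring.
      - destruct (Nat.eqb_spec l n); [unfold N in *; lia|]. ring. }
    assert (Hrest : forall l, Cmod (rest l) <= INR N * (if Nat.ltb l N then 0 else Rabs (h l))).
    { intros l. unfold rest. destruct (Nat.ltb l N); [rewrite Cmod_0; lra|].
      rewrite Ef, Cmod_mult, Cmod_R, Rmult_comm. apply Rmult_le_compat_r; [apply Rabs_pos|].
      apply Rle_trans with (1 := Cmod_csum _ _).
      rewrite (sum_eq _ (fun _ => 1)) by (intros j _; rewrite <- Cpow_mult_r; apply Hz). rewrite sum_cte. unfold N. lra. }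
    assert (Ctl : cvr (fun l => INR N * (if Nat.ltb l N then 0 else Rabs (h l))) 1).
    { apply cvr_scal, cvr_mono with h; [|exact Hh]. intros l. destruct (Nat.ltb l N); [rewrite Rabs_R0; apply Rabs_pos|rewrite Rabs_Rabsolu; lra]. }
    assert (Rrest : Rad rest 1).
    { apply Rad_mono with (fun l => RtoC (INR N * (if Nat.ltb l N then 0 else Rabs (h l)))).
      - intros l. rewrite Cmod_R. apply Rle_trans with (2 := Rle_abs _). apply Hrest.
      - apply Rad_of_bound. intros t Ht. destruct (bound_of_cvr _ 1 t Ctl Ht) as [B HB]. exists B. intros l. rewrite Cmod_R. apply HB. }
    assert (E2 : PC (fun l => csum (fun j => f j l) m) r = (RtoC (INR N * h n) * RtoC r ^ n + PC rest r)%C).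
    { rewrite (PC_ext _ _ r Esplit), (PC_plus _ _ 1), PC_single; [reflexivity|apply Rad_single|exact Rrest|exact Hra]. }
    assert (B1 : Cmod (PC (fun l => csum (fun j => f j l) m) r) <= INR N * M).
    { rewrite E1. apply Rle_trans with (1 := Cmod_csum _ _).
      apply Rle_trans with (sum_f_R0 (fun _ => M) m); [|rewrite sum_cte; unfold N; lra].
      apply sum_Rle. intros j _. unfold f. rewrite (PC_scal _ _ 1); [|apply Rad_dir; [apply Hz|exact Hh]|exact Hra].
      rewrite Cmod_mult, <- Cpow_mult_r, Hz, Rmult_1_l. apply HM; [apply Hz|lra]. }
    assert (B2 : Cmod (PC rest r) <= INR N * ((r / r') ^ N * S0)).
    { apply Rle_trans with (PSeries (fun l => INR N * (if Nat.ltb l N then 0 else Rabs (h l))) r).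
      - apply Cmod_PC_le with 1; [exact Rrest|exact Ctl|lra|exact Hrest].
      - assert (Es : PSeries (fun l => INR N * (if Nat.ltb l N then 0 else Rabs (h l))) r = INR N * PSeries (fun l => if Nat.ltb l N then 0 else Rabs (h l)) r) by apply PSeries_scal.
        rewrite Es. apply Rmult_le_compat_l; [lra|]. apply dir_tail_le; [exact Hh|lra|lra]. }
    pose proof (Cmod_sub_ge (RtoC (INR N * h n) * RtoC r ^ n) (- PC rest r)) as T. rewrite Cmod_opp in T.
    replace (RtoC (INR N * h n) * RtoC r ^ n - - PC rest r)%C with (RtoC (INR N * h n) * RtoC r ^ n + PC rest r)%C in T by ring.
    rewrite <- E2 in T. rewrite Cmod_mult, Cmod_pow, !Cmod_R, Rabs_mult, (Rabs_right (INR N)), (Rabs_right r) in T by lra.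
    apply Rmult_le_reg_l with (INR N); [exact HN|]. rewrite Rmult_plus_distr_l. fold N. lra. }
  apply Rnot_lt_le. intros Hlt. set (eps := Rabs (h n) * r ^ n - M).
  assert (Hq : 0 < r / r' < 1).
  { split; [apply Rdiv_lt_0_compat; lra|]. apply Rlt_div_l; [lra|]. lra. }
  assert (HS0 : 0 < Rabs S0 + 1) by (pose proof (Rabs_pos S0); lra).
  destruct (pow_lt_1_zero (r / r') ltac:(rewrite Rabs_right; lra) (eps / (Rabs S0 + 1)) ltac:(apply Rdiv_lt_0_compat; unfold eps; lra)) as [N0 HN0].
  set (m := Nat.max n N0). specialize (Key m ltac:(lia)). specialize (HN0 (S m) ltac:(lia)).
  assert (Hp : 0 <= (r / r') ^ S m) by (apply pow_le; lra). rewrite Rabs_right in HN0 by lra.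
  pose proof (Rle_abs S0) as Ha.
  assert ((r / r') ^ S m * S0 <= (r / r') ^ S m * (Rabs S0 + 1)) by (apply Rmult_le_compat_l; lra).
  apply (Rmult_lt_compat_r (Rabs S0 + 1)) in HN0; [|exact HS0].
  replace (eps / (Rabs S0 + 1) * (Rabs S0 + 1)) with eps in HN0 by (field; lra).
  unfold eps in *. lra.
Qed.

(** * The singular part *)

Definition mult_of (k n : nat) : R := if Nat.eqb (n mod k) 0 then 1 else 0.

Lemma cvr_mult_of (k : nat) : cvr (mult_of k) 1.
Proof.
  apply cvr_of_bound. intros r Hr. exists 1. intros n.
  assert (0 <= r ^ n <= 1) by (split; [apply pow_le; lra|apply pow_le_1; lra]).
  unfold mult_of. destruct Nat.eqb; rewrite ?Rabs_R1, ?Rabs_R0; lra.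
Qed.

(* Coefficients of the sum of [z ^ 2 / (z - xi) ^ 2 - 1] over the k-th roots of unity [xi]. *)
Definition sing (k n : nat) : R := (INR n - 1) * (INR k * mult_of k n).

Lemma cvr_sing (k : nat) : cvr (sing k) 1.
Proof. apply cvr_euler, cvr_scal, cvr_mult_of. Qed.

Lemma mult_of_shift (k n : nat) : mult_of k (n + k) = mult_of k n.
Proof.
  unfold mult_of. replace (n + k)%nat with (n + 1 * k)%nat by lia. rewrite Nat.Div0.mod_add. reflexivity.
Qed.

Lemma mult_of_low (k n : nat) : (0 < n < k)%nat -> mult_of k n = 0.
Proof. intros H. unfold mult_of. rewrite Nat.mod_small by lia. destruct (Nat.eqb_spec n 0); [lia|reflexivity]. Qed.

Lemma mult_of_0 (k : nat) : mult_of k 0 = 1.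
Proof. unfold mult_of. rewrite Nat.Div0.mod_0_l. reflexivity. Qed.

Lemma conv_single (k : nat) (x : C) (d : nat -> C) (n : nat) :
  conv (fun j => if Nat.eqb j k then x else 0%C) d n = (if Nat.leb k n then x * d (n - k)%nat else 0)%C.
Proof.
  unfold conv.
  assert (G : forall m, csum (fun j => (if Nat.eqb j k then x else 0) * d (n - j)%nat)%C m = (if Nat.leb k m then x * d (n - k)%nat else 0)%C).
  { induction m as [|m IH]; cbn [csum].
    - destruct (Nat.eqb_spec 0 k) as [<-|e]; [reflexivity|]. destruct (Nat.leb_spec k 0); [lia|]. ring.
    - rewrite IH. destruct (Nat.eqb_spec (S m) k) as [e|e].
      + destruct (Nat.leb_spec k m); [lia|]. destruct (Nat.leb_spec k (S m)); [|lia]. rewrite e. ring.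
      + destruct (Nat.leb_spec k m); destruct (Nat.leb_spec k (S m)); try lia; ring. }
  apply G.
Qed.

Lemma PC_shift (k : nat) (x c0 : C) (c d : nat -> C) (s : R) : Rad d 1 -> Rabs s < 1 ->
  (forall n, c n = ((if Nat.eqb n 0 then c0 else 0) + (if Nat.leb k n then x * d (n - k)%nat else 0))%C) ->
  PC c s = (c0 + x * RtoC s ^ k * PC d s)%C.
Proof.
  intros Hd Hs Hc.
  rewrite (PC_ext c (fun n => (if Nat.eqb n 0 then c0 else 0) + conv (fun j => if Nat.eqb j k then x else 0%C) d n)%C).
  - rewrite (PC_plus _ _ 1); [|apply Rad_single|apply Rad_conv; [apply Rad_single|exact Hd]|exact Hs].
    rewrite (PC_conv _ _ 1); [|apply Rad_single|exact Hd|exact Hs].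
    rewrite (PC_single 0 c0), (PC_single k x). change (RtoC s ^ 0)%C with (RtoC 1). ring.
  - intros n. rewrite conv_single. apply Hc.
Qed.

(** Periodicity of [mult_of] gives T = 1 + t T and S = -k + t (S + k^2 T) for the sums T of
    [mult_of] and S of [sing]; these equations are then solved. *)
Lemma sing_value (k : nat) (x : C) (s : R) : (0 < k)%nat -> Cmod x = 1 -> 0 <= s < 1 ->
  let t := (x ^ k * RtoC s ^ k)%C in
  (1 - t)%C <> 0%C /\
  PC (dir (sing k) x) s = ((RtoC (INR k) ^ 2 * t - RtoC (INR k) * (1 - t)) / (1 - t) ^ 2)%C.
Proof.
  intros Hk Hx Hs t. assert (Hsa : Rabs s < 1) by (rewrite Rabs_right; lra).
  assert (Ht : Cmod t < 1).
  { unfold t. rewrite Cmod_mult, !Cmod_pow, Hx, pow1, Cmod_R, Rabs_right by lra.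
    destruct k as [|k]; [lia|]. simpl. assert (0 <= s ^ k <= 1) by (split; [apply pow_le; lra|apply pow_le_1; lra]). nra. }
  assert (Hne : (1 - t)%C <> 0%C).
  { intros E. assert (Et : t = 1%C) by (replace t with (1 - (1 - t))%C by ring; rewrite E; ring). rewrite Et, Cmod_1 in Ht. lra. }
  split; [exact Hne|].
  assert (RT : Rad (dir (mult_of k) x) 1) by (apply Rad_dir; [exact Hx|apply cvr_mult_of]).
  assert (RS : Rad (dir (sing k) x) 1) by (apply Rad_dir; [exact Hx|apply cvr_sing]).
  assert (ET : PC (dir (mult_of k) x) s = (1 + x ^ k * RtoC s ^ k * PC (dir (mult_of k) x) s)%C).
  { apply PC_shift; [exact RT|exact Hsa|]. intros n. unfold dir.
    destruct (Nat.leb_spec k n) as [l|l].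
    - destruct (Nat.eqb_spec n 0); [lia|]. rewrite <- (mult_of_shift k (n - k)). replace (n - k + k)%nat with n by lia.
      replace (x ^ n)%C with (x ^ k * x ^ (n - k))%C by (rewrite <- Cpow_add_r; f_equal; lia). ring.
    - destruct (Nat.eqb_spec n 0) as [->|]; [rewrite mult_of_0; simpl; ring|]. rewrite mult_of_low by lia. ring. }
  assert (ES : PC (dir (sing k) x) s = (- RtoC (INR k) + x ^ k * RtoC s ^ k * PC (fun n => dir (sing k) x n + RtoC (INR k) ^ 2 * dir (mult_of k) x n)%C s)%C).
  { apply PC_shift; [apply Rad_plus; [exact RS|apply Rad_scal, RT]|exact Hsa|]. intros n. unfold dir, sing.
    destruct (Nat.leb_spec k n) as [l|l].
    - destruct (Nat.eqb_spec n 0); [lia|]. rewrite <- (mult_of_shift k (n - k)). replace (n - k + k)%nat with n by lia.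
      replace (x ^ n)%C with (x ^ k * x ^ (n - k))%C by (rewrite <- Cpow_add_r; f_equal; lia).
      rewrite minus_INR by exact l. rewrite !RtoC_mult, !RtoC_minus. ring.
    - destruct (Nat.eqb_spec n 0) as [->|]; [rewrite mult_of_0; simpl; rewrite !RtoC_mult, RtoC_minus; ring|]. rewrite mult_of_low by lia.
      rewrite !Rmult_0_r. ring. }
  rewrite (PC_plus _ _ 1), (PC_scal _ _ 1) in ES; try assumption; [|apply Rad_scal, RT].
  fold t in ET, ES. set (T := PC (dir (mult_of k) x) s) in *. set (Sg := PC (dir (sing k) x) s) in *.
  assert (HT : T = (/ (1 - t))%C).
  { replace T with ((T - t * T) / (1 - t))%C by (field; exact Hne). rewrite ET at 1. field. exact Hne. }
  replace Sg with ((Sg - t * Sg) / (1 - t))%C by (field; exact Hne). rewrite ES at 1. rewrite HT. field. exact Hne.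
Qed.

Lemma Cmod_horner (a B : R) (z w : C) : 0 <= a -> Cmod z <= 1 -> Cmod w <= B -> Cmod (RtoC a + z * w)%C <= a + B.
Proof.
  intros Ha Hz Hw. apply Rle_trans with (1 := Cmod_triangle _ _). rewrite Cmod_R, Cmod_mult, Rabs_right by lra.
  pose proof (Cmod_ge_0 w). pose proof (Cmod_ge_0 z). nra.
Qed.

Lemma Cmod_pow_minus_1 (z : C) (n : nat) : Cmod z <= 1 -> Cmod (z ^ n - 1)%C <= INR n * Cmod (z - 1)%C.
Proof.
  intros Hz. induction n as [|n IH].
  - simpl. replace (1 - 1)%C with (RtoC 0) by ring. rewrite Cmod_0. lra.
  - rewrite Cpow_S, S_INR. replace (z * z ^ n - 1)%C with (z * (z ^ n - 1) + (z - 1))%C by ring.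
    apply Rle_trans with (1 := Cmod_triangle _ _). rewrite Cmod_mult.
    pose proof (Cmod_ge_0 (z ^ n - 1)%C). pose proof (Cmod_ge_0 z). nra.
Qed.

(* With [1 - z^k = (1 - z) P], both terms are rational and their double poles at 1 cancel:
   the difference is [Q / P^2] for an explicit polynomial [Q] with positive coefficients. *)
Lemma sing_near_pole (k : nat) (z : C) : (4 <= k <= 6)%nat -> Cmod z < 1 -> Cmod (z - 1)%C < 1 / 10 ->
  Cmod (z ^ 2 / (z - 1) ^ 2 - (RtoC (INR k) ^ 2 * z ^ k - RtoC (INR k) * (1 - z ^ k)) / (1 - z ^ k) ^ 2)%C <= 231.
Proof.
  intros Hk Hz Hz1.
  assert (Hw : (z - 1)%C <> 0%C).
  { intros E. assert (Ez : z = 1%C) by (replace z with (z - 1 + 1)%C by ring; rewrite E; ring). rewrite Ez, Cmod_1 in Hz. lra. }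
  assert (G : forall P Q : C, (1 - z ^ k = (1 - z) * P)%C ->
     (z ^ 2 * P ^ 2 - (RtoC (INR k) ^ 2 * z ^ k - RtoC (INR k) * (1 - z ^ k)) = (1 - z) ^ 2 * Q)%C ->
     1 <= Cmod P -> Cmod Q <= 231 ->
     Cmod (z ^ 2 / (z - 1) ^ 2 - (RtoC (INR k) ^ 2 * z ^ k - RtoC (INR k) * (1 - z ^ k)) / (1 - z ^ k) ^ 2)%C <= 231).
  { intros P Q EP EQ HP HQ. assert (HP0 : P <> 0%C) by (apply Cmod_gt_0; lra).
    set (X := (RtoC (INR k) ^ 2 * z ^ k - RtoC (INR k) * (1 - z ^ k))%C) in *. rewrite EP.
    assert (Hw' : (1 - z)%C <> 0%C) by (intros E; apply Hw; replace (z - 1)%C with (- (1 - z))%C by ring; rewrite E; ring).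
    replace (z ^ 2 / (z - 1) ^ 2 - X / ((1 - z) * P) ^ 2)%C with ((z ^ 2 * P ^ 2 - X) / ((1 - z) ^ 2 * P ^ 2))%C.
    2:{ replace ((z - 1) ^ 2)%C with ((1 - z) ^ 2)%C by ring. field. split; assumption. }
    rewrite EQ. replace ((1 - z) ^ 2 * Q / ((1 - z) ^ 2 * P ^ 2))%C with (Q / P ^ 2)%C by (field; split; assumption).
    rewrite Cmod_div by (apply Cpow_nz, HP0). rewrite Cmod_pow. assert (1 <= Cmod P ^ 2) by (simpl; nra).
    apply Rle_div_l; [lra|]. nra. }
  (* P(1) = k, and |P - k| is at most (1 + ... + (k - 1)) |z - 1|, hence at most 15/10; 15 is the
     sum for k = 6. *)
  assert (HP : forall m n (P : C), INR n <= 15 -> 4 <= m -> Cmod (P - RtoC m)%C <= INR n * Cmod (z - 1)%C -> 1 <= Cmod P).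
  { intros m n P Hn Hm HPm. pose proof (Cmod_sub_ge (RtoC m) (RtoC m - P)) as T.
    replace (RtoC m - (RtoC m - P))%C with P in T by ring. rewrite (Cmod_minus_sym (RtoC m) P), Cmod_R, Rabs_right in T by lra.
    pose proof (Cmod_ge_0 (z - 1)%C). nra. }
  assert (Hpow : forall n, Cmod (z ^ n - 1)%C <= INR n * Cmod (z - 1)%C) by (intros n; apply Cmod_pow_minus_1; lra).
  assert (Hadd : forall (A B : C) (x y : R), Cmod A <= x -> Cmod B <= y -> Cmod (A + B)%C <= x + y).
  { intros A B x y HA HB. apply Rle_trans with (1 := Cmod_triangle _ _). lra. }
  assert (H1 : Cmod (RtoC 1) <= 1) by (rewrite Cmod_1; lra).
  pose proof (Hpow 1%nat) as p1. pose proof (Hpow 2%nat) as p2. pose proof (Hpow 3%nat) as p3. pose proof (Hpow 4%nat) as p4. pose proof (Hpow 5%nat) as p5.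
  simpl INR in p1, p2, p3, p4, p5.
  assert (Hk' : k = 4%nat \/ k = 5%nat \/ k = 6%nat) by lia.
  destruct Hk' as [->|[->| ->]];
    [replace (INR 4) with 4 in * by (simpl; ring)|replace (INR 5) with 5 in * by (simpl; ring)|replace (INR 6) with 6 in * by (simpl; ring)].
  - apply (G (1 + z + z ^ 2 + z ^ 3)%C (4 + z * (8 + z * (13 + z * (20 + z * (10 + z * (4 + z * 1))))))%C).
    + ring.
    + ring.
    + apply (HP 4 6%nat); [simpl; lra|lra|].
      replace (1 + z + z ^ 2 + z ^ 3 - 4)%C with ((z ^ 1 - 1) + (z ^ 2 - 1) + (z ^ 3 - 1))%C by ring.
      eapply Rle_trans; [apply Hadd; [apply Hadd; [exact p1|exact p2]|exact p3]|]. simpl. lra.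
    + eapply Rle_trans; [repeat (apply Cmod_horner; [lra|lra|]); exact H1|]. lra.
  - apply (G (1 + z + z ^ 2 + z ^ 3 + z ^ 4)%C (5 + z * (10 + z * (16 + z * (24 + z * (35 + z * (20 + z * (10 + z * (4 + z * 1))))))))%C).
    + ring.
    + ring.
    + apply (HP 5 10%nat); [simpl; lra|lra|].
      replace (1 + z + z ^ 2 + z ^ 3 + z ^ 4 - 5)%C with ((z ^ 1 - 1) + (z ^ 2 - 1) + (z ^ 3 - 1) + (z ^ 4 - 1))%C by ring.
      eapply Rle_trans; [apply Hadd; [apply Hadd; [apply Hadd; [exact p1|exact p2]|exact p3]|exact p4]|]. simpl. lra.
    + eapply Rle_trans; [repeat (apply Cmod_horner; [lra|lra|]); exact H1|]. lra.
  - apply (G (1 + z + z ^ 2 + z ^ 3 + z ^ 4 + z ^ 5)%C (6 + z * (12 + z * (19 + z * (28 + z * (40 + z * (56 + z * (35 + z * (20 + z * (10 + z * (4 + z * 1))))))))))%C).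
    + ring.
    + ring.
    + apply (HP 6 15%nat); [simpl; lra|lra|].
      replace (1 + z + z ^ 2 + z ^ 3 + z ^ 4 + z ^ 5 - 6)%C with ((z ^ 1 - 1) + (z ^ 2 - 1) + (z ^ 3 - 1) + (z ^ 4 - 1) + (z ^ 5 - 1))%C by ring.
      eapply Rle_trans; [apply Hadd; [apply Hadd; [apply Hadd; [apply Hadd; [exact p1|exact p2]|exact p3]|exact p4]|exact p5]|]. simpl. lra.
    (* The sum of these coefficients is 231, the largest of the three cases. *)
    + eapply Rle_trans; [repeat (apply Cmod_horner; [lra|lra|]); exact H1|]. lra.
Qed.

(** * Coefficient asymptotics *)

Lemma Cmod_expi_minus_1 (a : R) : Cmod (expi a - 1)%C <= Rabs a.
Proof.
  pose proof (cder_mean_value (fun t => expi (t * a)) (fun t => RtoC a * (Ci * expi (t * a)))%C 0 1 (Rabs a) ltac:(lra)) as B.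
  cbv beta in B. rewrite Rmult_1_l, Rmult_0_l in B. replace (expi 0) with (RtoC 1) in B by (unfold expi; rewrite cos_0, sin_0; reflexivity).
  rewrite <- (Rmult_1_r (Rabs a)). replace (Rabs a * 1) with (Rabs a * (1 - 0)) by ring. apply B.
  intros t _. split.
  - split.
    + apply (is_derive_ext (fun t => cos (t * a))); [reflexivity|]. auto_derive; [trivial|]. simpl. ring.
    + apply (is_derive_ext (fun t => sin (t * a))); [reflexivity|]. auto_derive; [trivial|]. simpl. ring.
  - rewrite !Cmod_mult, Cmod_R, Cmod_Ci, Cmod_expi. lra.
Qed.

(** Rotating by [x] turns the ray into the positive axis, where [ray_series] applies. *)
Lemma ray_dir (g lam : C) (u du : C -> C) (c : nat -> C) (b : nat -> R) (x : C) (s : R) :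
  sol g lam u du c -> (forall n, c n = RtoC (b n)) -> cvr b 1 ->
  (forall z : C, z <> 0%C -> Cmod z < 1 -> ~ pole u z) -> Cmod x = 1 -> 0 < s < 1 ->
  PC (dir b x) s = ((x * RtoC s) ^ 2 * u (x * RtoC s))%C.
Proof.
  intros H Hcb Hb Hnp Hx Hs.
  assert (Hx0 : x <> 0%C) by (apply Cmod_gt_0; lra).
  pose proof (sol_scale g lam u du c x Hx0 H) as Hsc.
  assert (Ec : forall n, (x ^ n * c n)%C = dir b x n) by (intros n; rewrite Hcb; unfold dir; ring).
  assert (Rs : Rad (fun n => x ^ n * c n)%C 1).
  { apply (Rad_ext (dir b x)); [intros n; symmetry; apply Ec|]. apply Rad_dir; assumption. }
  pose proof (ray_series _ _ _ _ _ 1 Hsc Rs) as Hray. cbv beta in Hray.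
  rewrite <- (PC_ext _ _ s Ec).
  assert (E : (x ^ 2 * u (x * RtoC s) = PC (fun n => x ^ n * c n) s / RtoC (s ^ 2))%C).
  { apply Hray; [|exact Hs]. intros r Hr. rewrite (pole_scale u (x ^ 2)%C x) by (try apply Cpow_nz; exact Hx0).
    apply Hnp.
    - apply Cmult_neq_0; [exact Hx0|apply RtoC_neq_0; lra].
    - rewrite Cmod_mult, Hx, Cmod_R, Rabs_right; lra. }
  replace ((x * RtoC s) ^ 2 * u (x * RtoC s))%C with (RtoC s ^ 2 * (x ^ 2 * u (x * RtoC s)))%C by ring.
  rewrite E, RtoC_pow. field. apply RtoC_neq_0. lra.
Qed.

(** Only powers x^(k m) have non-zero coefficients, so a point near any k-th root of unity can be
    exchanged for one near 1. *)
Lemma dir_same_power (k : nat) (b : nat -> R) (x y : C) (n : nat) :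
  pos_coeffs k b -> (x ^ k = y ^ k)%C -> dir b x n = dir b y n.
Proof.
  intros H E. unfold dir. pose proof (pc_k _ _ H). destruct (Nat.eq_dec (n mod k) 0) as [e|e].
  - apply Nat.Div0.mod_divides in e. destruct e as [m ->]. rewrite !Cpow_mult_r, E. reflexivity.
  - rewrite (pc_div _ _ H n e). ring.
Qed.

(** The difference from the singular part is bounded separately off the rays x^k = 1, at radii up to
    [rho], and in the remaining sectors, which the k-fold symmetry reduces to a neighbourhood of 1
    where the double poles cancel. *)
Lemma pos_coeffs_asymptotics (g lam : C) (u du : C -> C) (c : nat -> C) (k : nat) (b : nat -> R) :
  sol g lam u du c -> (forall n, c n = RtoC (b n)) -> pos_coeffs k b -> cvr b 1 ->
  (forall z : C, z <> 0%C -> Cmod z < 1 -> ~ pole u z) -> pole u 1%C ->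
  exists M, forall n, Rabs (b n - sing k n) <= M.
Proof.
  intros H Hcb Hp Hb Hnp Hpole.
  destruct (double_pole_bound g lam u du c H Hpole) as (r & M0 & Hr & HM0).
  set (d := Rmin r (1 / 10)). assert (Hd : 0 < d <= 1 / 10) by (split; [apply Rmin_pos; lra|apply Rmin_r]).
  assert (Hdr : d <= r) by apply Rmin_l.
  pose proof PI_RGT_0 as Hpi. pose proof PI2_1 as Hpi2. unfold PI2 in Hpi2.
  pose proof (pc_k _ _ Hp) as Hk.
  (* Re (x^k) > 1 - eta then says that the argument of x^k is smaller than d/2 in absolute value. *)
  set (eta := 1 - cos (d / 2)).
  assert (Heta : 0 < eta).
  { unfold eta. rewrite <- cos_0. assert (cos (d / 2) < cos 0); [|lra]. apply cos_decreasing_1; lra. }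
  assert (Heta1 : eta <= 1).
  { unfold eta. assert (0 <= cos (d / 2)); [|lra]. apply cos_ge_0; lra. }
  destruct (away_bound k b Hp Hb eta Heta) as [M1 HM1].
  set (rho := 1 - d / 2). set (M2 := PSeries b rho).
  set (K := INR k). assert (HK : 4 <= K <= 6).
  { unfold K. split; [replace 4 with (INR 4) by (simpl; ring)|replace 6 with (INR 6) by (simpl; ring)]; apply le_INR; lia. }
  (* The numerator of the closed form for the singular part is at most K^2 + 2 K, because |t| <= 1
     and |1 - t| <= 2. *)
  set (Bs := fun e : R => (K ^ 2 + K * 2) / e ^ 2).
  set (M := Rabs M0 + 231 + Rabs M1 + Rabs M2 + Bs eta + Bs (d / 2)).
  assert (HBs : forall e, 0 < e -> 0 <= Bs e).
  { intros e He. unfold Bs. apply Rmult_le_pos; [simpl; nra|]. left. apply Rinv_0_lt_compat, pow_lt, He. }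
  pose proof (HBs eta Heta) as Hbs1. pose proof (HBs (d / 2) ltac:(lra)) as Hbs2.
  pose proof (Rabs_pos M0). pose proof (Rabs_pos M1). pose proof (Rabs_pos M2).
  pose proof (Rle_abs M0). pose proof (Rle_abs M1). pose proof (Rle_abs M2).
  set (h := fun n => b n - sing k n).
  assert (Ch : cvr h 1).
  { apply (cvr_ext (fun n => b n + -1 * sing k n)); [intros n; unfold h; ring|]. apply cvr_plus; [exact Hb|apply cvr_scal, cvr_sing]. }
  exists M. apply (cauchy_estimate h M Ch). intros x s Hx Hs.
  assert (Hsa : Rabs s < 1) by (rewrite Rabs_right; lra).
  assert (Eh : PC (dir h x) s = (PC (dir b x) s - PC (dir (sing k) x) s)%C).
  { rewrite (PC_ext _ (fun n => dir b x n + -1 * dir (sing k) x n)%C).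
    - assert (R1 : Rad (dir b x) 1) by (apply Rad_dir; [exact Hx|exact Hb]).
      assert (R2 : Rad (dir (sing k) x) 1) by (apply Rad_dir; [exact Hx|apply cvr_sing]).
      rewrite (PC_plus _ _ 1); [|exact R1|apply Rad_scal, R2|exact Hsa].
      rewrite (PC_scal _ _ 1); [|exact R2|exact Hsa]. ring.
    - intros n. unfold dir, h. rewrite RtoC_minus. ring. }
  destruct (sing_value k x s ltac:(lia) Hx Hs) as [Ht Es]. set (t := (x ^ k * RtoC s ^ k)%C) in *.
  assert (Hsk : 0 <= s ^ k <= s).
  { split; [apply pow_le; lra|]. destruct k as [|k']; [lia|]. simpl.
    assert (0 <= s ^ k' <= 1) by (split; [apply pow_le; lra|apply pow_le_1; lra]). nra. }
  assert (Htm : Cmod t = s ^ k).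
  { unfold t. rewrite Cmod_mult, !Cmod_pow, Hx, pow1, Cmod_R, Rabs_right by lra. ring. }
  assert (Hsing : forall e, 0 < e -> e <= Cmod (1 - t)%C -> Cmod (PC (dir (sing k) x) s) <= Bs e).
  { intros e He Hle. rewrite Es. rewrite Cmod_div by (apply Cpow_nz, Ht). rewrite Cmod_pow. fold K. unfold Bs.
    assert (Hnum : Cmod (RtoC K ^ 2 * t - RtoC K * (1 - t))%C <= K ^ 2 + K * 2).
    { unfold Cminus at 1. apply Rle_trans with (1 := Cmod_triangle _ _). rewrite Cmod_opp, !Cmod_mult, Cmod_pow, Cmod_R, Rabs_right, Htm by lra.
      assert (Cmod (1 - t)%C <= 2).
      { apply Rle_trans with (1 := Cmod_triangle _ _). rewrite Cmod_opp, Cmod_1. lra. }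
      apply Rplus_le_compat; [|apply Rmult_le_compat_l; lra]. rewrite <- (Rmult_1_r (K ^ 2)) at 2. apply Rmult_le_compat_l; [simpl; nra|lra]. }
    assert (He2 : 0 < e ^ 2) by (apply pow_lt, He). assert (Hle2 : e ^ 2 <= Cmod (1 - t)%C ^ 2) by (apply pow_incr; lra).
    unfold Rdiv. apply Rmult_le_compat; [apply Cmod_ge_0|left; apply Rinv_0_lt_compat; lra|exact Hnum|].
    apply Rinv_le_contravar; assumption. }
  assert (Htri : Cmod (PC (dir h x) s) <= Cmod (PC (dir b x) s) + Cmod (PC (dir (sing k) x) s)).
  { rewrite Eh. apply Rle_trans with (1 := Cmod_triangle _ _). rewrite Cmod_opp. lra. }
  destruct (Rle_lt_dec (Re (x ^ k)%C) (1 - eta)) as [c1|c1].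
  { assert (Hle : eta <= Cmod (1 - t)%C).
    { apply Rle_trans with (2 := re_le_Cmod _). apply Rle_trans with (2 := Rle_abs _).
      unfold t. rewrite <- RtoC_pow. unfold Cminus. rewrite Re_plus.
      replace (Re (- (x ^ k * RtoC (s ^ k)))%C) with (- (Re (x ^ k)%C * s ^ k)) by (simpl; unfold Re; ring).
      simpl (Re (RtoC 1)). destruct (Rle_lt_dec (Re (x ^ k)%C) 0); nra. }
    specialize (HM1 x s Hx c1 Hs). specialize (Hsing eta Heta Hle). unfold M. lra. }
  destruct (Rle_lt_dec s rho) as [c2|c2].
  { assert (Hle : d / 2 <= Cmod (1 - t)%C).
    { pose proof (Cmod_sub_ge 1 t) as T. rewrite Cmod_1, Htm in T. unfold rho in c2. lra. }
    specialize (Hsing (d / 2) ltac:(lra) Hle).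
    assert (Cmod (PC (dir b x) s) <= M2).
    { apply Rle_trans with (PSeries b s).
      - apply Cmod_PC_le with 1; [apply Rad_dir; assumption|exact Hb|lra|]. intros n. rewrite Cmod_dir by exact Hx.
        rewrite Rabs_right; [lra|apply Rle_ge, (pc_pos _ _ Hp)].
      - apply PSeries_mono; [exact Hb|apply (pc_pos _ _ Hp)|lra|unfold rho; lra]. }
    unfold M. lra. }
  destruct (expi_surj (x ^ k)%C) as [th [Hth Eth]]; [rewrite Cmod_pow, Hx; apply pow1|].
  (* [y] is the k-th root of x^k nearest to 1. Its argument is at most (d/2) / 4, so y s lies within
     d/8 + d/2 of 1. *)
  set (y := expi (th / K)). set (z := (y * RtoC s)%C).
  assert (Hy : Cmod y = 1) by apply Cmod_expi.
  assert (Eyk : (x ^ k = y ^ k)%C).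
  { rewrite Eth. unfold y. rewrite expi_pow. fold K. f_equal. field. lra. }
  assert (Hrho : 0 < rho) by (unfold rho; lra).
  assert (Hthd : Rabs th < d / 2).
  { apply Rnot_le_lt. intros Hge. rewrite Eth in c1. simpl in c1. unfold eta in c1.
    assert (Ecos : cos th = cos (Rabs th)).
    { unfold Rabs. destruct (Rcase_abs th); [rewrite cos_neg|]; reflexivity. }
    assert (cos (Rabs th) <= cos (d / 2)); [|lra].
    assert (Rabs th <= PI) by (apply Rabs_le; lra).
    apply cos_decr_1; lra. }
  assert (Hy1 : Cmod (y - 1)%C <= d / 8).
  { apply Rle_trans with (1 := Cmod_expi_minus_1 _). unfold Rdiv at 1. rewrite Rabs_mult, Rabs_inv, (Rabs_right K) by lra.
    apply Rle_trans with (Rabs th * / 4); [|lra]. apply Rmult_le_compat_l; [apply Rabs_pos|]. apply Rinv_le_contravar; lra. }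
  assert (Hz : Cmod z = s) by (unfold z; rewrite Cmod_mult, Hy, Cmod_R, Rabs_right; lra).
  assert (Hz1 : Cmod (z - 1)%C < d).
  { unfold z. replace (y * RtoC s - 1)%C with (RtoC s * (y - 1) + - RtoC (1 - s))%C by (rewrite RtoC_minus; ring).
    apply Rle_lt_trans with (1 := Cmod_triangle _ _). rewrite Cmod_opp, Cmod_mult, !Cmod_R, !Rabs_right by lra.
    pose proof (Cmod_ge_0 (y - 1)%C). unfold rho in c2. nra. }
  assert (Et : t = (z ^ k)%C) by (unfold t, z; rewrite Eyk, Cpow_mult_l; reflexivity).
  rewrite Eh, Es, Et, (PC_ext _ (dir b y)) by (intros n; apply (dir_same_power k); assumption).
  rewrite (ray_dir g lam u du c b y s H Hcb Hb Hnp Hy) by lra. fold z. fold K.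
  pose proof (sing_near_pole k z Hk ltac:(lra) ltac:(lra)) as B1. fold K in B1.
  pose proof (HM0 z ltac:(split; lra)) as B2.
  assert (Hw : (z - 1)%C <> 0%C).
  { intros E. assert (Ez : z = 1%C) by (replace z with (z - 1 + 1)%C by ring; rewrite E; ring). rewrite Ez, Cmod_1 in Hz. lra. }
  set (X := ((RtoC K ^ 2 * z ^ k - RtoC K * (1 - z ^ k)) / (1 - z ^ k) ^ 2)%C) in *.
  replace (z ^ 2 * u z - X)%C with (z ^ 2 * (u z - / (z - 1) ^ 2) + (z ^ 2 / (z - 1) ^ 2 - X))%C by (field; exact Hw).
  apply Rle_trans with (1 := Cmod_triangle _ _). rewrite Cmod_mult, Cmod_pow, Hz.
  assert (s ^ 2 <= 1) by (apply pow_le_1; lra).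
  assert (0 <= s ^ 2) by (apply pow_le; lra).
  pose proof (Cmod_ge_0 (u z - / (z - 1) ^ 2)%C). unfold M. nra.
Qed.

(** * Normalisation of the nearest pole and conclusion *)

(** The values are c_4 = g / 20, c_5 = lam and c_6 = g3 / 28. A non-zero c_k can be rotated to a
    positive one. *)
Lemma first_coeff_neq_0 (g lam g3 : C) (k : nat) (c : nat -> C) :
  only_nonzero_parameter g lam g3 k -> rec g lam c -> c O = 1%C -> c 6%nat = (g3 / 28)%C -> c k <> 0%C.
Proof.
  intros Hone Hrec H0 H6.
  pose proof (fun n Hn => rec_solved g lam c n Hrec H0 Hn) as R.
  assert (Rz : forall n x y, x <> 0 -> (RtoC x * c n = y)%C -> c n = (y / RtoC x)%C).
  { intros n x y Hx E. rewrite <- E. field. apply RtoC_neq_0, Hx. }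
  assert (C1 : c 1%nat = 0%C).
  { pose proof (R 1%nat ltac:(lia)) as E. unfold forcing in E. cbn in E. apply Rz in E; [|lra]. rewrite E. field. apply RtoC_neq_0; lra. }
  assert (C2 : c 2%nat = 0%C).
  { pose proof (R 2%nat ltac:(lia)) as E. unfold forcing in E. cbn in E. rewrite C1 in E. apply Rz in E; [|lra]. rewrite E. field. apply RtoC_neq_0; lra. }
  assert (C3 : c 3%nat = 0%C).
  { pose proof (R 3%nat ltac:(lia)) as E. unfold forcing in E. cbn in E. rewrite C1, C2 in E. apply Rz in E; [|lra]. rewrite E. field. apply RtoC_neq_0; lra. }
  assert (C4 : (10 * c 4%nat = g / 2)%C).
  { pose proof (R 4%nat ltac:(lia)) as E. unfold forcing in E. cbn in E. rewrite C1, C2, C3 in E.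
    replace ((1 + 1 + 1 + 1 - 6) * (1 + 1 + 1 + 1 + 1)) with (-10) in E by ring.
    replace (10 * c 4%nat)%C with (- (-10 * c 4%nat))%C by ring. rewrite E. field. }
  assert (C5 : g = 0%C -> c 5%nat = lam).
  { intros Hg. pose proof (R 5%nat ltac:(lia)) as E. unfold forcing in E. cbn in E. rewrite C1, C2, C3 in E.
    replace ((1 + 1 + 1 + 1 + 1 - 6) * (1 + 1 + 1 + 1 + 1 + 1)) with (-6) in E by ring.
    apply Rz in E; [|lra]. rewrite E. field. }
  assert (H2 : RtoC 2 <> 0%C) by (apply RtoC_neq_0; lra). assert (H28 : RtoC 28 <> 0%C) by (apply RtoC_neq_0; lra).
  destruct Hone as [(Hn & _ & _ & ->)|[(Hg & Hn & _ & ->)|(_ & _ & Hn & ->)]]; intros E; apply Hn.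
  - rewrite E in C4. replace g with (2 * (g / 2))%C by field. rewrite <- C4. ring.
  - rewrite <- (C5 Hg). exact E.
  - replace g3 with (28 * (g3 / 28))%C by field. rewrite <- H6, E. ring.
Qed.

(** The one non-zero parameter has weight k, so the scaling multiplies it by xi^k = 1. *)
Lemma root_of_unity_invariant (g lam g3 : C) (k : nat) (u du : C -> C) (c : nat -> C) (xi : C) :
  only_nonzero_parameter g lam g3 k -> sol g lam u du c -> c 6%nat = (g3 / 28)%C -> (xi ^ k = 1)%C ->
  scaling_invariant u xi.
Proof.
  intros Hone H H6 Hxi.
  assert (Hxi0 : xi <> 0%C).
  { intros E. rewrite E in Hxi. destruct Hone as [(_ & _ & _ & ->)|[(_ & _ & _ & ->)|(_ & _ & _ & ->)]];
      apply (f_equal Re) in Hxi; simpl in Hxi; lra. }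
  assert (E3 : g3 = 0%C -> (xi ^ 6 * c 6%nat = c 6%nat)%C).
  { intros E. rewrite H6, E. field. }
  apply (sol_scaling_invariant g lam u du c xi H Hxi0);
    destruct Hone as [(_ & El & Eg3 & ->)|[(Eg & _ & Eg3 & ->)|(Eg & El & _ & ->)]];
    try (apply E3; assumption); rewrite ?Eg, ?El, ?Hxi; ring.
Qed.

(** If w^k <> 1, then Re (w^k) < 1 and the bound off the rays keeps [u] bounded near the end of the
    radius to [w], against the pole. *)
Lemma unit_pole_power (g lam : C) (u du : C -> C) (c : nat -> C) (k : nat) (b : nat -> R) (w : C) :
  sol g lam u du c -> (forall n, c n = RtoC (b n)) -> pos_coeffs k b -> cvr b 1 ->
  (forall z : C, z <> 0%C -> Cmod z < 1 -> ~ pole u z) -> Cmod w = 1 -> pole u w -> (w ^ k = 1)%C.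
Proof.
  intros H Hcb Hp Hb Hnp Hw Hpole.
  set (y := (w ^ k)%C). assert (Hy : Cmod y = 1) by (unfold y; rewrite Cmod_pow, Hw; apply pow1).
  pose proof (Cmod_sqr y) as E. rewrite Hy in E.
  assert (Hre : Re y <= 1) by (pose proof (re_le_Cmod y) as B; pose proof (Rle_abs (Re y)); lra).
  destruct (Rle_lt_dec 1 (Re y)) as [h|h].
  { assert (Er : Re y = 1) by lra. rewrite Er in E. assert (Ei : Im y = 0) by nra.
    apply injective_projections; assumption. }
  exfalso. destruct (away_bound k b Hp Hb (1 - Re y) ltac:(lra)) as [M HM].
  (* For s >= 1/2, passing from s^2 u to u costs at most a factor 4. *)
  destruct (Hpole (4 * Rabs M)) as [d [Hd B]].
  set (s := 1 - Rmin d 1 / 2). assert (Hm : 0 < Rmin d 1) by (apply Rmin_pos; lra).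
  pose proof (Rmin_l d 1). pose proof (Rmin_r d 1).
  assert (Hs : 1 / 2 <= s < 1) by (unfold s; lra).
  specialize (HM w s Hw ltac:(fold y; lra) ltac:(lra)).
  rewrite (ray_dir g lam u du c b w s H Hcb Hb Hnp Hw) in HM by lra.
  rewrite Cmod_mult, Cmod_pow, Cmod_mult, Hw, Cmod_R, Rabs_right, Rmult_1_l in HM by lra.
  assert (Ed : Cmod (w * RtoC s - w)%C = Rmin d 1 / 2).
  { replace (w * RtoC s - w)%C with (w * - RtoC (1 - s))%C by (rewrite RtoC_minus; ring).
    rewrite Cmod_mult, Hw, Cmod_opp, Cmod_R, Rabs_right; unfold s; lra. }
  specialize (B (w * RtoC s)%C).
  assert (Hlt : 4 * Rabs M < Cmod (u (w * RtoC s)%C)).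
  { apply B; [|lra]. intros Heq. rewrite Heq in Ed. replace (w - w)%C with (RtoC 0) in Ed by ring. rewrite Cmod_0 in Ed. lra. }
  pose proof (Rle_abs M). pose proof (Rabs_pos M). assert (1 / 4 <= s ^ 2) by nra. nra.
Qed.

Lemma normalized_coefficients_estimate (g lam g3 : C) (k : nat) (u du : C -> C) (c : nat -> C) (Omega : C) (F : nat -> C) :
  only_nonzero_parameter g lam g3 k -> sol g lam u du c -> c 6%nat = (g3 / 28)%C ->
  minimal_nonzero_pole u Omega -> normalized_coefficients c Omega F ->
  exists M, 0 <= M /\ forall n, (1 <= n)%nat ->
    Cmod (F (k * n)%nat - RtoC (INR k))%C <= M / (INR (k * n) - 1).
Proof.
  intros Hone H H6 (HO0 & HOp & HOmin) HF.
  rewrite is_pole_iff in HOp.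
  assert (Hk : (4 <= k <= 6)%nat) by (destruct Hone as [(_ & _ & _ & ->)|[(_ & _ & _ & ->)|(_ & _ & _ & ->)]]; lia).
  pose proof (first_coeff_neq_0 g lam g3 k c Hone (sol_rec _ _ _ _ _ H) (sol_c0 _ _ _ _ _ H) H6) as Hp0.
  assert (Hpm : 0 < Cmod (c k)) by (apply Cmod_gt_0, Hp0). assert (HOm : 0 < Cmod Omega) by (apply Cmod_gt_0, HO0).
  (* The phase [y] makes a^k c_k positive, and the modulus |Omega| of [a] puts the nearest poles on
     the unit circle; the image w = Omega / a may be any point of it so far. *)
  destruct (unit_root (RtoC (Cmod (c k)) / c k)%C k ltac:(lia)) as [y [Hy Eyk]].
  { rewrite Cmod_div by exact Hp0. rewrite Cmod_R, Rabs_right by lra. field. lra. }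
  set (a := (RtoC (Cmod Omega) * y)%C).
  assert (Ham : Cmod a = Cmod Omega) by (unfold a; rewrite Cmod_mult, Hy, Cmod_R, Rabs_right; lra).
  assert (Ha0 : a <> 0%C) by (apply Cmod_gt_0; lra).
  pose proof (sol_scale g lam u du c a Ha0 H) as Hs.
  set (v := fun z => (a ^ 2 * u (a * z))%C) in *. set (e := fun n => (a ^ n * c n)%C) in *.
  assert (Hpv : forall z, pole v z <-> pole u (a * z)%C).
  { intros z. apply pole_scale; [apply Cpow_nz, Ha0|exact Ha0]. }
  assert (Hone' : only_nonzero_parameter (a ^ 4 * g)%C (a ^ 5 * lam)%C (a ^ 6 * g3)%C k).
  { assert (Hm : forall n (x : C), x <> 0%C -> (a ^ n * x)%C <> 0%C) by (intros n x Hx; apply Cmult_neq_0; [apply Cpow_nz, Ha0|exact Hx]).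
    destruct Hone as [(X1 & -> & -> & ->)|[(-> & X1 & -> & ->)|(-> & -> & X1 & ->)]]; [left|right; left|right; right];
      repeat split; try (apply Hm; exact X1); ring. }
  assert (He6 : e 6%nat = (a ^ 6 * g3 / 28)%C) by (unfold e; rewrite H6; unfold Cdiv; ring).
  assert (Hek : e k = RtoC (Cmod Omega ^ k * Cmod (c k))).
  { unfold e, a. rewrite Cpow_mult_l, Eyk, RtoC_mult, RtoC_pow. field. exact Hp0. }
  destruct (sol_pos_coeffs _ _ _ k _ _ _ _ Hone' Hs He6 (Rmult_lt_0_compat _ _ (pow_lt _ k HOm) Hpm) Hek) as [b [Hcb Hpc]].
  assert (Hnp : forall z : C, z <> 0%C -> Cmod z < 1 -> ~ pole v z).
  { intros z Hz Hz1 Hp. rewrite Hpv in Hp. rewrite <- is_pole_iff in Hp.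
    specialize (HOmin (a * z)%C (Cmult_neq_0 _ _ Ha0 Hz) Hp). rewrite Cmod_mult, Ham in HOmin. nra. }
  assert (Hb : cvr b 1).
  { apply (sol_radius _ _ _ _ _ k b Hs Hcb Hpc). intros s Hs01. apply Hnp; [apply RtoC_neq_0; lra|].
    rewrite Cmod_R, Rabs_right; lra. }
  set (w := (Omega / a)%C).
  assert (Haw : (a * w)%C = Omega) by (unfold w; field; exact Ha0).
  assert (Hw : Cmod w = 1) by (unfold w; rewrite Cmod_div, Ham by exact Ha0; field; lra).
  assert (Hpw : pole v w) by (rewrite Hpv, Haw; exact HOp).
  pose proof (unit_pole_power _ _ _ _ _ k b w Hs Hcb Hpc Hb Hnp Hw Hpw) as Hwk.
  (* As w^k = 1, invariance of the rescaled solution moves its pole from [w] to 1. *)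
  assert (Hp1 : pole v 1%C).
  { destruct (root_of_unity_invariant _ _ _ k v _ e w Hone' Hs He6 Hwk 1%C) as [Hiff _].
    rewrite !is_pole_iff, Cmult_1_r in Hiff. apply Hiff, Hpw. }
  destruct (pos_coeffs_asymptotics _ _ _ _ _ k b Hs Hcb Hpc Hb Hnp Hp1) as [M HM].
  exists M. split; [apply Rle_trans with (2 := HM O), Rabs_pos|]. intros n Hn.
  assert (HN : 4 <= INR (k * n)) by (replace 4 with (INR 4) by (simpl; ring); apply le_INR; nia).
  specialize (HM (k * n)%nat). unfold sing, mult_of in HM. rewrite Nat.mul_comm, Nat.Div0.mod_mul, (Nat.mul_comm n k) in HM. simpl Nat.eqb in HM. cbv iota in HM.
  pose proof (HF (k * n)%nat ltac:(nia)) as EF.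
  set (m := (k * n)%nat) in *.
  (* Since k divides [m] and w^k = 1, the coefficient is the same whether it is scaled by [a] or by
     [Omega]. *)
  assert (EO : (Omega ^ m * c m)%C = RtoC (b m)).
  { rewrite <- Hcb. unfold e. rewrite <- Haw, Cpow_mult_l. unfold m at 2. rewrite (Cpow_mult_r w), Hwk, Cpow_1_l. ring. }
  assert (Hden : RtoC (INR m - 1) <> 0%C) by (apply RtoC_neq_0; lra).
  assert (EFm : F m = RtoC (b m / (INR m - 1))).
  { rewrite RtoC_div by lra. rewrite <- EO, EF, <- RtoC_minus. field. split; [apply Cpow_nz, HO0|exact Hden]. }
  rewrite EFm, <- RtoC_minus, Cmod_R.
  replace (b m / (INR m - 1) - INR k) with ((b m - (INR m - 1) * (INR k * 1)) / (INR m - 1)) by (field; lra).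
  unfold Rdiv. rewrite Rabs_mult, (Rabs_right (/ _)) by (apply Rle_ge; left; apply Rinv_0_lt_compat; lra).
  apply Rmult_le_compat_r; [left; apply Rinv_0_lt_compat; lra|exact HM].
Qed.

Local Open Scope C_scope.

Theorem proposition3p1 :
  forall (g2 lambda g3 : C) (k : nat) (u : C -> C) (c : nat -> C),
    only_nonzero_parameter g2 lambda g3 k ->
    is_solution g2 lambda g3 u c ->
    (forall xi : C, xi ^ k = 1 -> scaling_invariant u xi)
    /\
    (forall (Omega : C) (F : nat -> C),
       minimal_nonzero_pole u Omega ->
       normalized_coefficients c Omega F ->
       filterlim (fun n : nat => F (k * n)%nat) eventually
         (locally (RtoC (INR k)))).
Proof.
  intros g2 lambda g3 k u c Hone Hsol.
  destruct (sol_of_is_solution g2 lambda g3 u c Hsol) as [du H].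
  assert (H6 : c 6%nat = g3 / 28) by apply Hsol.
  split.
  - intros xi Hxi. exact (root_of_unity_invariant g2 lambda g3 k u du c xi Hone H H6 Hxi).
  - intros Omega F HO HF.
    destruct (normalized_coefficients_estimate g2 lambda g3 k u du c Omega F Hone H H6 HO HF) as [M [HM0 HM]].
    assert (Hk : (4 <= k)%nat) by (destruct Hone as [(_ & _ & _ & ->)|[(_ & _ & _ & ->)|(_ & _ & _ & ->)]]; lia).
    apply filterlim_locally. intros eps.
    (* For n > N this gives k n - 1 >= N - 1 > M / eps. *)
    destruct (INR_unbounded (M / eps + 1)) as [N HN].
    exists (S N). intros n Hn.
    apply C_NormedModule_mixin_compat1.
    apply Rle_lt_trans with (1 := HM n ltac:(lia)).
    pose proof (cond_pos eps) as Heps.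
    assert (HNn : (INR N <= INR (k * n))%R) by (apply le_INR; nia).
    assert (HMe : (0 <= M / eps)%R) by (apply Rmult_le_pos; [exact HM0|left; apply Rinv_0_lt_compat, Heps]).
    assert (Hd : (0 < INR (k * n) - 1)%R) by lra.
    apply Rmult_lt_reg_r with (1 := Hd).
    replace (M / (INR (k * n) - 1) * (INR (k * n) - 1))%R with M by (field; lra).
    replace M with (eps * (M / eps))%R at 1 by (field; lra).
    apply Rmult_lt_compat_l; lra.
Qed.
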